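(* Let $n\ge 2$, $2\le s\le n$, let $k_1,\dots,k_s$ be positive integers with $k_1+\cdots+k_s=n$, let $\mu_1,\dots,\mu_s$ be pairwise distinct real numbers, and let $\omega=\frac{\sqrt{-1}}{2}\operatorname{diag}(\mu_1I_{k_1},\dots,\mu_sI_{k_s})$, with associated decomposition $\mathfrak u(n)=\mathfrak k\oplus\mathfrak m$. For every integer $L\ge 1$, the $(L+2)$-th Fordy-Kulish NLS equation $$Q_t=\widetilde X'^{(L+2)}=[\omega,V'^{(L+2)}[Q]]\qquad (Q\in\mathfrak m)$$ is equivalent to the $L$-th Langer-Perline LIE equation $$\gamma_t=X'^{(L)}\qquad(\gamma\in\mathfrak u(n),\ \gamma_x\in\{g^{-1}\omega g: g\in U(n)\}),$$ in the following sense, where $I\subset\mathbb R$ is an open interval and all maps are smooth on $\mathbb R\times I\ni(x,t)$. (a) If $Q:\mathbb R\times I\to\mathfrak m$ solves the $(L+2)$-th Fordy-Kulish NLS equation, then there exist $E:\mathbb R\times I\to U(n)$ and $\gamma:\mathbb R\times I\to\mathfrak u(n)$ with $E_x=QE$ and $\gamma_x=E^{-1}\omega E$ such that $\gamma$ solves the $L$-th Langer-Perline LIE equation. (b) If $\gamma:\mathbb R\times I\to\mathfrak u(n)$, with $\gamma_x(x,t)\in\{g^{-1}\omega g: g\in U(n)\}$ for all $(x,t)$, solves the $L$-th Langer-Perline LIE equation, then there exist $E:\mathbb R\times I\to U(n)$ and $Q:\mathbb R\times I\to\mathfrak m$ with $\gamma_x=E^{-1}\omega E$ and $E_x=QE$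 such that $Q$ solves the $(L+2)$-th Fordy-Kulish NLS equation.
   Context: $\mathfrak u(n)$ is the Lie algebra of skew-Hermitian $n\times n$ matrices. Write $n\times n$ matrices in $s\times s$ block form with block sizes $k_1,\dots,k_s$. $\mathfrak k=\ker(\mathrm{ad}_\omega)\subset\mathfrak u(n)$ is the set of block diagonal matrices in $\mathfrak u(n)$ and $\mathfrak m\subset\mathfrak u(n)$ is the set of those with zero diagonal blocks; subscripts $\mathfrak k,\mathfrak m$ denote the components of an element of $\mathfrak u(n)$. The operator $\mathrm{ad}_\omega:\mathfrak m\to\mathfrak m$, $X\mapsto[\omega,X]$, is invertible with inverse $\mathrm{ad}_\omega^{-1}$ (multiplication of the $(i,j)$ block, $i\ne j$, by $-2\sqrt{-1}/(\mu_i-\mu_j)$). For $Q=Q(x,t)\in\mathfrak m$ the matrices $V'^{(j)}=V'^{(j)}[Q]=V'^{(j)}_{\mathfrak m}+V'^{(j)}_{\mathfrak k}$ are defined by $V'^{(0)}=\omega$ and, for $j\ge1$, $$V'^{(j)}_{\mathfrak m}=\mathrm{ad}_\omega^{-1}\big(\partial_xV'^{(j-1)}_{\mathfrak m}-[Q,V'^{(j-1)}_{\mathfrak k}]-[Q,V'^{(j-1)}_{\mathfrak m}]_{\mathfrak m}\big),\qquad \partial_xV'^{(j)}_{\mathfrak k}=[Q,V'^{(j)}_{\mathfrak m}]_{\mathfrak k},$$ where the integration constants in $V'^{(j)}_{\mathfrak k}$ are chosen to be zero, i.e. $V'^{(j)}_{\mathfrak k}$ is the solution which is a polynomial without constant term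 in the entries of $Q$ and of its $x$-derivatives. (For example $V'^{(1)}=Q$ and $V'^{(2)}=\mathrm{ad}_\omega^{-1}Q_x+\frac12[Q,\mathrm{ad}_\omega^{-1}Q]_{\mathfrak k}$.) The $L$-th Fordy-Kulish NLS equation is $Q_t=\widetilde X'^{(L)}:=[\omega,V'^{(L)}]$. Equivalently $\widetilde X'^{(1)}=[\omega,Q]$ and $\widetilde X'^{(L)}=\widetilde{\mathcal R}_{red}\widetilde X'^{(L-1)}$, with $\widetilde{\mathcal R}_{red}B=(\partial_x-\mathrm{ad}_Q\,\partial_x^{-1}\,(\mathrm{ad}_Q\,\cdot)_{\mathfrak k}-(\mathrm{ad}_Q\,\cdot)_{\mathfrak m})\,\mathrm{ad}_\omega^{-1}B$. For $\gamma$ with $\gamma_x\in\{g^{-1}\omega g\}$, choose a frame $E\in U(n)$ with $\gamma_x=E^{-1}\omega E$ and $Q:=E_xE^{-1}\in\mathfrak m$, and write $\{B\}=E^{-1}BE$. The vector fields $X'^{(L)}$ along $\gamma$ are $X'^{(0)}=\{\omega\}$, $X'^{(L)}=\mathcal R_{red}X'^{(L-1)}$, where $\mathcal R_{red}(Y)=\mathcal P(\mathrm{ad}_{\{\omega\}}^{-2}[\gamma_x,\partial_xY])$, $\mathrm{ad}_{\{\omega\}}^{-1}\{B_{\mathfrak m}\}=\{\mathrm{ad}_\omega^{-1}B_{\mathfrak m}\}$ and $\mathcal P(\{B\})=\{(\partial_x^{-1}[Q,B_{\mathfrak m}])_{\mathfrak k}+B_{\mathfrak m}\}$. With the integration constants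 in $\partial_x^{-1}$ chosen to be zero, i.e. with each $(\partial_x^{-1}[Q,B_{\mathfrak m}])_{\mathfrak k}$ occurring in this recursion taken to be the antiderivative of $[Q,B_{\mathfrak m}]_{\mathfrak k}$ which is a polynomial without constant term in the entries of $Q$ and of its $x$-derivatives, $X'^{(L)}=\{V'^{(L)}[Q]\}=E^{-1}V'^{(L)}[Q]E$, and this does not depend on the choice of frame $E$. The $L$-th Langer-Perline LIE equation is $\gamma_t=X'^{(L)}$. *)

(* Defs.v *)
From mathcomp Require Export all_boot all_order all_algebra.
From mathcomp Require Export all_classical all_reals all_analysis.
From mathcomp Require Export complex finmap.
(* The notations of monalg clash with those of mathcomp-analysis. *)
From mathcomp Require Export -(notations) monalg.

Set Implicit Arguments.
Unset Strict Implicit.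
Unset Printing Implicit Defensive.

Import Order.TTheory GRing.Theory Num.Theory.
Import numFieldNormedType.Exports.

Local Open Scope classical_set_scope.
Local Open Scope ring_scope.
Local Open Scope sesquilinear_scope.
Local Open Scope complex_scope.

Section Calculus.
Context {R : realType}.

(* R[i] carries no normed R-module structure in the library, hence the
   differentiation of real and imaginary parts. *)
Definition mxderive {m n} (A : R -> 'M[R[i]]_(m, n)) (x : R) :
    'M[R[i]]_(m, n) :=
  \matrix_(i, j) (derive1 (fun y => complex.Re (A y i j)) x
                  +i* derive1 (fun y => complex.Im (A y i j)) x).

Definition dx {m n} (A : R -> R -> 'M[R[i]]_(m, n)) (x t : R) :=
  mxderive (A ^~ t) x.

Definition dt {m n} (A : R -> R -> 'M[R[i]]_(m, n)) (x t : R) :=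
  mxderive (A x) t.

Definition smooth1 (f : R -> R) : Prop :=
  forall (k : nat) (x : R), derivable (derive1n k f) x 1.

(* Class C^k on the strip of all (x, t) with t in I. *)
Fixpoint Ck (k : nat) (I : set R) (f : R -> R -> R) : Prop :=
  (forall x t, I t -> {for (x, t), continuous (fun z : R * R => f z.1 z.2)}) /\
  match k with
  | 0 => True
  | k'.+1 =>
    [/\ forall x t, I t -> derivable (f ^~ t) x 1 /\ derivable (f x) t 1,
        Ck k' I (fun x t => derive1 (f ^~ t) x)
      & Ck k' I (fun x t => derive1 (f x) t)]
  end.

Definition smooth2 (I : set R) (f : R -> R -> R) : Prop := forall k, Ck k I f.

Definition smooth1_mx {m n} (A : R -> 'M[R[i]]_(m, n)) : Prop :=
  forall i j, smooth1 (fun x => complex.Re (A x i j)) /\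
              smooth1 (fun x => complex.Im (A x i j)).

Definition smooth2_mx {m n} (I : set R) (A : R -> R -> 'M[R[i]]_(m, n)) :
    Prop :=
  forall i j, smooth2 I (fun x t => complex.Re (A x t i j)) /\
              smooth2 I (fun x t => complex.Im (A x t i j)).

End Calculus.

Section DifferentialPolynomials.
Context {R : realType} {n : nat}.

(* The variable (a, b, k) stands for the k-th x-derivative of the (a, b) entry
   of an n x n matrix valued function. *)
Definition jetvar : choiceType := ('I_n * 'I_n * nat)%type.

Definition dpoly := malg (cmonom jetvar) R[i].

Definition dpvar (v : jetvar) : dpoly := mkmalgU (ucm v) 1.

Definition dpconst (c : R[i]) : dpoly := mkmalgU mone c.

Definition const_term (p : dpoly) : R[i] := mcoeff mone p.

(* Leibniz rule: v_1^e_1 ... v_r^e_r is sent to the sum over i of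
   e_i (v_1^e_1 ... v_i^(e_i - 1) ... v_r^e_r) v_i'. *)
Definition dp_monD (m : cmonom jetvar) : dpoly :=
  \sum_(v <- finsupp m)
    mkmalgU (mmul (divcm m (ucm v)) (ucm (v.1, v.2.+1))) (m v)%:R.

Definition dpD (p : dpoly) : dpoly := mmap dpconst dp_monD p.

(* D^-1 with zero integration constant: the antiderivative q of p without
   constant term. It is unique when it exists, D q = 0 holding only for
   constants q. Without an antiderivative the value is a dummy 0; in the
   recursions below every p is a total derivative. *)
Definition dpDinv (p : dpoly) : dpoly :=
  xget 0 [set q | dpD q = p /\ const_term q = 0].

Definition dpeval (Q : R -> 'M[R[i]]_n) (p : dpoly) (x : R) : R[i] :=
  mmap idfun
    (fun m : cmonom jetvar =>
       \prod_(v <- finsupp m)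
         (iter v.2 mxderive Q x) v.1.1 v.1.2 ^+ m v) p.

Definition dpeval_mx (Q : R -> 'M[R[i]]_n) (P : 'M[dpoly]_n) (x : R) :
    'M[R[i]]_n :=
  map_mx (fun p => dpeval Q p x) P.

End DifferentialPolynomials.

Arguments dpoly R n : clear implicits.

Definition comm {A : pzRingType} {n} (X Y : 'M[A]_n) : 'M[A]_n :=
  X *m Y - Y *m X.

Section Blocks.
Context {R : realType} {s : nat} (k : 'I_s -> nat) (mu : 'I_s -> R).

Local Notation n := (\sum_i k i)%N.

Definition kpart {A : nmodType} (X : 'M[A]_n) : 'M[A]_n :=
  \mxblock_(i, j) (if i == j then submxblock X i j else 0).

Definition mpart {A : nmodType} (X : 'M[A]_n) : 'M[A]_n :=
  \mxblock_(i, j) (if i == j then 0 else submxblock X i j).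

Definition in_u (X : 'M[R[i]]_n) : Prop :=
  X \is hermitianmx n true Num.conj.

Definition in_m (X : 'M[R[i]]_n) : Prop :=
  in_u X /\ forall i, submxblock X i i = 0.

Definition omega : 'M[R[i]]_n :=
  ('i%C / 2%:R) *: \mxdiag_(i < s) ((mu i)%:C)%:M.

Definition in_orbit (X : 'M[R[i]]_n) : Prop :=
  exists2 g : 'M[R[i]]_n, g \is unitarymx & X = invmx g *m omega *m g.

(* Differential polynomials in Q with values in gl(n); those below restrict to
   maps into u(n) when Q takes its values in m. *)
Local Notation Dmx := 'M[dpoly R n]_n.

Definition omegaD : Dmx := map_mx dpconst omega.

(* The generic element Q of m; its jet variables inside diagonal blocks are
   unused. *)
Definition QD : Dmx := mpart (\matrix_(a, b) dpvar (a, b, 0%N)).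

Definition ad_omega_inv (X : Dmx) : Dmx :=
  \mxblock_(i, j)
    (if i == j then 0
     else map_mx (fun p => (- 2%:R * 'i%C / (mu i - mu j)%:C) *: p)
                 (submxblock X i j)).

Fixpoint FK_V (j : nat) : Dmx :=
  match j with
  | 0 => omegaD
  | j'.+1 =>
    let V := FK_V j' in
    let Vm := ad_omega_inv
                (map_mx dpD (mpart V) - comm QD (kpart V)
                 - mpart (comm QD (mpart V))) in
    Vm + map_mx dpDinv (kpart (comm QD Vm))
  end.

(* Vector fields {B} = E^-1 B E along curves are represented by B. With
   E_x = Q E, hence (E^-1)_x = - E^-1 Q, one has
   d/dx {B} = {D B + B Q - Q B} = {D B - [Q, B]}. *)
Definition frame_dx (B : Dmx) : Dmx := map_mx dpD B - comm QD B.

Definition LP_P (B : Dmx) : Dmx :=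
  map_mx dpDinv (kpart (comm QD (mpart B))) + mpart B.

(* R_red Y = P (ad_{omega}^-2 [gamma_x, Y_x]) for Y = {B}, where
   gamma_x = {omega} and all brackets are taken inside { }. *)
Definition LP_Rred (B : Dmx) : Dmx :=
  LP_P (ad_omega_inv (ad_omega_inv (comm omegaD (frame_dx B)))).

Definition LP_X (L : nat) : Dmx := iter L LP_Rred omegaD.

(* Q_t = [omega, V'^(L)[Q]] on R x I *)
Definition FK_solution (L : nat) (I : set R) (Q : R -> R -> 'M[R[i]]_n) :
    Prop :=
  forall x t, I t -> dt Q x t = comm omega (dpeval_mx (Q ^~ t) (FK_V L) x).

Definition is_frame (c E Q : R -> 'M[R[i]]_n) : Prop :=
  [/\ smooth1_mx E,
      forall x, E x \is unitarymx,
      forall x, mxderive c x = invmx (E x) *m omega *m E x,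
      forall x, mxderive E x = Q x *m E x
    & forall x, in_m (Q x)].

(* gamma_t = X'^(L) on R x I. The right-hand side at time t involves only the
   curve gamma(., t), and does not depend on the chosen frame of this curve. *)
Definition LIE_solution (L : nat) (I : set R) (gamma : R -> R -> 'M[R[i]]_n) :
    Prop :=
  forall t, I t -> exists E Q : R -> 'M[R[i]]_n,
    is_frame (gamma ^~ t) E Q /\
    forall x, dt gamma x t = invmx (E x) *m dpeval_mx Q (LP_X L) x *m E x.

End Blocks.

(* Main.v *)
Require Import Defs.
From HB Require Import structures.
From mathcomp Require Import ring lra zify.

(* Let T = 1 + sum_(j >= 1) T_j lambda^-j be the dressing series with
   off-diagonal T_j, given by
   [omega, T_(j+1)] = D T_j - Q T_j + sum_i T_i (Q T_(j-i))_k. Then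
   V = T omega T^-1 satisfies D V_j = [Q, V_j] + [omega, V_(j+1)]. As D has only
   constants in its kernel, the V_j are both the FK_V j and the LP_X j. In terms
   of T no antiderivative is left, and T^* T commutes with omega, whence V_j[Q]
   takes values in u(n).

   If Q solves the NLS equation then, with W = V_(L+1)[Q], the system E_x = Q E,
   E_t = W E has zero curvature, and the system gamma_x = E^-1 omega E,
   gamma_t = E^-1 V_L[Q] E is closed.

   Conversely, for A = gamma_x the matrices P = E^-1 Q E and
   N_j = E^-1 V_j[Q] E are polynomials in the spectral projections of A and in
   x-derivatives, hence smooth in t although a frame is given for each t
   separately. The equation makes A_t = [A, N_(L+1)], and A_x = [A, P]; equality
   of mixed derivatives then yields [A, Z] = 0 for the curvature Z of the system
   F_x = - P F, F_t = - N_(L+1) F. Since P and the x-derivative of N_(L+1) are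
   commutators with A, so is Z, and hence Z = 0. The inverse E of F is a frame
   with E_t = E N_(L+1). *)

Set Implicit Arguments.
Unset Strict Implicit.
Unset Printing Implicit Defensive.

Import Order.TTheory GRing.Theory Num.Theory.
Import numFieldNormedType.Exports.

Local Open Scope classical_set_scope.
Local Open Scope ring_scope.
Local Open Scope complex_scope.

(** * Linear differential equations with parameters *)

(** The recursions pick antiderivatives by a choice, about which nothing is known until the
    integrand is seen to be a total derivative; the dressing series provides the antiderivative in
    advance. With [h_i = (Q T_i)_k], its recursion says that [T] conjugates [D - Q - lambda omega]
    into the block diagonal operator [D - h - lambda omega]. The latter commutes with [omega], so
    the former commutes with [V = T omega T^-1], and the diagonal blocks of this relation display
    [D] of the diagonal part of [V_j] as the integrand. The step from [[A, Z] = 0] and [Z = [A, U]]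
    to [Z = 0] rests on [A] being diagonalizable: kernel and image of [ad A] then meet only in [0].
    Both directions need linear systems on a whole strip, with solutions smooth in both variables.
    They are integrated in [t] along [x = 0] and then in [x] for each [t]; regularity in [t] is
    recovered from Gronwall estimates on difference quotients, and higher regularity from the
    equations themselves. *)

Section Derivatives.
Context {R : realType}.
Implicit Types (f g : R -> R) (x a b : R).

Lemma is_derive1D f g x a b : is_derive x 1 f a -> is_derive x 1 g b ->
  is_derive x 1 (fun y => f y + g y) (a + b).
Proof. exact: is_deriveD. Qed.

Lemma is_derive1N f x a : is_derive x 1 f a ->
  is_derive x 1 (fun y => - f y) (- a).
Proof. exact: is_deriveN. Qed.

Lemma is_derive1B f g x a b : is_derive x 1 f a -> is_derive x 1 g b ->
  is_derive x 1 (fun y => f y - g y) (a - b).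
Proof. exact: is_deriveB. Qed.

Lemma is_derive1M f g x a b : is_derive x 1 f a -> is_derive x 1 g b ->
  is_derive x 1 (fun y => f y * g y) (a * g x + f x * b).
Proof.
move=> fa gb; apply: (is_derive_eq (is_deriveM _ _)).
by rewrite /GRing.scale/= addrC [g x * a]mulrC.
Qed.

Lemma is_derive1Mr f x a (c : R) : is_derive x 1 f a ->
  is_derive x 1 (fun y => f y * c) (a * c).
Proof.
move=> fa; apply: (is_derive_eq (is_derive1M fa (is_derive_cst c x 1))).
by rewrite mulr0 addr0.
Qed.

Lemma is_derive1_sum (J : Type) (r : seq J) (h : J -> R -> R) (d : J -> R) x :
  (forall j, is_derive x 1 (h j) (d j)) ->
  is_derive x 1 (fun y => \sum_(j <- r) h j y) (\sum_(j <- r) d j).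
Proof.
move=> hd; elim: r => [|j r IH].
  rewrite big_nil (_ : (fun y => _) = cst 0); first exact: is_derive_cst.
  by apply/funext => y; rewrite big_nil.
rewrite big_cons (_ : (fun y => _) = fun y => h j y + \sum_(j <- r) h j y).
  exact: is_derive1D.
by apply/funext => y; rewrite big_cons.
Qed.

Lemma is_derive1_continuous f x a : is_derive x 1 f a -> {for x, continuous f}.
Proof. by case=> fx _; exact/differentiable_continuous/derivable1_diffP. Qed.

Lemma is_derive1_derivable f x a : is_derive x 1 f a -> derivable f x 1.
Proof. by case. Qed.

Lemma is_derive1_val f x a : is_derive x 1 f a -> derive1 f x = a.
Proof. by move=> fa; rewrite derive1E derive_val. Qed.

Lemma derivable_is_derive1 f x : derivable f x 1 ->
  is_derive x 1 f (derive1 f x).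
Proof. by move=> fx; rewrite derive1E; exact: derivableP. Qed.

Lemma le_is_derive f g df dg a b : a <= b ->
  (forall x, a <= x <= b -> is_derive x 1 f (df x)) ->
  (forall x, a <= x <= b -> is_derive x 1 g (dg x)) ->
  (forall x, a <= x <= b -> df x <= dg x) ->
  f a <= g a -> f b <= g b.
Proof.
move=> ab fd gd fg fga.
have hd x : a <= x <= b -> is_derive x 1 (fun y => g y - f y) (dg x - df x).
  by move=> xab; apply: is_derive1B; [exact: gd|exact: fd].
have [||c + E] := MVT_segment (df := fun x => dg x - df x)
  (f := fun y => g y - f y) ab.
- move=> x; rewrite in_itv/= => /andP[ax xb]; apply: hd.
  by rewrite !ltW.
- apply: derivable_within_continuous => x; rewrite in_itv/= => xab.
  exact: is_derive1_derivable (hd x xab).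
rewrite in_itv/= => cab.
have : 0 <= (dg c - df c) * (b - a).
  by rewrite mulr_ge0// subr_ge0// fg.
rewrite -E; lra.
Qed.

(** Parametrising the segment over [[0, 1]] treats [a <= b] and [b <= a] at once, so that the
    estimates below hold on both sides of an initial point. *)
Definition segpath (a b s : R) : R := a + s * (b - a).

Lemma segpath_itv (S : set R) a b s : is_interval S -> S a -> S b ->
  0 <= s <= 1 -> S (segpath a b s).
Proof.
move=> iS Sa Sb /andP[s0 s1]; rewrite /segpath.
have [ab|ba] := leP a b.
  by apply: (iS a b) => //; apply/andP; split; nra.
by apply: (iS b a) => //; apply/andP; split; nra.
Qed.

Lemma is_derive_segpath f df a b s :
  is_derive (segpath a b s) 1 f (df (segpath a b s)) ->
  is_derive s 1 (f \o segpath a b) (df (segpath a b s) * (b - a)).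
Proof.
move=> fd; apply: is_derive1_comp => //.
have H : is_derive s 1 (fun y : R => a + y * (b - a)) (0 + (1 * (b - a) + s * 0)).
  by apply: is_derive1D; apply: is_derive1M.
by apply: (is_derive_eq H); lra.
Qed.

Lemma is_derive_expRM (K s : R) :
  is_derive s 1 (fun y => expR (K * y)) (K * expR (K * s)).
Proof.
have : is_derive s 1 (expR \o (fun y => K * y)) (expR (K * s) * (0 * s + K * 1)).
  apply: is_derive1_comp.
  exact: (is_derive1M (is_derive_cst K s 1) (is_derive_id s 1)).
by move=> /is_derive_eq; apply; lra.
Qed.

(** Along the segment from [a] to [b], the product of [u + e] and [expR (- C |b - a| s)] is
    nonincreasing. The shift [e] makes room for an inhomogeneous term. *)
Lemma gronwall (S : set R) (u du : R -> R) (C e a b : R) :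
  is_interval S -> S a -> S b -> 0 <= C ->
  (forall x, S x -> is_derive x 1 u (du x)) ->
  (forall x, S x -> `|du x| <= C * (u x + e)) ->
  u b + e <= (u a + e) * expR (C * `|b - a|).
Proof.
move=> iS Sa Sb C0 ud duC.
have hv (s : R) : 0 <= s <= 1 ->
    is_derive s 1 (fun s : R => (u (segpath a b s) + e) * expR (- (C * `|b - a|) * s))
      ((du (segpath a b s) * (b - a)) * expR (- (C * `|b - a|) * s)
       + (u (segpath a b s) + e) *
         (- (C * `|b - a|) * expR (- (C * `|b - a|) * s))).
  move=> s01; apply: is_derive1M; last exact: is_derive_expRM.
  rewrite -[X in is_derive _ _ _ X]addr0; apply: is_derive1D.
  by apply: (@is_derive_segpath u du); apply: ud; exact: segpath_itv.
have := @le_is_derive _ (cst ((u a + e))) _ (cst 0) 0 1 ler01 hv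
  (fun x _ => is_derive_cst _ _ _).
rewrite /segpath !mulr0 mul0r expR0 mulr1 addr0 mul1r mulr1.
rewrite [a + _]addrC subrK => /(_ _ (lexx _)) H.
have {}H : (u b + e) * expR (- (C * `|b - a|)) <= u a + e.
  apply: H => s s01 /=; rewrite mulrA -mulrDl.
  rewrite pmulr_lle0 ?expR_gt0//.
  have Ss := segpath_itv iS Sa Sb s01.
  have := duC _ Ss; rewrite -/(segpath a b s).
  set x := segpath a b s; move=> xC.
  have h1 : du x * (b - a) <= `|du x| * `|b - a|.
    by rewrite -normrM ler_norm.
  have h2 : `|du x| * `|b - a| <= C * (u x + e) * `|b - a|.
    by rewrite ler_wpM2r.
  by rewrite mulrN subr_le0; nra.
by rewrite -ler_pdivrMr ?expR_gt0// -expRN.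
Qed.

(** Integrating [K] times the weight [expR (2 K |x - a|)] gains a factor [1 / 2]. Measured against
    this weight, a Picard step is a contraction on segments of any length. *)
Lemma weighted_bound (S : set R) (g dg : R -> R) (B K a b : R) :
  is_interval S -> S a -> S b -> 0 <= B -> 0 < K ->
  (forall x, S x -> is_derive x 1 g (dg x)) ->
  (forall x, S x -> `|dg x| <= K * (B * expR (2 * K * `|x - a|))) ->
  g a = 0 -> `|g b| <= B / 2 * expR (2 * K * `|b - a|).
Proof.
move=> iS Sa Sb B0 K0 gd dgB ga0.
have key (h dh : R -> R) : (forall x, S x -> is_derive x 1 h (dh x)) ->
    (forall x, S x -> `|dh x| <= K * (B * expR (2 * K * `|x - a|))) ->
    h a = 0 -> h b <= B / 2 * expR (2 * K * `|b - a|).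
  move=> hd dhB ha0.
  have := @le_is_derive (h \o segpath a b)
    (fun s : R => expR (2 * K * `|b - a| * s) * (B / 2)) _ _ 0 1 ler01
    (fun (s : R) s01 => @is_derive_segpath h dh a b s (hd _ (segpath_itv iS Sa Sb s01)))
    (fun (s : R) _ => is_derive1Mr _ (is_derive_expRM _ _)).
  rewrite /comp /segpath !(mulr0, mul0r, mul1r, mulr1, addr0, expR0) ha0.
  rewrite [a + _]addrC subrK [_ * (B / 2)]mulrC; apply; last by rewrite divr_ge0.
  move=> s s01; have Ss := segpath_itv iS Sa Sb s01.
  have := dhB _ Ss; rewrite -/(segpath a b s); set x := segpath a b s => xB.
  apply: (le_trans (ler_norm _)); rewrite normrM.
  have := ler_wpM2r (normr_ge0 (b - a)) xB; move=> /le_trans; apply.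
  have -> : `|x - a| = s * `|b - a|.
    rewrite /x /segpath addrC addKr normrM ger0_norm//.
    by case/andP: s01.
  rewrite (_ : 2 * K * (s * `|b - a|) = 2 * K * `|b - a| * s); last by ring.
  by rewrite le_eqVlt; apply/orP; left; apply/eqP; field.
have h1 := key _ _ gd dgB ga0.
have h2 : - g b <= B / 2 * expR (2 * K * `|b - a|).
  apply: (key (fun x => - g x) (fun x => - dg x)).
  - by move=> x /gd; exact: is_derive1N.
  - by move=> x /dgB; rewrite normrN.
  - by rewrite ga0 oppr0.
by rewrite ler_norml; apply/andP; split => //; lra.
Qed.

Lemma lipschitz_bound (S : set R) (g dg : R -> R) (M a b : R) :
  is_interval S -> S a -> S b ->
  (forall x, S x -> is_derive x 1 g (dg x)) ->
  (forall x, S x -> `|dg x| <= M) ->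
  `|g b - g a| <= M * `|b - a|.
Proof.
move=> iS Sa Sb gd dgM.
have key (h dh : R -> R) : (forall x, S x -> is_derive x 1 h (dh x)) ->
    (forall x, S x -> `|dh x| <= M) -> h b - h a <= M * `|b - a|.
  move=> hd dhM.
  have := @le_is_derive (h \o segpath a b)
    (fun s : R => h a + s * (M * `|b - a|)) _ _ 0 1 ler01
    (fun (s : R) s01 => @is_derive_segpath h dh a b s (hd _ (segpath_itv iS Sa Sb s01)))
    (fun (s : R) _ => is_derive1D (is_derive_cst (h a) s 1)
       (is_derive1Mr _ (is_derive_id s 1))).
  rewrite /comp /segpath !(mul0r, mul1r, addr0) [a + _]addrC subrK add0r.
  move=> H; rewrite lerBlDl; apply: H => // s s01.
  apply: (le_trans (ler_norm _)); rewrite normrM ler_wpM2r//; apply: dhM.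
  exact: segpath_itv.
have h1 := key _ _ gd dgM.
have h2 : - g b - (- g a) <= M * `|b - a|.
  apply: (key (fun x => - g x) (fun x => - dg x)).
  - by move=> x /gd; exact: is_derive1N.
  - by move=> x /dgM; rewrite normrN.
by rewrite ler_norml; apply/andP; split => //; lra.
Qed.

End Derivatives.

Section Antiderivative.
Context {R : realType}.
Implicit Types (S : set R) (f : R -> R).

Lemma open_margin S x : open S -> S x ->
  exists2 e, 0 < e & forall y, `|y - x| <= e -> S y.
Proof.
move=> oS Sx; have /nbhs_ballP[e e0 eS] : nbhs x S by exact: open_nbhs_nbhs.
exists (e / 2); first by rewrite divr_gt0.
move=> y yx; apply: eS; rewrite /ball/= distrC (le_lt_trans yx)//.
by rewrite ltr_pdivrMr// ltr_pMr// ltr1n.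
Qed.

Lemma open_itv_cover S x y : open S -> is_interval S -> S x -> S y ->
  exists a b, [/\ S a, S b, a < x < b & a < y < b].
Proof.
move=> oS iS Sx Sy.
wlog xy : x y Sx Sy / x <= y.
  move=> H; have [xy|/ltW yx] := leP x y; first exact: H.
  by have [a [b [? ? ? ?]]] := H _ _ Sy Sx yx; exists a, b.
have [e e0 eS] := open_margin oS Sx; have [d d0 dS] := open_margin oS Sy.
exists (x - e), (y + d); split; try lra.
  by apply: eS; rewrite addrAC subrr add0r normrN ger0_norm// ltW.
by apply: dS; rewrite addrAC subrr add0r ger0_norm// ltW.
Qed.

Lemma exists_antiderivative S f x0 : open S -> is_interval S -> S x0 ->
  (forall x, S x -> {for x, continuous f}) ->
  exists F, F x0 = 0 /\ forall x, S x -> is_derive x 1 F (f x).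
Proof.
move=> oS iS Sx0 cf; pose mu := @lebesgue_measure R.
pose I u v := (\int[mu]_(t in `[u, v]) f t)%R.
exists (fun x => if x0 <= x then I x0 x else - I x x0); split.
  by rewrite lexx /I set_itv1 Rintegral_set1.
move=> x Sx; have [a [b [Sa Sb ax abx0]]] := open_itv_cover oS iS Sx Sx0.
have intf u v : a <= u -> v <= b -> mu.-integrable `[u, v] (EFin \o f).
  move=> au vb; apply: continuous_compact_integrable.
    exact: segment_compact.
  apply: continuous_in_subspaceT => y /set_mem/=; rewrite in_itv/= => /andP[uy yv].
  apply: cf; apply: (iS a b) => //.
  by rewrite (le_trans au uy) (le_trans yv vb).
have split_int u v : a <= u -> u <= v -> v <= b -> I u v = I a v - I a u.
  move=> au uv vb; rewrite /I; symmetry.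
  have := @Rintegral_itvB R f (BLeft a) (BRight v) u.
  rewrite /= => ->; last 3 first.
  - exact: intf.
  - by rewrite bnd_simp.
  - by rewrite bnd_simp.
  rewrite Rintegral_itv_obnd_cbnd//.
  by apply: integrableS (intf u v au vb) => //; exact: subset_itv_oc_cc.
have Gd : is_derive x 1 (I a) (f x).
  have [||||G1 G2] := @continuous_FTC1_closed R f a x b.
  - lra.
  - exact: intf.
  - lra.
  - exact: cf.
  by rewrite -G2; exact: derivable_is_derive1.
(* Near [x] the candidate equals [I a y - I a x0] with a fixed left end [a], whatever the order of
   [y] and [x0]. *)
have Gd' : is_derive x 1 (fun y => I a y - I a x0) (f x).
  rewrite -[f x]subr0; apply: is_derive1B => //.
apply: near_eq_is_derive Gd'.
have : nbhs x `]a, b[%classic.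
  by apply: open_nbhs_nbhs; split; [exact: interval_open|rewrite /= in_itv].
apply: filterS => y /=; rewrite in_itv/= => ayb.
move: abx0 ayb => /andP[ax0 x0b] /andP[ay yb].
have [h|h] := leP x0 y; first by rewrite (split_int x0)// ltW.
by rewrite (split_int y) ?opprB// ltW.
Qed.

End Antiderivative.

(** * Linear systems on an open interval, by Picard iteration *)

Section LinearODE.
Context {R : realType}.
Implicit Types (S : set R).

Lemma cvg_geo0 (E : R) : (fun m : nat => E / 2 ^+ m) @ \oo --> (0 : R).
Proof.
rewrite -[X in _ --> X](mulr0 E); apply: cvgM; first exact: cvg_cst.
have := @cvg_expr R (2^-1); rewrite ger0_norm ?invr_ge0// invf_lt1// ltr1n.
move=> /(_ isT); apply: cvg_trans; apply: near_eq_cvg.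
by near=> m; rewrite /= exprVn.
Unshelve. all: by end_near. Qed.

Lemma geo_le0 (d E : R) : (forall m : nat, `|d| <= E / 2 ^+ m) -> d = 0.
Proof.
move=> dE; apply/eqP; rewrite -normr_le0.
rewrite -(cvg_lim _ (cvg_geo0 E))//; apply: limr_ge; last exact: nearW.
by apply/cvg_ex; exists 0; exact: cvg_geo0.
Qed.

(** For [g m = 2 E / 2 ^ m] one has [g m.+1 = g m - E / 2 ^ m], so [u m - g m] is nondecreasing and
    [u m + g m] nonincreasing. The limit is the supremum of the lower ends of these nested
    intervals. *)
Lemma geo_limit (u : nat -> R) (E : R) :
  (forall m, `|u m.+1 - u m| <= E / 2 ^+ m) ->
  forall m, `|u m - limn u| <= 2 * E / 2 ^+ m.
Proof.
move=> uE; pose g m := 2 * E / 2 ^+ m.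
have gS m : g m.+1 = g m - E / 2 ^+ m.
  by rewrite /g exprS; field; rewrite expf_neq0.
have g0 m : 0 <= g m.
  have := le_trans (normr_ge0 _) (uE m); rewrite /g -mulrA => h.
  by rewrite mulr_ge0.
have vS m : u m - g m <= u m.+1 - g m.+1.
  by have := uE m; rewrite ler_norml gS => /andP[? ?]; lra.
have wS m : u m.+1 + g m.+1 <= u m + g m.
  by have := uE m; rewrite ler_norml gS => /andP[? ?]; lra.
have v_homo m n : (m <= n)%N -> u m - g m <= u n - g n.
  move=> /subnK <-; elim: (n - m)%N => // k IH; rewrite addSn.
  exact: le_trans IH (vS _).
have w_homo m n : (m <= n)%N -> u n + g n <= u m + g m.
  move=> /subnK <-; elim: (n - m)%N => // k IH; rewrite addSn.
  exact: le_trans (wS _) IH.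
have vw m n : u m - g m <= u n + g n.
  have := v_homo _ _ (leq_maxl m n); have := w_homo _ _ (leq_maxr m n).
  by have := g0 (maxn m n); lra.
pose A := [set u m - g m | m in setT].
have supA : has_sup A.
  split; first by exists (u 0%N - g 0%N), 0%N.
  by exists (u 0%N + g 0%N) => _ [m _ <-].
have uL m : `|u m - sup A| <= g m.
  have h1 : u m - g m <= sup A by apply: ub_le_sup; [case: supA|exists m].
  have h2 : sup A <= u m + g m.
    by apply: ge_sup; [case: supA|move=> _ [n _ <-]].
  by rewrite ler_norml; apply/andP; split; lra.
suff -> : limn u = sup A by [].
apply: cvg_lim => //; apply/cvgrPdist_lt => e e0.
have /cvgrPdist_lt/(_ e e0) := cvg_geo0 (2 * E); apply: filterS => m.
rewrite sub0r normrN => /(le_lt_trans (ler_norm _)); apply: le_lt_trans.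
by rewrite distrC.
Qed.

Lemma continuous_segment_bounded (f : R -> R) (a b : R) :
  (forall x, a <= x <= b -> {for x, continuous f}) ->
  exists2 M, 0 <= M & forall x, a <= x <= b -> `|f x| <= M.
Proof.
move=> cf; have [ab|ba] := leP a b; last first.
  by exists 0 => // x /andP[/le_trans h /h]; rewrite leNgt ba.
have [|c _ fc] := @EVT_max R (fun x => `|f x|) a b ab.
  apply: continuous_in_subspaceT => x /set_mem/=; rewrite in_itv/= => xab.
  by apply: continuous_comp (cf _ xab) _; exact: norm_continuous.
by exists `|f c| => // x xab; apply: fc; rewrite in_itv.
Qed.

Lemma continuous_segment_bounded2 (J K : finType) (f : J -> K -> R -> R) (a b : R) :
  (forall j k x, a <= x <= b -> {for x, continuous (f j k)}) ->
  exists2 M, 0 <= M & forall j k x, a <= x <= b -> `|f j k x| <= M.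
Proof.
move=> cf.
have /choice[M MP] (jk : J * K) : exists M, 0 <= M /\
    forall x, a <= x <= b -> `|f jk.1 jk.2 x| <= M.
  by have [M M0 fM] := continuous_segment_bounded (cf jk.1 jk.2); exists M.
exists (\sum_jk M jk).
  by apply: sumr_ge0 => jk _; case: (MP jk).
move=> j k x xab; rewrite (bigD1 (j, k))//=.
apply: (le_trans ((MP (j, k)).2 x xab)); rewrite lerDl.
by apply: sumr_ge0 => jk _; case: (MP jk).
Qed.

Lemma continuous_lincomb (J : finType) (a y : J -> R -> R) x :
  (forall k, {for x, continuous (a k)}) -> (forall k, {for x, continuous (y k)}) ->
  {for x, continuous (fun x => \sum_k a k x * y k x)}.
Proof.
move=> ca cy; elim: (index_enum J) => [|k r IH].
  rewrite (_ : (fun x => _) = cst 0); first exact: cvg_cst.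
  by apply/funext => z; rewrite big_nil.
rewrite (_ : (fun x => _) = fun x => a k x * y k x + \sum_(k <- r) a k x * y k x).
  by apply: cvgD => //; apply: cvgM; [exact: ca|exact: cy].
by apply/funext => z; rewrite big_cons.
Qed.

(** The iterates converge uniformly on every segment in [S] around [s0]. By linearity, a bound of
    the coefficients on the segment controls all iterates, hence the solution exists on all of
    [S]. *)
Theorem linear_ode (J : finType) S (a : J -> J -> R -> R) (c : J -> R) s0 :
  open S -> is_interval S -> S s0 ->
  (forall j k x, S x -> {for x, continuous (a j k)}) ->
  exists y : J -> R -> R, (forall j, y j s0 = c j) /\
    forall j x, S x -> is_derive x 1 (y j) (\sum_k a j k x * y k x).
Proof.
move=> oS iS Ss0 ca.
(* An antiderivative is fixed for every function, without requirement on discontinuous ones, so that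
   the iteration is a total map; continuity of the iterates is proved afterwards. *)
have /choice[anti antiP] (f : R -> R) : exists F,
    (forall x, S x -> {for x, continuous f}) ->
    F s0 = 0 /\ forall x, S x -> is_derive x 1 F (f x).
  have [cf|ncf] := pselect (forall x, S x -> {for x, continuous f}).
    by have [F FP] := exists_antiderivative oS iS Ss0 cf; exists F.
  by exists 0.
pose rhs (y : J -> R -> R) j x := \sum_k a j k x * y k x.
pose next (y : J -> R -> R) j x := c j + anti (rhs y j) x.
pose Y m := iter m next (fun j => cst (c j)).
have crhs y : (forall k x, S x -> {for x, continuous (y k)}) ->
    forall j x, S x -> {for x, continuous (rhs y j)}.
  by move=> cy j x Sx; apply: continuous_lincomb => k; [exact: ca|exact: cy].
have nextd y : (forall k x, S x -> {for x, continuous (y k)}) ->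
    forall j, next y j s0 = c j /\
      forall x, S x -> is_derive x 1 (next y j) (rhs y j x).
  move=> cy j; have [y0 yd] := antiP (rhs y j) (crhs y cy j).
  split; first by rewrite /next y0 addr0.
  by move=> x Sx; rewrite -[rhs y j x]add0r; apply: is_derive1D => //; exact: yd.
have cY m : forall k x, S x -> {for x, continuous (Y m k)}.
  elim: m => [|m IH] k x Sx; first exact: cvg_cst.
  exact: is_derive1_continuous ((nextd _ IH k).2 x Sx).
have est al be : S al -> S be -> al <= s0 <= be -> exists E K, [/\ 0 <= E, 0 <= K,
    (forall y N x j, al <= x <= be -> (forall k, `|y k x| <= N) ->
       `|rhs y j x| <= K * N) &
    (forall m j x, al <= x <= be -> `|Y m.+1 j x - Y m j x| <= E / 2 ^+ m)].
  move=> Sal Sbe s0ab.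
  have Sab x : al <= x <= be -> S x by exact: iS.
  have [M M0 aM] := continuous_segment_bounded2
    (fun j k x xab => ca j k x (Sab x xab)).
  have [B0 B00 YB0] := continuous_segment_bounded2 (J := J) (K := unit)
    (f := fun j _ x => Y 1%N j x - Y 0%N j x)
    (fun j _ x xab => cvgB (cY 1%N j x (Sab x xab)) (cY 0%N j x (Sab x xab))).
  (* [M * #|J|] bounds the right-hand side in terms of the largest component; the [1] keeps [K]
     positive, as [weighted_bound] requires. *)
  pose K := M * #|J|%:R + 1.
  have K0 : 0 < K by rewrite ltr_pwDr// mulr_ge0.
  have rhsK (y : J -> R -> R) N x j : al <= x <= be ->
      (forall k, `|y k x| <= N) -> `|rhs y j x| <= K * N.
    move=> xab yN.
    have N0 : 0 <= N := le_trans (normr_ge0 _) (yN j).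
    apply: (le_trans (ler_norm_sum _ _ _)).
    apply: (@le_trans _ _ (\sum_(k : J) M * N)).
      by apply: ler_sum => k _; rewrite normrM ler_pM// aM.
    by rewrite sumr_const cardT -cardE -mulr_natr /K; nra.
  exists (B0 * expR (2 * K * (be - al))), K.
  split => //; [by rewrite mulr_ge0// expR_ge0|exact: ltW|].
  pose T : set R := [set x | al <= x <= be].
  have iT : is_interval T.
    move=> x y /andP[x1 x2] /andP[y1 y2] z /andP[xz zy].
    by apply/andP; split; [exact: le_trans x1 xz|exact: le_trans zy y2].
  have H m : forall j x, al <= x <= be ->
      `|Y m.+1 j x - Y m j x| <= B0 / 2 ^+ m * expR (2 * K * `|x - s0|).
    elim: m => [|m IH] j x xab.
      rewrite expr0 divr1; apply: (le_trans (YB0 j tt x xab)).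
      rewrite ler_peMr// -[leLHS]expR0 ler_expR.
      by rewrite !mulr_ge0// ltW.
    rewrite (_ : B0 / 2 ^+ m.+1 = B0 / 2 ^+ m / 2); last first.
      by rewrite exprS; field; rewrite expf_neq0.
    apply: (@weighted_bound _ T (fun x => Y m.+2 j x - Y m.+1 j x)
      (fun x => rhs (Y m.+1) j x - rhs (Y m) j x)) => //.
    - by rewrite divr_ge0// exprn_ge0.
    - move=> z /Sab Sz; apply: is_derive1B.
        exact: ((nextd _ (cY m.+1) j).2 z Sz).
      exact: ((nextd _ (cY m) j).2 z Sz).
    - move=> z Tz; rewrite /rhs -sumrB.
      under eq_bigr do rewrite -mulrBr.
      by apply: (rhsK (fun k z => Y m.+1 k z - Y m k z)) => // k; exact: IH.
    - by rewrite /Y /= !(nextd _ _ j).1 ?subrr//; exact: (cY m.+1) || exact: (cY m).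
  move=> m j x xab; apply: (le_trans (H m j x xab)).
  rewrite mulrAC ler_pM2r ?invr_gt0 ?exprn_gt0//.
  apply: ler_wpM2l => //; rewrite ler_expR ler_pM2l ?mulr_gt0//.
  case/andP: xab => ? ?; case/andP: s0ab => ? ?.
  by rewrite ler_norml; apply/andP; split; lra.
pose y j x := limn (fun m => Y m j x).
have cy : forall k x, S x -> {for x, continuous (y k)}.
  move=> k x Sx.
  have [al [be [Sal Sbe xab s0ab]]] := open_itv_cover oS iS Sx Ss0.
  have [|E [K [E0 K0 _ YE]]] := est al be Sal Sbe; first by lra.
  have YL m z : al <= z <= be -> `|Y m k z - y k z| <= 2 * E / 2 ^+ m.
    by move=> zab; apply: (@geo_limit (fun m => Y m k z)) => n; exact: YE.
  apply/cvgrPdist_lt => e e0.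
  have [m mE] : exists m : nat, 2 * E / 2 ^+ m < e / 3.
    have /cvgrPdist_lt/(_ (e / 3)) := cvg_geo0 (2 * E).
    rewrite divr_gt0// => /(_ isT)[m _ /(_ m (leqnn m))].
    by rewrite sub0r normrN => /(le_lt_trans (ler_norm _)); exists m.
  have := cY m k x Sx => /cvgrPdist_lt/(_ (e / 3)).
  rewrite divr_gt0// => /(_ isT) H.
  have : nbhs x `]al, be[%classic.
    by apply: open_nbhs_nbhs; split; [exact: interval_open|rewrite /= in_itv].
  move: H; apply: filterS2 => z H /=; rewrite in_itv/= => zab.
  have h1 := YL m x; have h2 := YL m z.
  have {}h1 : `|Y m k x - y k x| < e / 3 by apply: le_lt_trans (h1 _) mE; lra.
  have {}h2 : `|Y m k z - y k z| < e / 3 by apply: le_lt_trans (h2 _) mE; lra.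
  move: h1 h2 H; rewrite !ltr_norml => /andP[? ?] /andP[? ?] /andP[? ?].
  by apply/andP; split; lra.
(* The derivative of [next y] is [rhs y] by construction. What remains is that the limit [y] is a
   fixed point of [next], which [geo_le0] extracts from the geometric bounds. *)
exists (next y); split; first by move=> j; case: (nextd y cy j).
suff E x : S x -> forall j, next y j x = y j x.
  move=> j x Sx; have := (nextd y cy j).2 x Sx; rewrite /rhs.
  by under eq_bigr do rewrite -E//.
move=> Sx j.
have [al [be [Sal Sbe xab s0ab]]] := open_itv_cover oS iS Sx Ss0.
have [|E [K [E0 K0 rhsK YE]]] := est al be Sal Sbe; first by lra.
have YL m k z : al <= z <= be -> `|Y m k z - y k z| <= 2 * E / 2 ^+ m.
  by move=> zab; apply: (@geo_limit (fun m => Y m k z)) => n; exact: YE.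
apply/eqP; rewrite -subr_eq0; apply/eqP.
apply: (@geo_le0 _ (K * (2 * E) * `|x - s0| + 2 * E)) => m.
pose T : set R := [set x | al <= x <= be].
have iT : is_interval T.
  move=> u v /andP[x1 x2] /andP[y1 y2] z /andP[xz zy].
  by apply/andP; split; [exact: le_trans x1 xz|exact: le_trans zy y2].
have Ts0 : T s0 by rewrite /T/=; lra.
have Tx : T x by rewrite /T/=; lra.
have := @lipschitz_bound R T (fun x => next y j x - Y m.+1 j x)
  (fun x => rhs y j x - rhs (Y m) j x) (K * (2 * E / 2 ^+ m)) s0 x iT Ts0 Tx.
rewrite {2}/Y /= !(nextd _ _ j).1//; last exact: cY.
rewrite subrr subr0 => H.
have {}H : `|next y j x - Y m.+1 j x| <= K * (2 * E / 2 ^+ m) * `|x - s0|.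
  apply: H => z Tz.
    have Sz : S z by exact: (iS al be).
    apply: is_derive1B; first exact: ((nextd y cy j).2 z Sz).
    exact: ((nextd _ (cY m) j).2 z Sz).
  rewrite /rhs -sumrB; under eq_bigr do rewrite -mulrBr.
  apply: (rhsK (fun k z => y k z - Y m k z)) => // k.
  by rewrite distrC; exact: YL.
have h2 : `|Y m.+1 j x - y j x| <= 2 * E / 2 ^+ m.
  apply: (le_trans (YL m.+1 j x Tx)); rewrite ler_wpM2l ?mulr_ge0//.
  rewrite lef_pV2 ?posrE ?exprn_gt0// exprS ler_peMl ?exprn_ge0//.
  by rewrite ler1n.
rewrite -[X in `|X|](subrKA (Y m.+1 j x)); apply: (le_trans (ler_normD _ _)).
rewrite mulrDl; apply: lerD => //; apply: (le_trans H).
by rewrite le_eqVlt; apply/orP; left; apply/eqP; ring.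
Qed.

End LinearODE.

(** * Joint continuity and energy estimates *)

Section JointContinuity.
Context {R : realType}.

Definition jcont (f : R -> R -> R) (x t : R) :=
  {for (x, t), continuous (fun z : R * R => f z.1 z.2)}.

Lemma jcontP (f : R -> R -> R) x t : jcont f x t <->
  forall e : R, 0 < e -> exists2 d : R, 0 < d &
    forall y s, `|y - x| < d -> `|s - t| < d -> `|f y s - f x t| < e.
Proof.
split.
  move=> /cvgrPdist_lt cf e e0; have := cf e e0.
  move=> /nbhs_ballP[d /= d0 dP]; exists d => // y s yx st.
  by rewrite distrC; apply: (dP (y, s)); split; rewrite /ball/= distrC.
move=> H; apply/cvgrPdist_lt => e e0; have [d d0 dP] := H e e0.
exists (ball x d, ball t d); first by split; exact: nbhsx_ballx.
move=> [y s] [/= yx st].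
by rewrite distrC; apply: dP; rewrite distrC.
Qed.

Lemma jcont_x f x t : jcont f x t -> {for x, continuous (f ^~ t)}.
Proof.
move=> /jcontP cf; apply/cvgrPdist_lt => e /cf[d d0 dP].
apply/nbhs_ballP; exists d => //= y yx; rewrite distrC; apply: dP.
  by rewrite distrC.
by rewrite subrr normr0.
Qed.

Lemma jcont_t f x t : jcont f x t -> {for t, continuous (f x)}.
Proof.
move=> /jcontP cf; apply/cvgrPdist_lt => e /cf[d d0 dP].
apply/nbhs_ballP; exists d => //= y yx; rewrite distrC; apply: dP.
  by rewrite subrr normr0.
by rewrite distrC.
Qed.

(** Compactness of the segment turns joint continuity at the points [(x, t)] into one radius [d]
    valid for all [x]. *)
Lemma tube (f : R -> R -> R) (a b t : R) :
  (forall x, a <= x <= b -> jcont f x t) ->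
  forall e : R, 0 < e -> exists2 d : R, 0 < d &
    forall x s, a <= x <= b -> `|s - t| < d -> `|f x s - f x t| < e.
Proof.
move=> cf e e0.
have /compact_near_coveringP cpt := @segment_compact R a b.
have : nbhs t (fun s => `[a, b] `<=` (fun x => `|f x s - f x t| < e)).
  apply: (cpt R (nbhs t) (fun s x => `|f x s - f x t| < e)).
  move=> x; rewrite /= in_itv/= => xab; have /jcontP/(_ (e / 2)) := cf x xab.
  rewrite divr_gt0// => /(_ isT)[d d0 dP].
  exists (ball x d, ball t d); first by split; exact: nbhsx_ballx.
  move=> [y s] [/= yx st]; rewrite -[_ - _](subrKA (f x t)).
  rewrite (splitr e); apply: (le_lt_trans (ler_normD _ _)); apply: ltrD.
    by apply: dP; rewrite distrC.
  by rewrite distrC; apply: dP; rewrite distrC ?subrr ?normr0.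
move=> /nbhs_ballP[d /= d0 dP]; exists d => // x s xab st; apply: (dP s) => //=.
by rewrite /ball/= distrC.
Qed.

Lemma is_derive_epsP (g : R -> R) (t d : R) : is_derive t 1 g d <->
  forall e : R, 0 < e -> exists2 r : R, 0 < r & forall h : R, h != 0 -> `|h| < r ->
    `|(g (t + h) - g t) / h - d| <= e.
Proof.
have E h : h^-1 *: (g (h *: 1 + t) - g t) = (g (t + h) - g t) / h.
  by rewrite /GRing.scale/= mulr1 [h + t]addrC mulrC.
split=> [gd e e0|H].
  have [dg gE] := gd; have : h^-1 *: (g (h *: 1 + t) - g t) @[h --> 0^'] --> d.
    by rewrite -gE.
  move=> /cvgrPdist_le/(_ e e0).
  move=> /nbhs_ballP[r r0 rP]; exists r => // h h0 hr.
  by rewrite -E distrC; apply: rP => //; rewrite /ball/= sub0r normrN.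
have cvd : h^-1 *: (g (h *: 1 + t) - g t) @[h --> 0^'] --> d.
  apply/cvgrPdist_le => e e0; have [r r0 rP] := H e e0.
  apply/nbhs_ballP; exists r => //= h; rewrite /ball/= sub0r normrN => hr h0.
  by rewrite distrC E; exact: rP.
split; first by apply/cvg_ex; exists d.
exact: cvg_lim cvd.
Qed.

(** [gronwall] for the energy, the sum of the [D_j ^ 2]: the products are split by
    [2 p q <= p ^ 2 + q ^ 2], and the source [rho] enters the additive constant [#|J| r ^ 2]. *)
Lemma system_gronwall (J : finType) (S : set R) (A : J -> J -> R -> R)
    (D rho : J -> R -> R) (M r a b : R) :
  is_interval S -> S a -> S b -> 0 <= M -> 0 <= r ->
  (forall j x, S x -> is_derive x 1 (D j) (\sum_k A j k x * D k x + rho j x)) ->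
  (forall j k x, S x -> `|A j k x| <= M) ->
  (forall j x, S x -> `|rho j x| <= r) ->
  \sum_j D j b ^+ 2 + #|J|%:R * r ^+ 2 <=
  (\sum_j D j a ^+ 2 + #|J|%:R * r ^+ 2) * expR ((2 * M * #|J|%:R + 1) * `|b - a|).
Proof.
move=> iS Sa Sb M0 r0 Dd AM rhor; set n := #|J|%:R.
have n0 : 0 <= n :> R by rewrite ler0n.
have sumc (c : R) : \sum_(j : J) c = n * c.
  by rewrite sumr_const -mulr_natl.
apply: (@gronwall R S (fun x => \sum_j D j x ^+ 2)
  (fun x => \sum_j 2 * D j x * (\sum_k A j k x * D k x + rho j x))) => //.
- by rewrite addr_ge0// !mulr_ge0.
- move=> x Sx; apply: is_derive1_sum => j.
  have H := is_derive1M (Dd j x Sx) (Dd j x Sx).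
  rewrite (_ : (fun y => _) = fun y => D j y * D j y); last first.
    by apply/funext => y; rewrite expr2.
  by apply: (is_derive_eq H); ring.
- move=> x Sx; apply: (le_trans (ler_norm_sum _ _ _)).
  set u := \sum_j D j x ^+ 2.
  have u0 : 0 <= u by apply: sumr_ge0 => j _; exact: sqr_ge0.
  apply: (@le_trans _ _ (\sum_j (M * (n * D j x ^+ 2 + u) + (D j x ^+ 2 + r ^+ 2)))).
    apply: ler_sum => j _; rewrite mulrDr; apply: (le_trans (ler_normD _ _)).
    apply: lerD.
      rewrite mulr_sumr; apply: (le_trans (ler_norm_sum _ _ _)).
      apply: (@le_trans _ _ (\sum_k M * (D j x ^+ 2 + D k x ^+ 2))).
        apply: ler_sum => k _; rewrite !normrM (ger0_norm (ler0n _ 2)).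
        rewrite -[D j x ^+ 2]real_normK ?num_real// -[D k x ^+ 2]real_normK ?num_real//.
        have := AM j k x Sx; have := normr_ge0 (A j k x).
        have := normr_ge0 (D j x); have := normr_ge0 (D k x).
        set p := `|D j x|; set q := `|D k x|; set c := `|A j k x| => q0 p0 c0 cM.
        rewrite mulrCA mulrA [c * _]mulrC.
        apply: (@le_trans _ _ (2 * p * q * M)); last first.
          by have := sqr_ge0 (p - q); nra.
        rewrite (_ : 2 * p * c * q = 2 * p * q * c); last by ring.
        by rewrite ler_wpM2l// !mulr_ge0.
      by rewrite -mulr_sumr big_split/= sumc.
    rewrite !normrM (ger0_norm (ler0n _ 2)).
    rewrite -[D j x ^+ 2]real_normK ?num_real//.
    have := rhor j x Sx; have := normr_ge0 (rho j x); have := normr_ge0 (D j x).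
    set p := `|D j x|; set q := `|rho j x| => p0 q0 qr.
    have := sqr_ge0 (p - r); nra.
  rewrite big_split/= -mulr_sumr !big_split/= -mulr_sumr !sumc -/u.
  have : 0 <= M * n * (n * r ^+ 2) by rewrite !mulr_ge0// sqr_ge0.
  nra.
Qed.

End JointContinuity.

(** * Dependence of linear systems on the parameter *)

Section Parameters2.
Context {R : realType} {J : finType}.

Lemma itv_segment_interval (a b : R) : is_interval [set x | a <= x <= b].
Proof.
move=> u v /= /andP[x1 x2] /andP[y1 y2] z /andP[xz zy].
by apply/andP; split; [exact: le_trans x1 xz|exact: le_trans zy y2].
Qed.

Lemma ball_interval (t d : R) : is_interval [set s | `|s - t| < d].
Proof.
move=> u v /=; rewrite !ltr_norml => /andP[? ?] /andP[? ?] s /andP[? ?]; rewrite ltr_norml.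
by apply/andP; split; lra.
Qed.

Lemma family_radius (P : J -> R -> Prop) :
  (forall j, exists2 d : R, 0 < d & forall h, `|h| < d -> P j h) ->
  exists2 d : R, 0 < d & forall j h, `|h| < d -> P j h.
Proof.
move=> H.
have {H} H j : \forall h \near (0 : R), P j h.
  have [d d0 dP] := H j; apply/nbhs_ballP; exists d => // h.
  by rewrite /ball/= sub0r normrN; exact: dP.
have : \forall h \near (0 : R), forall j, P j h.
  exact: (@filter_forall R J P (nbhs (0:R))).
move=> /nbhs_ballP[d /= d0 dP]; exists d => // j h hd; apply: dP.
by rewrite /ball/= sub0r normrN.
Qed.

Lemma tube_family (f : J -> J -> R -> R -> R) (a b t0 eta : R) : 0 < eta ->
  (forall j k x, jcont (f j k) x t0) ->
  exists2 d : R, 0 < d & forall j k h, `|h| < d ->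
    forall x, a <= x <= b -> `|f j k x (t0 + h) - f j k x t0| < eta.
Proof.
move=> eta0 cf.
have H j : exists2 d : R, 0 < d & forall h, `|h| < d -> forall k x,
    a <= x <= b -> `|f j k x (t0 + h) - f j k x t0| < eta.
  have H k : exists2 d : R, 0 < d & forall h, `|h| < d -> forall x,
      a <= x <= b -> `|f j k x (t0 + h) - f j k x t0| < eta.
    have [d d0 dP] := tube (fun x (_ : a <= x <= b) => cf j k x) eta0.
    exists d => // h hd x Tx; apply: dP => //.
    by rewrite addrC addKr.
  have [d d0 dP] := family_radius H.
  by exists d => // h hd k x Tx; exact: dP.
have [d d0 dP] := family_radius H.
by exists d => // j k h hd x Tx; exact: dP.
Qed.

(** [z] solves the variational equation. The difference quotient minus [z] satisfies the linear
    system at parameter [t0 + h], with a source and an initial value that are small with [h]; the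
    energy estimate keeps it small up to [X]. *)
Lemma parameter_derivative (I : set R) (a at_ : J -> J -> R -> R -> R)
    (y : J -> R -> R -> R) (z : J -> R -> R) (t0 : R) :
  open I -> I t0 ->
  (forall j (x : R) t, I t ->
     is_derive x 1 (y j ^~ t) (\sum_k a j k x t * y k x t)) ->
  (forall j k x, jcont (a j k) x t0) ->
  (forall j k x (t : R), I t -> is_derive t 1 (a j k x) (at_ j k x t)) ->
  (forall j k x, jcont (at_ j k) x t0) ->
  (forall j (x : R), is_derive x 1 (z j)
     (\sum_k (at_ j k x t0 * y k x t0 + a j k x t0 * z k x))) ->
  (forall j, is_derive t0 1 (y j 0) (z j 0)) ->
  forall j x, is_derive t0 1 (y j x) (z j x).
Proof.
move=> oI It0 yd ca ad cat zd z0 j0 X.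
pose T : set R := [set x | - `|X| <= x <= `|X|].
have iT : is_interval T := @itv_segment_interval _ _.
have T0 : T 0 by rewrite /T/= oppr_le0 normr_ge0.
have TX : T X by rewrite /T/= -ler_norml.
have [i i0 iI] := open_margin oI It0.
have [A A0 aA] := continuous_segment_bounded2
  (fun j k x (_ : - `|X| <= x <= `|X|) => jcont_x (ca j k x)).
have [Y Y0 yY] := continuous_segment_bounded2 (K := unit)
  (f := fun j _ x => y j x t0)
  (fun j _ x (_ : - `|X| <= x <= `|X|) => is_derive1_continuous (yd j x t0 It0)).
have [Z Z0 zZ] := continuous_segment_bounded2 (K := unit)
  (f := fun j _ x => z j x)
  (fun j _ x (_ : - `|X| <= x <= `|X|) => is_derive1_continuous (zd j x)).
pose n : R := #|J|%:R; have n0 : 0 <= n by rewrite /n ler0n.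
have sumc (c : R) : n * c = \sum_(j : J) c.
  by rewrite sumr_const -mulr_natl.
(* With [|D_j| <= eta] at [0] and [|rho_j| <= n eta (Y + Z)], the energy estimate bounds the sum of
   squares at [X] by [eta ^ 2 W]. *)
pose W := (n + n * (n * (Y + Z)) ^+ 2) * expR ((2 * (A + 1) * n + 1) * `|X|).
have W0 : 0 <= W.
  by rewrite mulr_ge0 ?expR_ge0// addr_ge0// mulr_ge0// sqr_ge0.
apply/is_derive_epsP => e e0.
pose eta := Num.min 1 (e / (W + 1)).
have W1 : 0 < W + 1 by rewrite ltr_pwDr.
have eta0 : 0 < eta by rewrite lt_min ltr01 divr_gt0.
have eta1 : eta <= 1 by rewrite ge_min lexx.
have etaE : eta ^+ 2 * W <= e ^+ 2.
  have h : eta * (W + 1) <= e by rewrite -ler_pdivlMr// ge_min lexx orbT.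
  have : (eta * (W + 1)) ^+ 2 <= e ^+ 2.
    by rewrite ler_pXn2r// nnegrE ltW// mulr_gt0.
  apply: le_trans; rewrite exprMn ler_wpM2l ?sqr_ge0//; nra.
have [d1 d10 d1P] := tube_family (- `|X|) `|X| eta0 ca.
have [d2 d20 d2P] := tube_family (- `|X|) `|X| eta0 cat.
have [d3 d30 d3P] : exists2 d : R, 0 < d & forall j h, `|h| < d -> h != 0 ->
    `|(y j 0 (t0 + h) - y j 0 t0) / h - z j 0| <= eta.
  apply: (@family_radius (fun j h => h != 0 ->
    `|(y j 0 (t0 + h) - y j 0 t0) / h - z j 0| <= eta)) => j.
  have [r r0 rP] := (is_derive_epsP _ _ _).1 (z0 j) eta eta0.
  by exists r => // h hr h0; exact: rP.
exists (Num.min i (Num.min d1 (Num.min d2 d3))).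
  by rewrite !lt_min i0 d10 d20 d30.
move=> h h0; rewrite !lt_min => /and4P[hi hd1 hd2 hd3].
have Ih s : `|s - t0| < `|h| + 0 \/ s = t0 + h \/ `|s - t0| < i -> I s.
  case=> [|[->|/ltW]]; last exact: iI.
    by rewrite addr0 => /lt_trans/(_ hi)/ltW; exact: iI.
  by apply: iI; rewrite addrC addKr ltW.
have Ith : I (t0 + h) by apply: Ih; right; left.
pose D j x := (y j x (t0 + h) - y j x t0) / h - z j x.
(* Keeping the coefficients at [t0 + h] on [D] leaves in the source only the error of the difference
   quotient of [a] and the increment of [a], both at most [eta]. *)
pose rho j x := \sum_k (((a j k x (t0 + h) - a j k x t0) / h - at_ j k x t0)
    * y k x t0 + (a j k x (t0 + h) - a j k x t0) * z k x).
pose r := n * (eta * (Y + Z)).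
have r0 : 0 <= r by rewrite mulr_ge0// mulr_ge0 ?addr_ge0// ltW.
(* Mean value estimate for [a] minus its linear part at [t0], whose derivative is the increment of
   [at_] from [t0]. *)
have adiff j k x : T x ->
    `|(a j k x (t0 + h) - a j k x t0) / h - at_ j k x t0| <= eta.
  move=> Tx.
  pose S := [set s : R | `|s - t0| < Num.min i d2].
  have iS : is_interval S := @ball_interval _ _.
  have St0 : S t0 by rewrite /S/= subrr normr0 lt_min i0 d20.
  have Sth : S (t0 + h) by rewrite /S/= addrC addKr lt_min hi hd2.
  have := @lipschitz_bound R S (fun s => a j k x s - s * at_ j k x t0)
    (fun s => at_ j k x s - 1 * at_ j k x t0) eta t0 (t0 + h) iS St0 Sth.
  rewrite [t0 + h - t0]addrC addKr => H.
  rewrite -(@ler_pM2r _ `|h|) ?normr_gt0// -normrM mulrBl divfK//.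
  rewrite (_ : _ - _ = a j k x (t0 + h) - (t0 + h) * at_ j k x t0
             - (a j k x t0 - t0 * at_ j k x t0)); last by ring.
  apply: H => s; rewrite /S/= lt_min => /andP[si sd2].
    apply: is_derive1B; first by apply: ad; apply: Ih; right; right.
    exact: (is_derive1Mr _ (is_derive_id s 1)).
  rewrite mul1r.
  have := d2P j k (s - t0) sd2 x Tx; rewrite (addrC t0) subrK => /ltW; exact.
have Dd j x : T x -> is_derive x 1 (D j)
    (\sum_k a j k x (t0 + h) * D k x + rho j x).
  move=> Tx.
  have H := is_derive1B (is_derive1Mr h^-1
    (is_derive1B (yd j x (t0 + h) Ith) (yd j x t0 It0))) (zd j x).
  apply: (is_derive_eq H).
  rewrite -sumrB mulr_suml -sumrB -big_split/=; apply: eq_bigr => k _.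
  by rewrite /D; field.
have aA' j k x : T x -> `|a j k x (t0 + h)| <= A + 1.
  move=> Tx; rewrite -[a j k x _](subrK (a j k x t0)) addrC.
  apply: (le_trans (ler_normD _ _)); apply: lerD; first exact: aA.
  by apply: le_trans eta1; apply/ltW/d1P.
have rhor j x : T x -> `|rho j x| <= r.
  move=> Tx; apply: (le_trans (ler_norm_sum _ _ _)).
  rewrite /r sumc; apply: ler_sum => k _.
  rewrite mulrDr; apply: (le_trans (ler_normD _ _)).
  rewrite !normrM; apply: lerD; apply: ler_pM => //.
  - exact: adiff.
  - exact: (yY k tt x Tx).
  - by apply/ltW/d1P.
  - exact: (zZ k tt x Tx).
have A1 : 0 <= A + 1 by rewrite addr_ge0.
have := system_gronwall iT T0 TX A1 r0 Dd aA' rhor.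
rewrite subr0 -/n => G.
have D0 : \sum_j D j 0 ^+ 2 <= n * eta ^+ 2.
  rewrite sumc; apply: ler_sum => k _.
  rewrite -real_normK ?num_real// ler_pXn2r ?nnegrE ?(ltW eta0)//.
  exact: (d3P k h hd3 h0).
rewrite -/(D j0 X) -(@ler_pXn2r _ 2)// ?nnegrE ?(ltW e0)//.
rewrite real_normK ?num_real//; apply: le_trans etaE.
apply: (@le_trans _ _ (\sum_j D j X ^+ 2 + n * r ^+ 2)).
  rewrite (bigD1 j0)//= -addrA lerDl addr_ge0//; last first.
    by rewrite mulr_ge0// sqr_ge0.
  by apply: sumr_ge0 => j _; exact: sqr_ge0.
apply: (le_trans G); rewrite /W [leRHS]mulrA ler_wpM2r ?expR_ge0//.
rewrite /r; nra.
Qed.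

(** The energy estimate bounds all components near [(x0, t0)]. Hence [y] is Lipschitz in [x]
    uniformly in [t], and continuity in [t] on the line [x = x0] is enough. *)
Lemma jcont_solution (I : set R) (a : J -> J -> R -> R -> R)
    (y : J -> R -> R -> R) (x0 t0 : R) :
  open I -> I t0 ->
  (forall j (x : R) t, I t ->
     is_derive x 1 (y j ^~ t) (\sum_k a j k x t * y k x t)) ->
  (forall j k x, jcont (a j k) x t0) ->
  (forall j, {for t0, continuous (y j x0)}) ->
  forall j, jcont (y j) x0 t0.
Proof.
move=> oI It0 yd ca cy0 j0.
pose T : set R := [set x | x0 - 1 <= x <= x0 + 1].
have iT : is_interval T := @itv_segment_interval _ _.
have T0 : T x0 by rewrite /T/=; apply/andP; split; lra.
have [i i0 iI] := open_margin oI It0.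
have [A A0 aA] := continuous_segment_bounded2
  (fun j k x (_ : x0 - 1 <= x <= x0 + 1) => jcont_x (ca j k x)).
pose n : R := #|J|%:R; have n0 : 0 <= n by rewrite /n ler0n.
have sumc (c : R) : n * c = \sum_(j : J) c.
  by rewrite sumr_const -mulr_natl.
have [d1 d10 d1P] := tube_family (x0 - 1) (x0 + 1) ltr01 ca.
have cy0' eta : 0 < eta -> exists2 d : R, 0 < d & forall j h, `|h| < d ->
    `|y j x0 (t0 + h) - y j x0 t0| < eta.
  move=> eta0; apply: (@family_radius (fun j h =>
    `|y j x0 (t0 + h) - y j x0 t0| < eta)) => j.
  have /cvgrPdist_lt/(_ eta eta0)/nbhs_ballP[d /= d0 dP] := cy0 j.
  exists d => // h hd; rewrite distrC; apply: dP.
  by rewrite /ball/= opprD addNKr normrN.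
have [d2 d20 d2P] := cy0' 1 ltr01.
pose B := \sum_j (`|y j x0 t0| + 1) ^+ 2.
pose B2 := B * expR (2 * (A + 1) * n + 1).
have B0 : 0 <= B by apply: sumr_ge0 => j _; exact: sqr_ge0.
have B20 : 0 <= B2 by rewrite mulr_ge0// expR_ge0.
have ybound t j x : `|t - t0| < Num.min i (Num.min d1 d2) -> T x ->
    `|y j x t| <= B2 + 1.
  rewrite !lt_min => /and3P[ti td1 td2] Tx.
  have It : I t by apply/iI/ltW.
  have A1 : 0 <= A + 1 by rewrite addr_ge0.
  have aA' j' k x' : T x' -> `|a j' k x' t| <= A + 1.
    move=> Tx'; rewrite -[a j' k x' _](subrK (a j' k x' t0)) addrC.
    apply: (le_trans (ler_normD _ _)); apply: lerD; first exact: aA.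
    by have := d1P j' k _ td1 x' Tx'; rewrite [t0 + _]addrC subrK => /ltW.
  have := @system_gronwall R J T (fun j k x => a j k x t) (fun j x => y j x t)
    (fun _ _ => 0) (A + 1) 0 x0 x iT T0 Tx A1 (lexx _).
  rewrite expr0n/= mulr0 !addr0 -/n => G.
  have {}G : \sum_j y j x t ^+ 2 <= (\sum_j y j x0 t ^+ 2) *
      expR ((2 * (A + 1) * n + 1) * `|x - x0|).
    apply: G => // [j' x' Tx'|j' x' Tx']; last by rewrite normr0.
    by rewrite addr0; exact: yd.
  have yB : \sum_j y j x0 t ^+ 2 <= B.
    apply: ler_sum => k _; rewrite -real_normK ?num_real//.
    rewrite ler_pXn2r ?nnegrE ?addr_ge0// -{1}[y k x0 t](subrK (y k x0 t0)) addrC.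
    apply: (le_trans (ler_normD _ _)); apply: lerD => //.
    by have := d2P k _ td2; rewrite [t0 + _]addrC subrK => /ltW.
  have yB2 : y j x t ^+ 2 <= B2.
    apply: (@le_trans _ _ (\sum_j y j x t ^+ 2)).
      by rewrite (bigD1 j)//= lerDl; apply: sumr_ge0 => k _; exact: sqr_ge0.
    apply: (le_trans G); rewrite /B2; apply: ler_pM => //.
    - by apply: sumr_ge0 => k _; exact: sqr_ge0.
    - rewrite ler_expR ler_piMr//; first by rewrite addr_ge0// !mulr_ge0.
      case/andP: Tx => ? ?.
      by rewrite ler_norml; apply/andP; split; lra.
  have := yB2; rewrite -real_normK ?num_real//; have := normr_ge0 (y j x t); nra.
pose M := n * ((A + 1) * (B2 + 1)).
have M0 : 0 <= M by rewrite !mulr_ge0// addr_ge0.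
apply/jcontP => e e0.
have [d3 d30 d3P] := cy0' (e / 2) (divr_gt0 e0 (ltr0n _ 2)).
pose d := Num.min (Num.min 1 (e / 2 / (M + 1)))
  (Num.min (Num.min i (Num.min d1 d2)) d3).
have M1 : 0 < M + 1 by rewrite ltr_pwDr.
exists d.
  by rewrite !lt_min ltr01 i0 d10 d20 d30 !divr_gt0.
move=> x t; rewrite /d lt_min (lt_min _ 1) => /andP[/andP[x1 xe] _].
rewrite lt_min => /andP[_]; rewrite lt_min => /andP[td td3].
have Tx : T x.
  by move: x1; rewrite ltr_norml => /andP[? ?]; apply/andP; split; lra.
have It : I t by apply/iI/ltW; move: td; rewrite lt_min => /andP[].
rewrite -[_ - _](subrKA (y j0 x0 t)) (splitr e).
apply: (le_lt_trans (ler_normD _ _)); apply: ltr_leD; last first.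
  by have := d3P j0 _ td3; rewrite [t0 + _]addrC subrK => /ltW.
have := @lipschitz_bound R T (y j0 ^~ t)
  (fun x => \sum_k a j0 k x t * y k x t) M x0 x iT T0 Tx
  (fun z _ => yd j0 z t It).
have MP z : T z -> `|\sum_k a j0 k z t * y k z t| <= M.
  move=> Tz; apply: (le_trans (ler_norm_sum _ _ _)).
  rewrite /M sumc; apply: ler_sum => k _; rewrite normrM; apply: ler_pM => //.
    rewrite -[a j0 k z _](subrK (a j0 k z t0)) addrC.
    apply: (le_trans (ler_normD _ _)); apply: lerD; first exact: aA.
    move: td; rewrite !lt_min => /and3P[_ td1 _].
    by have := d1P j0 k _ td1 z Tz; rewrite [t0 + _]addrC subrK => /ltW.
  exact: ybound.
move=> /(_ MP); move: xe; rewrite ltr_pdivlMr// => xe H.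
by apply: (le_lt_trans H); have := normr_ge0 (x - x0); nra.
Qed.

End Parameters2.

(** * Smooth functions on a strip and the Frobenius theorem *)

Section StripCalculus.
Context {R : realType} {I : set R}.
Hypothesis oI : open I.
Implicit Types f g : R -> R -> R.

Lemma near_strip (t : R) : I t -> \forall s \near t, I s.
Proof. by move=> It; exact: open_nbhs_nbhs. Qed.

Lemma jcontD f g x t : jcont f x t -> jcont g x t ->
  jcont (fun x t => f x t + g x t) x t.
Proof. by move=> cf cg; exact: (continuousD cf cg). Qed.

Lemma jcontM f g x t : jcont f x t -> jcont g x t ->
  jcont (fun x t => f x t * g x t) x t.
Proof. by move=> cf cg; exact: (continuousM cf cg). Qed.

Lemma jcont_congr f g x t : I t -> (forall x t, I t -> f x t = g x t) ->
  jcont f x t -> jcont g x t.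
Proof.
move=> It fg /jcontP cf; have [i i0 iI] := open_margin oI It.
apply/jcontP => e /cf[d d0 dP]; exists (Num.min i d).
  by rewrite lt_min i0.
move=> y s; rewrite !lt_min => /andP[_ yd] /andP[si sd].
by rewrite -!fg//; [exact: dP|exact/iI/ltW].
Qed.

Lemma Ck_jcont k f x t : Ck k I f -> I t -> jcont f x t.
Proof. by case: k => [|k] [cf _] It; exact: cf. Qed.

Lemma Ck_is_derive_x k f (x t : R) : Ck k.+1 I f -> I t ->
  is_derive x 1 (f ^~ t) (derive1 (f ^~ t) x).
Proof.
by case=> _ [df _ _] It; apply: derivable_is_derive1; case: (df x t It).
Qed.

Lemma Ck_is_derive_t k f (x t : R) : Ck k.+1 I f -> I t ->
  is_derive t 1 (f x) (derive1 (f x) t).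
Proof.
by case=> _ [df _ _] It; apply: derivable_is_derive1; case: (df x t It).
Qed.

Lemma Ck_dx k f : Ck k.+1 I f -> Ck k I (fun x t => derive1 (f ^~ t) x).
Proof. by case=> _ []. Qed.

Lemma Ck_dt k f : Ck k.+1 I f -> Ck k I (fun x t => derive1 (f x) t).
Proof. by case=> _ []. Qed.

Lemma is_derive_t_congr f g (x t d : R) : I t -> (forall x t, I t -> f x t = g x t) ->
  is_derive t 1 (f x) d -> is_derive t 1 (g x) d.
Proof.
move=> It fg; apply: near_eq_is_derive.
by apply: filterS (near_strip It) => s Is; exact: fg.
Qed.

Lemma is_derive_x_congr f g (x t d : R) : I t -> (forall x t, I t -> f x t = g x t) ->
  is_derive x 1 (f ^~ t) d -> is_derive x 1 (g ^~ t) d.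
Proof.
by move=> It fg; rewrite (_ : f ^~ t = g ^~ t)//; apply/funext => y; exact: fg.
Qed.

(** As [I] is open, the [t]-derivatives at points of [I] see only the values over [I]. *)
Lemma Ck_congr k f g : (forall x t, I t -> f x t = g x t) ->
  Ck k I f -> Ck k I g.
Proof.
elim: k f g => [|k IH] f g fg /=.
  by move=> [cf _]; split=> // x t It; apply: (jcont_congr It fg); exact: cf.
move=> Cf; have [cf [df fx ft]] := Cf; split=> [x t It|].
  by apply: (jcont_congr It fg); exact: cf.
have gx (x t : R) : I t -> is_derive x 1 (g ^~ t) (derive1 (f ^~ t) x).
  move=> It; apply: (is_derive_x_congr It fg).
  exact: (Ck_is_derive_x x Cf It).
have gt (x t : R) : I t -> is_derive t 1 (g x) (derive1 (f x) t).
  move=> It; apply: (is_derive_t_congr It fg).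
  exact: (Ck_is_derive_t x Cf It).
split.
- by move=> x t It; split; [case: (gx x t It)|case: (gt x t It)].
- by apply: IH fx => x t It; rewrite (is_derive1_val (gx x t It)).
- by apply: IH ft => x t It; rewrite (is_derive1_val (gt x t It)).
Qed.

Lemma CkS_intro k f fx ft : (forall x t, I t -> jcont f x t) ->
  (forall (x : R) t, I t -> is_derive x 1 (f ^~ t) (fx x t)) ->
  (forall x (t : R), I t -> is_derive t 1 (f x) (ft x t)) ->
  Ck k I fx -> Ck k I ft -> Ck k.+1 I f.
Proof.
move=> cf dfx dft Cfx Cft; split => //; split.
- by move=> x t It; split; [case: (dfx x t It)|case: (dft x t It)].
- by apply: Ck_congr Cfx => x t It; rewrite (is_derive1_val (dfx x t It)).
- by apply: Ck_congr Cft => x t It; rewrite (is_derive1_val (dft x t It)).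
Qed.

Lemma Ck_pred k f : Ck k.+1 I f -> Ck k I f.
Proof.
elim: k f => [|k IH] f; first by case.
by case=> cf [df fx ft]; split=> //; split; [exact: df|exact: IH fx|exact: IH ft].
Qed.

Lemma Ck_cst k (c : R) : Ck k I (fun _ _ => c).
Proof.
elim: k c => [|k IH] c.
  by split=> // x t _; exact: cvg_cst.
apply: CkS_intro (IH 0) (IH 0) => //.
- by move=> x t _; exact: cvg_cst.
- by move=> x t _; exact: is_derive_cst.
Qed.

Lemma Ck0_intro f : (forall x t, I t -> jcont f x t) -> Ck 0 I f.
Proof. by []. Qed.

Lemma CkD k f g : Ck k I f -> Ck k I g -> Ck k I (fun x t => f x t + g x t).
Proof.
elim: k f g => [|k IH] f g Cf Cg.
  apply: Ck0_intro => x t It.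
  exact: jcontD (Ck_jcont Cf It) (Ck_jcont Cg It).
have [_ [_ fx ft]] := Cf; have [_ [_ gx gt]] := Cg.
apply: CkS_intro (IH _ _ fx gx) (IH _ _ ft gt).
- by move=> x t It; exact: jcontD (Ck_jcont Cf It) (Ck_jcont Cg It).
- by move=> x t It; apply: is_derive1D; apply: Ck_is_derive_x; eassumption.
- by move=> x t It; apply: is_derive1D; apply: Ck_is_derive_t; eassumption.
Qed.

Lemma CkM k f g : Ck k I f -> Ck k I g -> Ck k I (fun x t => f x t * g x t).
Proof.
elim: k f g => [|k IH] f g Cf Cg.
  apply: Ck0_intro => x t It.
  exact: jcontM (Ck_jcont Cf It) (Ck_jcont Cg It).
have [_ [_ fx ft]] := Cf; have [_ [_ gx gt]] := Cg.
have Cf' := Ck_pred Cf; have Cg' := Ck_pred Cg.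
apply: CkS_intro (CkD (IH _ _ fx Cg') (IH _ _ Cf' gx))
  (CkD (IH _ _ ft Cg') (IH _ _ Cf' gt)).
- by move=> x t It; exact: jcontM (Ck_jcont Cf It) (Ck_jcont Cg It).
- by move=> x t It; apply: is_derive1M; apply: Ck_is_derive_x; eassumption.
- by move=> x t It; apply: is_derive1M; apply: Ck_is_derive_t; eassumption.
Qed.

Lemma CkN k f : Ck k I f -> Ck k I (fun x t => - f x t).
Proof.
move=> Cf; apply: Ck_congr (CkM (Ck_cst k (-1)) Cf) => x t _.
by rewrite mulN1r.
Qed.

Lemma Ck_sum k (J : Type) (r : seq J) (F : J -> R -> R -> R) :
  (forall j, Ck k I (F j)) -> Ck k I (fun x t => \sum_(j <- r) F j x t).
Proof.
move=> CF; elim: r => [|j r IH].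
  by apply: Ck_congr (Ck_cst k 0) => x t _; rewrite big_nil.
by apply: Ck_congr (CkD (CF j) IH) => x t _; rewrite big_cons.
Qed.

Lemma smooth2_dx f : smooth2 I f -> smooth2 I (fun x t => derive1 (f ^~ t) x).
Proof. by move=> Cf k; exact: Ck_dx. Qed.

Lemma smooth2_dt f : smooth2 I f -> smooth2 I (fun x t => derive1 (f x) t).
Proof. by move=> Cf k; exact: Ck_dt. Qed.

(** Differentiation under the integral sign. A component constantly equal to [1] is adjoined, at
    index [false], which makes the inhomogeneous equation [f_x = A] a homogeneous linear system. *)
Lemma parameter_derivative_affine f A (z : R -> R) (t0 : R) : I t0 ->
  (forall (x : R) t, I t -> is_derive x 1 (f ^~ t) (A x t)) ->
  Ck 1 I A ->
  (forall x : R, is_derive x 1 z (derive1 (A x) t0)) ->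
  is_derive t0 1 (f 0) (z 0) ->
  forall x, is_derive t0 1 (f x) (z x).
Proof.
move=> It0 fA CA zA z0 x.
pose a (j k : bool) x t := if j && ~~ k then A x t else 0.
have Ca j k : Ck 1 I (a j k) by case: j k => [] []; [exact: (Ck_cst 1 0)|exact: CA|exact: (Ck_cst 1 0)|exact: (Ck_cst 1 0)].
pose y (j : bool) := if j then f else (fun _ _ => 1).
apply: (@parameter_derivative R bool I a (fun j k x t => derive1 (a j k x) t)
  y (fun j => if j then z else cst 0) t0 oI It0 _ _ _ _ _ _ true x).
- move=> [] u t It; rewrite big_bool/= /a/=.
    rewrite mul0r add0r mulr1; exact: fA.
  by rewrite !mul0r addr0; exact: is_derive_cst.
- by move=> j k u; exact: (Ck_jcont (Ca j k)).
- by move=> j k u t It; exact: (Ck_is_derive_t u (Ca j k) It).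
- by move=> j k u; exact: (Ck_jcont (Ck_dt (Ca j k)) It0).
- move=> [] u; rewrite big_bool/= /a/=.
    have -> : derive1 (fun _ : R => 0 : R) t0 = 0.
      exact: (is_derive1_val (is_derive_cst _ _ _)).
    by rewrite !mul0r !mulr0 !add0r mulr1 addr0; exact: zA.
  have -> : derive1 (fun _ : R => 0 : R) t0 = 0.
    exact: (is_derive1_val (is_derive_cst _ _ _)).
  by rewrite !mul0r !addr0; exact: is_derive_cst.
- by case=> //=; exact: is_derive_cst.
Qed.

(** [Ck] does not identify mixed derivatives taken in different orders. The primitive in [x] of
    [f_xt] that agrees with [f_t] at [x = 0] is [f_t] everywhere, by differentiation under the
    integral sign. *)
Lemma schwarz f (x t : R) : smooth2 I f -> I t ->
  derive1 (fun s => derive1 (f ^~ s) x) t =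
  derive1 (fun y => derive1 (f y) t) x.
Proof.
move=> Cf It.
pose fx x t := derive1 (f ^~ t) x.
have Cfx : smooth2 I fx := smooth2_dx Cf.
have [||z [z0 zd]] := @exists_antiderivative R setT
    (fun y => derive1 (fx y) t) 0 openT _ Logic.I; first by [].
  by move=> y _; apply: (@jcont_x R (fun x t => derive1 (fx x) t));
    exact: (Ck_jcont (smooth2_dt Cfx 0%N)).
symmetry; apply: is_derive1_val.
have zE y : derive1 (f y) t = z y + derive1 (f 0) t.
  apply: is_derive1_val.
  apply: (@parameter_derivative_affine f fx (fun y => z y + derive1 (f 0) t)) => //.
  - by move=> u s Is; exact: (Ck_is_derive_x _ (Cf 1%N)).
  - move=> u; rewrite -[derive1 (fx u) t]addr0.
    by apply: is_derive1D; exact: zd.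
  - by rewrite z0 add0r; exact: (Ck_is_derive_t _ (Cf 1%N)).
rewrite (_ : (fun y => _) = fun y => z y + derive1 (f 0) t); last first.
  by apply/funext => y.
rewrite -[X in is_derive _ _ _ X]addr0.
by apply: is_derive1D; exact: zd.
Qed.

Hypothesis iI : is_interval I.

Lemma strip_constant f x t x0 t0 :
  (forall (x : R) t, I t -> is_derive x 1 (f ^~ t) 0) ->
  (forall x (t : R), I t -> is_derive t 1 (f x) 0) ->
  I t -> I t0 -> f x t = f x0 t0.
Proof.
move=> fx ft It It0.
have h1 : `|f x t - f x0 t| <= 0.
  rewrite -[leRHS](mul0r `|x - x0|).
  apply: (@lipschitz_bound R setT (f ^~ t) (fun=> 0)) => // u _.
    exact: fx.
  by rewrite normr0.
have h2 : `|f x0 t - f x0 t0| <= 0.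
  rewrite -[leRHS](mul0r `|t - t0|).
  apply: (@lipschitz_bound R I (f x0) (fun=> 0)) => // u Iu.
  by rewrite normr0.
by move: h1 h2; rewrite !normr_le0 !subr_eq0 => /eqP -> /eqP ->.
Qed.

(** The system is integrated in [t] along [x = 0], then in [x] at each [t]. The compatibility
    condition says that [b y] solves the variational equation of the [x]-system; being the
    [t]-derivative of [y] at [x = 0], it is so for all [x]. *)
Theorem frobenius (J : finType) (a b : J -> J -> R -> R -> R) (c : J -> R) t0 :
  (forall j k, smooth2 I (a j k)) -> (forall j k, smooth2 I (b j k)) ->
  (forall j k x t, I t ->
     derive1 (a j k x) t + \sum_l a j l x t * b l k x t =
     derive1 (b j k ^~ t) x + \sum_l b j l x t * a l k x t) ->
  I t0 ->
  exists y : J -> R -> R -> R,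
    [/\ forall j, smooth2 I (y j), forall j, y j 0 t0 = c j,
        forall j (x : R) t, I t ->
          is_derive x 1 (y j ^~ t) (\sum_k a j k x t * y k x t)
      & forall j x (t : R), I t ->
          is_derive t 1 (y j x) (\sum_k b j k x t * y k x t)].
Proof.
move=> Ca Cb ab It0.
have [e [e0 ed]] := @linear_ode R J I (fun j k t => b j k 0 t) c t0 oI iI It0
  (fun j k t It => jcont_t (Ck_jcont (Cb j k 0%N) It)).
(* The solutions at different [t] are chosen independently; their regularity in [t] comes from the
   initial values [e] through the energy estimates. *)
have /choice[y' y'P] t : exists y : J -> R -> R, I t ->
    (forall j, y j 0 = e j t) /\
    forall j (x : R), is_derive x 1 (y j) (\sum_k a j k x t * y k x).
  have [It|nIt] := pselect (I t); last by exists (fun _ _ => 0).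
  have [||y [y0 yd]] := @linear_ode R J setT (fun j k x => a j k x t)
    (e ^~ t) 0 openT _ Logic.I.
  - by [].
  - by move=> j k x _; exact: jcont_x (Ck_jcont (Ca j k 0%N) It).
  by exists y => _; split=> // j x; exact: yd.
pose y j x t := y' t j x.
have y0 j t : I t -> y j 0 t = e j t by move=> /y'P[H _]; exact: H.
have yx j (x : R) t : I t -> is_derive x 1 (y j ^~ t) (\sum_k a j k x t * y k x t).
  by move=> /y'P[_ yd]; exact: yd.
have yt j x (t : R) : I t -> is_derive t 1 (y j x) (\sum_k b j k x t * y k x t).
  move=> It.
  apply: (@parameter_derivative R J I a (fun j k x t => derive1 (a j k x) t) y
    (fun j x => \sum_k b j k x t * y k x t) t oI It yx).
  - by move=> *; exact: (Ck_jcont (Ca _ _ 0%N)).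
  - by move=> *; exact: (Ck_is_derive_t _ (Ca _ _ 1%N)).
  - by move=> *; exact: (Ck_jcont (smooth2_dt (Ca _ _) 0%N)).
  - move=> {}j {}x.
    have H := is_derive1_sum (index_enum J) (fun k =>
      is_derive1M (Ck_is_derive_x x (Cb j k 1%N) It) (yx k x t It)).
    apply: (is_derive_eq H); rewrite !big_split/=.
    rewrite [X in _ + X = _](eq_bigr
      (fun k => \sum_l b j k x t * a k l x t * y l x t)); last first.
      by move=> k _; rewrite mulr_sumr; apply: eq_bigr => l _; rewrite mulrA.
    rewrite [X in _ + X = _]exchange_big/= -big_split/=.
    rewrite [X in _ = _ + X](eq_bigr
      (fun k => \sum_l a j k x t * b k l x t * y l x t)); last first.
      by move=> k _; rewrite mulr_sumr; apply: eq_bigr => l _; rewrite mulrA.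
    rewrite [X in _ = _ + X]exchange_big/= -big_split/=.
    apply: eq_bigr => k _.
    by rewrite -!mulr_suml -!mulrDl ab.
  - move=> {}j.
    rewrite (eq_bigr (fun k => b j k 0 t * e k t)); last by move=> k _; rewrite y0.
    apply: near_eq_is_derive (ed j t It).
    by apply: filterS (near_strip It) => s Is; rewrite y0.
exists y; split=> // [j|j]; last by rewrite y0.
have cy i x t : I t -> jcont (y i) x t.
  move=> It; apply: (@jcont_solution R J I a y x t oI It yx).
    by move=> *; exact: (Ck_jcont (Ca _ _ 0%N)).
  by move=> k; exact: is_derive1_continuous (yt k x t It).
(* Bootstrap: the first derivatives of [y] are [a y] and [b y], of class [C^m] as soon as [y] is. *)
move=> m; elim: m j => [|m IH] j; first by split=> // x t It; exact: cy.
apply: CkS_intro (yx j) (yt j) _ _; first exact: cy.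
  by apply: Ck_sum => k; apply: CkM => //; exact: Ca.
by apply: Ck_sum => k; apply: CkM => //; exact: Cb.
Qed.

Theorem poincare A B t0 : smooth2 I A -> smooth2 I B -> I t0 ->
  (forall x t, I t -> derive1 (A x) t = derive1 (B ^~ t) x) ->
  exists g : R -> R -> R, [/\ smooth2 I g,
    forall (x : R) t, I t -> is_derive x 1 (g ^~ t) (A x t)
    & forall x (t : R), I t -> is_derive t 1 (g x) (B x t)].
Proof.
move=> CA CB It0 AB.
have [e [e0 ed]] := @exists_antiderivative R I (B 0) t0 oI iI It0
  (fun t It => jcont_t (Ck_jcont (CB 0%N) It)).
have /choice[y' y'P] t : exists y : R -> R, I t ->
    y 0 = 0 /\ forall x : R, is_derive x 1 y (A x t).
  have [It|nIt] := pselect (I t); last by exists (fun _ => 0).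
  have [||y [y0 yd]] := @exists_antiderivative R setT (A ^~ t) 0 openT _ Logic.I.
  - by [].
  - by move=> x _; exact: jcont_x (Ck_jcont (CA 0%N) It).
  by exists y => _; split=> // x; exact: yd.
pose g x t := y' t x + e t.
have gx (x : R) t : I t -> is_derive x 1 (g ^~ t) (A x t).
  move=> /y'P[_ yd]; rewrite -[A x t]addr0.
  by apply: is_derive1D; exact: yd.
have g_t x (t : R) : I t -> is_derive t 1 (g x) (B x t).
  move=> It; apply: (@parameter_derivative_affine g A (B ^~ t) t It gx (CA 1%N)).
    by move=> u; rewrite AB//; exact: (Ck_is_derive_x _ (CB 1%N)).
  apply: near_eq_is_derive (ed t It).
  by apply: filterS (near_strip It) => s /y'P[y0 _]; rewrite /g y0 add0r.
have cg x t : I t -> jcont g x t.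
  move=> It.
  pose a (j k : bool) x t := if j && ~~ k then A x t else 0.
    have Ca j k : Ck 1 I (a j k) by case: j k => [] []; [exact: (Ck_cst 1 0)|exact: CA|exact: (Ck_cst 1 0)|exact: (Ck_cst 1 0)].
  pose y (j : bool) := if j then g else (fun _ _ => 1).
  apply: (@jcont_solution R bool I a y x t oI It _ _ _ true).
  - move=> [] u s Is; rewrite big_bool/= /a/=.
      rewrite mul0r add0r mulr1; exact: gx.
    by rewrite !mul0r addr0; exact: is_derive_cst.
  - by move=> j k u; exact: (Ck_jcont (Ca j k)).
  - case=> /=; last exact: cvg_cst.
    exact: is_derive1_continuous (g_t x t It).
exists g; split=> // -[|m]; first by split=> // x t It; exact: cg.
exact: CkS_intro cg gx g_t (CA m) (CB m).
Qed.

End StripCalculus.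

(** * Dressing series *)

Lemma addmxE (V : nmodType) m n (A B : 'M[V]_(m, n)) i j :
  (A + B) i j = A i j + B i j.
Proof. by rewrite mxE. Qed.

Lemma oppmxE (V : zmodType) m n (A : 'M[V]_(m, n)) i j : (- A) i j = - A i j.
Proof. by rewrite mxE. Qed.

Lemma zeromxE (V : nmodType) m n i j : (0 : 'M[V]_(m, n)) i j = 0.
Proof. by rewrite mxE. Qed.

(* Identities between sums of products of matrices: after expansion the
   entries of the products are atoms for ring. *)
Ltac mx_ring :=
  rewrite ?(mulmxDl, mulmxDr, mulmxBl, mulmxBr, mulNmx, mulmxN, mulmxA,
    mulmx1, mul1mx, mulmx0, mul0mx);
  apply/matrixP => ? ?; rewrite ?(addmxE, oppmxE, zeromxE); ring.

(* f : nat -> 'M_n stands for the formal series \sum_j f j lambda^-j. *)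
Definition conv (S : pzRingType) n (f g : nat -> 'M[S]_n) (j : nat) : 'M[S]_n :=
  \sum_(i < j.+1) f i *m g (j - i)%N.

Section Convolution.
Context {S : pzRingType} {n : nat}.
Implicit Types (f g h : nat -> 'M[S]_n) (a : 'M[S]_n).

Lemma conv_rev f g j : conv f g j = \sum_(i < j.+1) f (j - i)%N *m g i.
Proof.
rewrite /conv (reindex_inj rev_ord_inj)/=; apply: eq_bigr => i _.
by rewrite subSS subKn// -ltnS.
Qed.

Lemma eq_conv f g f' g' j : (forall i, (i <= j)%N -> f i = f' i) ->
  (forall i, (i <= j)%N -> g i = g' i) -> conv f g j = conv f' g' j.
Proof.
move=> ff' gg'; apply: eq_bigr => i _.
by rewrite ff' ?gg'// ?leq_subr// -ltnS.
Qed.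

Lemma convA f g h j : conv f (conv g h) j = conv (conv f g) h j.
Proof.
rewrite [RHS]conv_rev.
pose t (l i : nat) := f l *m (g (j - l - i)%N *m h i).
transitivity (\sum_(l < j.+1) \sum_(i < j.+1 | (i <= j - l)%N) t l i).
  apply: eq_bigr => /= l _; rewrite conv_rev mulmx_sumr.
  by rewrite (big_ord_narrow_leq (leq_subr _ _)).
rewrite (exchange_big_dep predT) //=; apply: eq_bigr => i _.
transitivity (\sum_(l < j.+1 | (l <= j - i)%N) t l i).
  by apply: eq_bigl => l; have := ltn_ord i; have := ltn_ord l; lia.
rewrite (big_ord_narrow_leq (leq_subr _ _)) /conv mulmx_suml /=.
by apply: eq_bigr => l _; rewrite /t -!subnDA addnC mulmxA.
Qed.

Lemma convDl f g h j : conv (fun i => f i + g i) h j = conv f h j + conv g h j.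
Proof. by rewrite /conv -big_split/=; apply: eq_bigr => i _; rewrite mulmxDl. Qed.

Lemma convDr f g h j : conv f (fun i => g i + h i) j = conv f g j + conv f h j.
Proof. by rewrite /conv -big_split/=; apply: eq_bigr => i _; rewrite mulmxDr. Qed.

Lemma convNl f g j : conv (fun i => - f i) g j = - conv f g j.
Proof. by rewrite /conv -sumrN; apply: eq_bigr => i _; rewrite mulNmx. Qed.

Lemma convNr f g j : conv f (fun i => - g i) j = - conv f g j.
Proof. by rewrite /conv -sumrN; apply: eq_bigr => i _; rewrite mulmxN. Qed.

Lemma convMl a f g j : conv (fun i => a *m f i) g j = a *m conv f g j.
Proof. by rewrite /conv mulmx_sumr; apply: eq_bigr => i _; rewrite mulmxA. Qed.

Lemma convMr a f g j : conv f (fun i => g i *m a) j = conv f g j *m a.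
Proof. by rewrite /conv mulmx_suml; apply: eq_bigr => i _; rewrite mulmxA. Qed.

Lemma convMm a f g j : conv (fun i => f i *m a) g j = conv f (fun i => a *m g i) j.
Proof. by apply: eq_bigr => i _; rewrite mulmxA. Qed.

Lemma convSl f g j : conv f g j.+1 = f 0%N *m g j.+1 + conv (fun i => f i.+1) g j.
Proof. by rewrite /conv big_ord_recl. Qed.

Lemma convSr f g j : conv f g j.+1 = conv f (fun i => g i.+1) j + f j.+1 *m g 0%N.
Proof.
rewrite /conv big_ord_recr/= subnn; congr (_ + _); apply: eq_bigr => i _.
by rewrite subSn// -ltnS.
Qed.

(** A series with constant term [1] can be cancelled on the right, coefficient by coefficient. This
    stands in for an inverse series: [V = T omega T^-1] is always used in the form
    [V T = T omega]. *)
Lemma conv_eq0 f g j : g 0%N = 1%:M -> (forall i, (i <= j)%N -> conv f g i = 0) ->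
  f j = 0.
Proof.
move=> g0; have [m] := ubnP j; elim: m j => // m IH j; rewrite ltnS => jm H.
have := H j (leqnn j); rewrite /conv big_ord_recr/= subnn g0 mulmx1 big1 ?add0r//.
move=> i _; rewrite (IH i) ?mul0mx//; first exact: leq_trans (ltn_ord i) jm.
by move=> l li; apply: H; exact: leq_trans li (ltnW (ltn_ord i)).
Qed.

End Convolution.

Section Recursion.
Context {T : Type} (x0 : T) (step : (nat -> T) -> nat -> T).
Hypothesis step_ext : forall f g j, (forall i, (i <= j)%N -> f i = g i) ->
  step f j = step g j.

(** A step may read all earlier values, and by [step_ext] no later ones. In the proof, [F m]
    tabulates the first [m + 1] values and the diagonal [F m m] is the sequence. *)
Lemma course_of_values : exists f : nat -> T,
  f 0%N = x0 /\ forall j, f j.+1 = step f j.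
Proof.
pose F := fix F (m : nat) : nat -> T := match m with
  | 0 => fun=> x0
  | m'.+1 => fun i => if i == m'.+1 then step (F m') m' else F m' i end.
have FE m i : (i <= m)%N -> F m i = F i i.
  elim: m => [|m IH]; first by rewrite leqn0 => /eqP ->.
  rewrite leq_eqVlt => /predU1P[->//|im] /=.
  by rewrite ltn_eqF// IH.
exists (fun m => F m m); split=> // j; rewrite /= eqxx.
by apply: step_ext => i ij; exact: FE.
Qed.

End Recursion.

Section Dressing.
Context {S : comNzRingType} {n : nat}.
Local Notation A := 'M[S]_n.
Variables (D K J : A -> A) (w q : A).

(** [K] is to be the block diagonal part, [J] the inverse of [ad w] off the diagonal. With
    [h_i = K (q T_i)], the equation [[w, T_(j+1)] = dressing_rhs T j] is the coefficient form of [D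
    T = (q + lambda w) T - T (h + lambda w)], a gauge transformation to a block diagonal
    connection. *)
Definition dressing_rhs (T : nat -> A) j : A :=
  D (T j) - q *m T j + conv T (fun i => K (q *m T i)) j.

Definition is_dressing (T : nat -> A) :=
  T 0%N = 1%:M /\ forall j, T j.+1 = J (dressing_rhs T j).

Definition dressed (T V : nat -> A) := forall j, conv V T j = T j *m w.

Lemma exists_dressing : exists T, is_dressing T.
Proof.
apply: course_of_values => f g j fg; congr J; rewrite /dressing_rhs.
rewrite fg//; congr (_ + _); apply: eq_conv => // i ij.
by rewrite fg.
Qed.

Lemma exists_dressed T : T 0%N = 1%:M -> exists V, V 0%N = w /\
  (forall j, V j.+1 = T j.+1 *m w - conv V (fun i => T i.+1) j) /\ dressed T V.
Proof.
move=> T0; have [|V [V0 VS]] := @course_of_values A w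
    (fun V j => T j.+1 *m w - conv V (fun i => T i.+1) j).
  by move=> f g j fg; congr (_ - _); exact: eq_conv.
exists V; split=> //; split=> // -[|j].
  by rewrite /conv big_ord_recl big_ord0 addr0 V0 T0 mulmx1 mul1mx.
by rewrite convSr T0 mulmx1 VS addrC subrK.
Qed.

Hypotheses (DD : forall x y, D (x + y) = D x + D y)
  (DM : forall x y, D (x *m y) = D x *m y + x *m D y) (Dw : D w = 0)
  (KD : forall x y, K (x + y) = K x + K y) (KN : forall x, K (- x) = - K x)
  (KK : forall x, K (K x) = K x)
  (KM : forall x y, K (x *m K y) = K x *m K y) (K1 : K 1%:M = 1%:M)
  (Kw : forall x, w *m K x = K x *m w) (KJ : forall x, K (J x) = 0)
  (wJ : forall x, K x = 0 -> w *m J x - J x *m w = x)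
  (KDc : forall x, K (D x) = D (K x)).

Lemma derivation0 : D 0 = 0.
Proof. by apply: (addrI (D 0)); rewrite -DD !addr0. Qed.

Lemma derivation_sum (I : Type) (r : seq I) (F : I -> A) :
  D (\sum_(i <- r) F i) = \sum_(i <- r) D (F i).
Proof.
by elim: r => [|i r IH]; rewrite ?big_nil ?derivation0// !big_cons DD IH.
Qed.

Lemma derivation_conv f g j : D (conv f g j) =
  conv (fun i => D (f i)) g j + conv f (fun i => D (g i)) j.
Proof. by rewrite derivation_sum -big_split/=; apply: eq_bigr => i _; rewrite DM. Qed.

Lemma derivation1 : D 1%:M = 0.
Proof.
apply: (addrI (D 1%:M)); rewrite addr0.
by have := DM 1%:M 1%:M; rewrite !mulmx1 mul1mx => <-.
Qed.

Lemma K_sum (I : Type) (r : seq I) (F : I -> A) :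
  K (\sum_(i <- r) F i) = \sum_(i <- r) K (F i).
Proof.
elim: r => [|i r IH]; last by rewrite !big_cons KD IH.
by rewrite !big_nil; apply: (addrI (K 0)); rewrite -KD !addr0.
Qed.

(** For [i >= 1] the coefficient [T_i] has no diagonal blocks, so only the term [i = 0] of the
    convolution reaches the diagonal; it is [K (q T_j)] and cancels the diagonal of [- q T_j]. This
    is the solvability condition for [T_(j+1)]. *)
Lemma dressing_K T j : is_dressing T -> K (dressing_rhs T j) = 0.
Proof.
move=> [T0 TS]; rewrite /dressing_rhs KD KD KN KDc.
have -> : D (K (T j)) = 0.
  by case: j => [|j]; rewrite ?T0 ?K1 ?derivation1// TS KJ derivation0.
rewrite /conv big_ord_recl/= T0 mul1mx subn0 KD KK sub0r addrA addNr add0r.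
rewrite K_sum big1// => i _.
by rewrite KM TS KJ mul0mx.
Qed.

Lemma dressing_comm T j : is_dressing T ->
  w *m T j.+1 - T j.+1 *m w = dressing_rhs T j.
Proof. by move=> dT; rewrite dT.2 wJ// dressing_K. Qed.

(** Differentiating [V T = T w] and inserting the equation of [T] gives the claim multiplied on the
    right by [T], which is then cancelled. The block diagonal [h] drops out because it commutes with
    [w]. *)
Lemma dressed_zero_curvature T V : is_dressing T -> V 0%N = w -> dressed T V ->
  forall j, D (V j) = q *m V j - V j *m q + (w *m V j.+1 - V j.+1 *m w).
Proof.
move=> dT V0 VT.
pose W j := D (V j) - (q *m V j - V j *m q + (w *m V j.+1 - V j.+1 *m w)).
suff WT j : conv W T j = 0.
  move=> j; apply/subr0_eq; change (W j = 0).
  by apply: (@conv_eq0 _ _ _ T) => //; exact: dT.1.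
pose h i := K (q *m T i).
have DT i : D (T i) = q *m T i + (w *m T i.+1 - T i.+1 *m w) - conv T h i.
  by rewrite (dressing_comm _ dT) /dressing_rhs; mx_ring.
have e1 : conv (fun i => D (V i)) T j =
    (q *m T j + (w *m T j.+1 - T j.+1 *m w)) *m w
    - conv V (fun i => q *m T i) j - conv V (fun i => w *m T i.+1) j
    + conv V (fun i => T i.+1) j *m w.
  have := derivation_conv V T j; rewrite VT DM Dw mulmx0 addr0.
  have -> : conv V (fun i => D (T i)) j = conv V (fun i => q *m T i) j
      + (conv V (fun i => w *m T i.+1) j - conv V (fun i => T i.+1) j *m w)
      - conv T h j *m w.
    rewrite -convMr -!convNr -!convDr.
    transitivity (conv V (fun i => q *m T i + (w *m T i.+1 - T i.+1 *m w)) j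
      - conv V (conv T h) j).
      by rewrite -convNr -convDr; apply: eq_conv => // i _; rewrite DT.
    rewrite convA; congr (_ - _).
    transitivity (conv (fun i => T i *m w) h j).
      by apply: eq_conv => // i _; exact: VT.
    by rewrite convMm -convMr; apply: eq_conv => // i _; rewrite Kw.
  by rewrite DT => /eqP; rewrite -subr_eq => /eqP <-; mx_ring.
(* A shift of the index is multiplication by [lambda] up to one boundary coefficient; [e2] to [e5]
   record these boundary terms, which cancel in the final sum. *)
have e2 : conv V (fun i => T i.+1) j = T j.+1 *m w - V j.+1.
  by have := VT j.+1; rewrite convSr dT.1 mulmx1 => <-; rewrite addrK.
have e3 : conv V (fun i => w *m T i.+1) j =
    conv V (fun i => w *m T i) j.+1 - V j.+1 *m w.
  by rewrite [in RHS]convSr dT.1 mulmx1 addrK.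
have e4 : conv (fun i => V i.+1) T j = T j.+1 *m w - w *m T j.+1.
  by have := VT j.+1; rewrite convSl V0 => <-; rewrite addrC addKr.
have e5 : conv (fun i => V i.+1) (fun i => w *m T i) j =
    conv V (fun i => w *m T i) j.+1 - w *m (w *m T j.+1).
  by rewrite [in RHS]convSl V0 addrC addKr.
have -> : conv W T j = conv (fun i => D (V i)) T j
    - q *m conv V T j + conv V (fun i => q *m T i) j
    - w *m conv (fun i => V i.+1) T j
    + conv (fun i => V i.+1) (fun i => w *m T i) j.
  rewrite -!convMl -!convMm -!convNl -!convDl.
  by apply: eq_conv => // i _; rewrite /W; mx_ring.
rewrite e1 e2 e3 e4 e5 VT.
mx_ring.
Qed.

End Dressing.

(** * Complex matrices depending on two variables *)

Notation adjmx A := (map_mx Num.conj A^T).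

Section ComplexDerivative.
Context {R : realType}.
Implicit Types (f g : R -> R[i]) (x : R) (a b z w : R[i]).

Lemma ReD z w : complex.Re (z + w) = complex.Re z + complex.Re w.
Proof. by case: z w => [? ?] [? ?]. Qed.

Lemma ImD z w : complex.Im (z + w) = complex.Im z + complex.Im w.
Proof. by case: z w => [? ?] [? ?]. Qed.

Lemma ReM z w : complex.Re (z * w) =
  complex.Re z * complex.Re w - complex.Im z * complex.Im w.
Proof. by case: z w => [? ?] [? ?]. Qed.

Lemma ImM z w : complex.Im (z * w) =
  complex.Re z * complex.Im w + complex.Im z * complex.Re w.
Proof. by case: z w => [? ?] [? ?] /=; rewrite addrC. Qed.

Lemma Re_conj z : complex.Re (Num.conj z) = complex.Re z.
Proof. by case: z. Qed.

Lemma Im_conj z : complex.Im (Num.conj z) = - complex.Im z.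
Proof. by case: z. Qed.

Definition is_cderive f x a :=
  is_derive x 1 (fun y => complex.Re (f y)) (complex.Re a) /\
  is_derive x 1 (fun y => complex.Im (f y)) (complex.Im a).

Lemma is_cderive_cst c x : is_cderive (fun=> c) x 0.
Proof. by split; exact: is_derive_cst. Qed.

Lemma is_cderiveD f g x a b : is_cderive f x a -> is_cderive g x b ->
  is_cderive (fun y => f y + g y) x (a + b).
Proof.
move=> [f1 f2] [g1 g2]; split.
  under eq_fun do rewrite ReD; rewrite ReD; exact: is_derive1D.
under eq_fun do rewrite ImD; rewrite ImD; exact: is_derive1D.
Qed.

Lemma is_cderiveM f g x a b : is_cderive f x a -> is_cderive g x b ->
  is_cderive (fun y => f y * g y) x (a * g x + f x * b).
Proof.
move=> [f1 f2] [g1 g2]; split.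
  under eq_fun do rewrite ReM; rewrite ReD !ReM.
  apply: (is_derive_eq (is_derive1B (is_derive1M f1 g1) (is_derive1M f2 g2))).
  by ring.
under eq_fun do rewrite ImM; rewrite ImD !ImM.
apply: (is_derive_eq (is_derive1D (is_derive1M f1 g2) (is_derive1M f2 g1))).
by ring.
Qed.

Lemma is_cderive_conj f x a : is_cderive f x a ->
  is_cderive (fun y => Num.conj (f y)) x (Num.conj a).
Proof.
move=> [f1 f2]; split.
  by under eq_fun do rewrite Re_conj; rewrite Re_conj.
by under eq_fun do rewrite Im_conj; rewrite Im_conj; exact: is_derive1N.
Qed.

Lemma is_cderiveMl c f x a : is_cderive f x a ->
  is_cderive (fun y => c * f y) x (c * a).
Proof.
by move=> /(is_cderiveM (is_cderive_cst c x)); rewrite mul0r add0r.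
Qed.

Lemma is_cderive_sum (J : Type) (r : seq J) (P : pred J) (h : J -> R -> R[i])
    (d : J -> R[i]) x :
  (forall j, P j -> is_cderive (h j) x (d j)) ->
  is_cderive (fun y => \sum_(j <- r | P j) h j y) x (\sum_(j <- r | P j) d j).
Proof.
move=> hd; elim: r => [|j r IH].
  rewrite big_nil (_ : (fun y => _) = fun=> 0); first exact: is_cderive_cst.
  by apply/funext => y; rewrite big_nil.
rewrite big_cons (_ : (fun y => _) = fun y =>
  if P j then h j y + \sum_(j <- r | P j) h j y else \sum_(j <- r | P j) h j y).
  by case: ifPn => // Pj; apply: is_cderiveD => //; exact: hd.
by apply/funext => y; rewrite big_cons.
Qed.

Lemma is_cderive_eq f x a b : is_cderive f x a -> a = b -> is_cderive f x b.
Proof. by move=> fa <-. Qed.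

Definition is_mxderive {m n} (A : R -> 'M[R[i]]_(m, n)) x (D : 'M[R[i]]_(m, n)) :=
  forall i j, is_cderive (fun y => A y i j) x (D i j).

Lemma is_mxderive_val {m n} (A : R -> 'M[R[i]]_(m, n)) x D :
  is_mxderive A x D -> mxderive A x = D.
Proof.
move=> AD; apply/matrixP => i j; rewrite mxE; have [A1 A2] := AD i j.
by rewrite (is_derive1_val A1) (is_derive1_val A2); case: (D i j).
Qed.

Lemma is_mxderive_eq {m n} (A : R -> 'M[R[i]]_(m, n)) x D D' :
  is_mxderive A x D -> D = D' -> is_mxderive A x D'.
Proof. by move=> AD <-. Qed.

Lemma is_mxderive_cst {m n} (C : 'M[R[i]]_(m, n)) x : is_mxderive (fun=> C) x 0.
Proof. by move=> i j; rewrite mxE; exact: is_cderive_cst. Qed.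

Lemma is_mxderiveD {m n} (A B : R -> 'M[R[i]]_(m, n)) x D D' :
  is_mxderive A x D -> is_mxderive B x D' ->
  is_mxderive (fun y => A y + B y) x (D + D').
Proof.
move=> AD BD i j; under eq_fun do rewrite mxE; rewrite mxE.
exact: is_cderiveD.
Qed.

Lemma is_mxderiveZ {m n} c (A : R -> 'M[R[i]]_(m, n)) x D :
  is_mxderive A x D -> is_mxderive (fun y => c *: A y) x (c *: D).
Proof.
move=> AD i j; under eq_fun do rewrite mxE; rewrite mxE.
exact: is_cderiveMl.
Qed.

Lemma is_mxderiveN {m n} (A : R -> 'M[R[i]]_(m, n)) x D :
  is_mxderive A x D -> is_mxderive (fun y => - A y) x (- D).
Proof.
by rewrite -scaleN1r; under eq_fun do rewrite -scaleN1r; exact: is_mxderiveZ.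
Qed.

Lemma is_mxderiveB {m n} (A B : R -> 'M[R[i]]_(m, n)) x D D' :
  is_mxderive A x D -> is_mxderive B x D' ->
  is_mxderive (fun y => A y - B y) x (D - D').
Proof. by move=> AD BD; apply: is_mxderiveD => //; exact: is_mxderiveN. Qed.

Lemma is_mxderiveM {m n p} (A : R -> 'M[R[i]]_(m, n)) (B : R -> 'M[R[i]]_(n, p))
    x D D' :
  is_mxderive A x D -> is_mxderive B x D' ->
  is_mxderive (fun y => A y *m B y) x (D *m B x + A x *m D').
Proof.
move=> AD BD i j; under eq_fun do rewrite mxE; rewrite !mxE -big_split/=.
by apply: is_cderive_sum => l _; exact: is_cderiveM.
Qed.

Lemma is_mxderive_adj {m n} (A : R -> 'M[R[i]]_(m, n)) x D :
  is_mxderive A x D -> is_mxderive (fun y => adjmx (A y)) x (adjmx D).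
Proof.
move=> AD i j; under eq_fun do rewrite !mxE; rewrite !mxE.
exact: is_cderive_conj.
Qed.

Lemma is_mxderive_sum {m n} (J : Type) (r : seq J) (P : pred J)
    (h : J -> R -> 'M[R[i]]_(m, n)) d x :
  (forall j, P j -> is_mxderive (h j) x (d j)) ->
  is_mxderive (fun y => \sum_(j <- r | P j) h j y) x (\sum_(j <- r | P j) d j).
Proof.
move=> hd i j; under eq_fun do rewrite summxE; rewrite summxE.
by apply: is_cderive_sum => l Pl; exact: hd.
Qed.

End ComplexDerivative.

Section ComplexSmooth.
Context {R : realType} {I : set R}.
Hypothesis oI : open I.
Implicit Types (f g : R -> R -> R[i]).

Definition csmooth2 f :=
  smooth2 I (fun x t => complex.Re (f x t)) /\
  smooth2 I (fun x t => complex.Im (f x t)).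

Lemma csmooth2_congr f g : (forall x t, I t -> f x t = g x t) ->
  csmooth2 f -> csmooth2 g.
Proof.
move=> fg [f1 f2]; split=> k.
  by apply: (Ck_congr oI _ (f1 k)) => x t It; rewrite fg.
by apply: (Ck_congr oI _ (f2 k)) => x t It; rewrite fg.
Qed.

Lemma csmooth2_cst c : csmooth2 (fun _ _ => c).
Proof. by split=> k; exact: Ck_cst. Qed.

Lemma csmooth2D f g : csmooth2 f -> csmooth2 g ->
  csmooth2 (fun x t => f x t + g x t).
Proof.
move=> [f1 f2] [g1 g2]; split=> k.
  by apply: (Ck_congr oI _ (CkD oI (f1 k) (g1 k))) => x t It; rewrite ReD.
by apply: (Ck_congr oI _ (CkD oI (f2 k) (g2 k))) => x t It; rewrite ImD.
Qed.

Lemma csmooth2M f g : csmooth2 f -> csmooth2 g ->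
  csmooth2 (fun x t => f x t * g x t).
Proof.
move=> [f1 f2] [g1 g2]; split=> k.
  apply: (Ck_congr oI _ (CkD oI (CkM oI (f1 k) (g1 k))
    (CkN oI (CkM oI (f2 k) (g2 k))))) => x t It; by rewrite ReM.
apply: (Ck_congr oI _ (CkD oI (CkM oI (f1 k) (g2 k))
  (CkM oI (f2 k) (g1 k)))) => x t It; by rewrite ImM.
Qed.

Lemma csmooth2_conj f : csmooth2 f -> csmooth2 (fun x t => Num.conj (f x t)).
Proof.
move=> [f1 f2]; split=> k.
  by apply: (Ck_congr oI _ (f1 k)) => x t It; rewrite Re_conj.
by apply: (Ck_congr oI _ (CkN oI (f2 k))) => x t It; rewrite Im_conj.
Qed.

Lemma csmooth2_sum (J : Type) (r : seq J) (P : pred J) (F : J -> R -> R -> R[i]) :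
  (forall j, P j -> csmooth2 (F j)) ->
  csmooth2 (fun x t => \sum_(j <- r | P j) F j x t).
Proof.
move=> CF; elim: r => [|j r IH].
  by apply: csmooth2_congr (csmooth2_cst 0) => x t _; rewrite big_nil.
case: (boolP (P j)) => Pj.
  apply: csmooth2_congr (csmooth2D (CF j Pj) IH) => x t _.
  by rewrite big_cons Pj.
by apply: csmooth2_congr IH => x t _; rewrite big_cons (negbTE Pj).
Qed.

Variables m n : nat.
Implicit Types A B : R -> R -> 'M[R[i]]_(m, n).

Lemma smooth2_mx_congr A B : (forall x t, I t -> A x t = B x t) ->
  smooth2_mx I A -> smooth2_mx I B.
Proof.
move=> AB CA i j; apply: csmooth2_congr (CA i j) => x t It; by rewrite AB.
Qed.

Lemma smooth2_mx_cst (C : 'M[R[i]]_(m, n)) : smooth2_mx I (fun _ _ => C).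
Proof. by move=> i j; exact: csmooth2_cst. Qed.

Lemma smooth2_mxD A B : smooth2_mx I A -> smooth2_mx I B ->
  smooth2_mx I (fun x t => A x t + B x t).
Proof.
move=> CA CB i j; apply: csmooth2_congr (csmooth2D (CA i j) (CB i j)) => x t _.
by rewrite mxE.
Qed.

Lemma smooth2_mxZ c A : smooth2_mx I A -> smooth2_mx I (fun x t => c *: A x t).
Proof.
move=> CA i j; apply: csmooth2_congr (csmooth2M (csmooth2_cst c) (CA i j)) => x t _.
by rewrite mxE.
Qed.

Lemma smooth2_mxN A : smooth2_mx I A -> smooth2_mx I (fun x t => - A x t).
Proof.
move=> /(smooth2_mxZ (-1)); apply: smooth2_mx_congr => x t _.
by rewrite scaleN1r.
Qed.

Lemma smooth2_mx_sum (J : Type) (r : seq J) (P : pred J)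
    (F : J -> R -> R -> 'M[R[i]]_(m, n)) :
  (forall j, P j -> smooth2_mx I (F j)) ->
  smooth2_mx I (fun x t => \sum_(j <- r | P j) F j x t).
Proof.
move=> CF i j.
apply: (@csmooth2_congr (fun x t => \sum_(l <- r | P l) F l x t i j)).
  by move=> x t _; rewrite summxE.
by apply: csmooth2_sum => l Pl; exact: CF.
Qed.

Lemma smooth2_mx_dx A : smooth2_mx I A -> smooth2_mx I (dx A).
Proof.
move=> CA i j; have [C1 C2] := CA i j; split=> k.
  by apply: (Ck_congr oI _ (smooth2_dx C1 k)) => x t _; rewrite mxE.
by apply: (Ck_congr oI _ (smooth2_dx C2 k)) => x t _; rewrite mxE.
Qed.

Lemma smooth2_mx_is_dx A x t : smooth2_mx I A -> I t ->
  is_mxderive (A ^~ t) x (dx A x t).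
Proof.
move=> CA It i j; have [C1 C2] := CA i j; rewrite mxE; split=> /=.
  exact: (Ck_is_derive_x x (C1 1%N) It).
exact: (Ck_is_derive_x x (C2 1%N) It).
Qed.

Lemma smooth2_mx_is_dt A x t : smooth2_mx I A -> I t ->
  is_mxderive (A x) t (dt A x t).
Proof.
move=> CA It i j; have [C1 C2] := CA i j; rewrite mxE; split=> /=.
  exact: (Ck_is_derive_t x (C1 1%N) It).
exact: (Ck_is_derive_t x (C2 1%N) It).
Qed.

Lemma is_mxderive_t_congr A B x t D : I t -> (forall x t, I t -> A x t = B x t) ->
  is_mxderive (A x) t D -> is_mxderive (B x) t D.
Proof.
move=> It AB AD i j; have [A1 A2] := AD i j; split.
  apply: (@is_derive_t_congr R I oI (fun x t => complex.Re (A x t i j))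
    (fun x t => complex.Re (B x t i j)) x t _ It _ A1).
  by move=> *; rewrite AB.
apply: (@is_derive_t_congr R I oI (fun x t => complex.Im (A x t i j))
    (fun x t => complex.Im (B x t i j)) x t _ It _ A2).
by move=> *; rewrite AB.
Qed.

Lemma schwarz_mx A x t : smooth2_mx I A -> I t -> dt (dx A) x t = dx (dt A) x t.
Proof.
move=> CA It; apply/matrixP => i j; have [C1 C2] := CA i j.
have Rx : (fun s => complex.Re (dx A x s i j)) =
    (fun s => derive1 (fun y => complex.Re (A y s i j)) x).
  by apply/funext => s; rewrite [dx A x s i j]mxE.
have Ix : (fun s => complex.Im (dx A x s i j)) =
    (fun s => derive1 (fun y => complex.Im (A y s i j)) x).
  by apply/funext => s; rewrite [dx A x s i j]mxE.
have Rt : (fun y => complex.Re (dt A y t i j)) =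
    (fun y => derive1 (fun s => complex.Re (A y s i j)) t).
  by apply/funext => y; rewrite [dt A y t i j]mxE.
have It' : (fun y => complex.Im (dt A y t i j)) =
    (fun y => derive1 (fun s => complex.Im (A y s i j)) t).
  by apply/funext => y; rewrite [dt A y t i j]mxE.
rewrite [LHS]mxE [RHS]mxE Rx Ix Rt It'.
by rewrite (schwarz oI x C1 It) (schwarz oI x C2 It).
Qed.

Lemma strip_constant_mx A x t x0 t0 : is_interval I ->
  (forall x t, I t -> is_mxderive (A ^~ t) x 0) ->
  (forall x t, I t -> is_mxderive (A x) t 0) ->
  I t -> I t0 -> A x t = A x0 t0.
Proof.
move=> iI Ax At It It0; apply/matrixP => i j; apply/eqP.
rewrite eq_complex; apply/andP; split; apply/eqP.
  apply: (strip_constant iI (f := fun x t => complex.Re (A x t i j))) => // y s Is.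
    by have [] := Ax y s Is i j; rewrite mxE.
  by have [] := At y s Is i j; rewrite mxE.
apply: (strip_constant iI (f := fun x t => complex.Im (A x t i j))) => // y s Is.
  by have [] := Ax y s Is i j; rewrite mxE.
by have [] := At y s Is i j; rewrite mxE.
Qed.

End ComplexSmooth.

Section ComplexSmoothM.
Context {R : realType} {I : set R}.
Hypothesis oI : open I.

Lemma smooth2_mxM m n p (A : R -> R -> 'M[R[i]]_(m, n)) (B : R -> R -> 'M[R[i]]_(n, p)) :
  smooth2_mx I A -> smooth2_mx I B -> smooth2_mx I (fun x t => A x t *m B x t).
Proof.
move=> CA CB i j.
apply: (@csmooth2_congr _ _ oI (fun x t => \sum_k A x t i k * B x t k j)).
  by move=> x t _; rewrite mxE.
by apply: csmooth2_sum => // k _; exact: csmooth2M.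
Qed.

Lemma smooth2_mx_adj m n (A : R -> R -> 'M[R[i]]_(m, n)) :
  smooth2_mx I A -> smooth2_mx I (fun x t => adjmx (A x t)).
Proof.
move=> CA i j; apply: (csmooth2_congr oI _ (csmooth2_conj oI (CA j i))) => x t _.
by rewrite !mxE.
Qed.

End ComplexSmoothM.

Section ComplexFrobenius.
Context {R : realType} {I : set R}.
Hypotheses (oI : open I) (iI : is_interval I).

(* The (p, q) entry of the real 2 x 2 matrix of multiplication by z. *)
Definition realif (z : R[i]) (p q : bool) : R :=
  if p == q then complex.Re z else if p then complex.Im z else - complex.Im z.

Lemma realifD z w p q : realif (z + w) p q = realif z p q + realif w p q.
Proof. by rewrite /realif ReD ImD; case: p q => [] []//=; rewrite opprD. Qed.

Lemma realifM z w p q :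
  realif (z * w) p q = \sum_r realif z p r * realif w r q.
Proof.
rewrite big_bool; case: z w => [a b] [c d].
by case: p q => [] []; rewrite /realif /=; ring.
Qed.

Lemma realif_sum (K : Type) (r : seq K) (F : K -> R[i]) p q :
  realif (\sum_(k <- r) F k) p q = \sum_(k <- r) realif (F k) p q.
Proof.
elim: r => [|k r IH]; last by rewrite !big_cons realifD IH.
by rewrite !big_nil /realif/= oppr0; case: p q => [] [].
Qed.

Lemma realif_mulmx m n l (A : 'M[R[i]]_(m, n)) (B : 'M[R[i]]_(n, l)) i j p q :
  realif ((A *m B) i j) p q =
  \sum_(k : 'I_n * bool) realif (A i k.1) p k.2 * realif (B k.1 j) k.2 q.
Proof.
rewrite mxE realif_sum; under eq_bigr do rewrite realifM.
by rewrite pair_bigA.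
Qed.

Lemma smooth2_realif f p q : csmooth2 (I := I) f ->
  smooth2 I (fun x t => realif (f x t) p q).
Proof.
move=> [f1 f2]; rewrite /realif; case: eqP => // _; case: p => // k.
exact: (CkN oI (f2 k)).
Qed.

Lemma is_derive_realif (f : R -> R[i]) (x : R) a p q : is_cderive f x a ->
  is_derive x 1 (fun y => realif (f y) p q) (realif a p q).
Proof.
move=> [f1 f2]; rewrite /realif; case: eqP => // _; case: p => //.
exact: is_derive1N.
Qed.

(** Each column of [F] solves a real system of twice the size. Its unknowns, the real and imaginary
    parts, form the column [false] of the 2 x 2 real form, on which the real forms of the
    coefficients act by multiplication. *)
Theorem mx_frobenius n (A B : R -> R -> 'M[R[i]]_n) (C : 'M[R[i]]_n) t0 :
  smooth2_mx I A -> smooth2_mx I B ->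
  (forall x t, I t -> dt A x t + A x t *m B x t = dx B x t + B x t *m A x t) ->
  I t0 ->
  exists F : R -> R -> 'M[R[i]]_n, [/\ smooth2_mx I F, F 0 t0 = C,
    forall x t, I t -> is_mxderive (F ^~ t) x (A x t *m F x t)
    & forall x t, I t -> is_mxderive (F x) t (B x t *m F x t)].
Proof.
move=> CA CB AB It0.
pose rf (M : R -> R -> 'M[R[i]]_n) (j k : 'I_n * bool) x t :=
  realif (M x t j.1 k.1) j.2 k.2.
have Crf M : smooth2_mx I M -> forall j k, smooth2 I (rf M j k).
  by move=> CM j k; apply: smooth2_realif; exact: CM.
have /choice[y yP] (c : 'I_n) : exists y : 'I_n * bool -> R -> R -> R,
    [/\ forall j, smooth2 I (y j), forall j, y j 0 t0 = realif (C j.1 c) j.2 false,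
        forall j (x : R) t, I t ->
          is_derive x 1 (y j ^~ t) (\sum_k rf A j k x t * y k x t)
      & forall j x (t : R), I t ->
          is_derive t 1 (y j x) (\sum_k rf B j k x t * y k x t)].
  apply: (frobenius oI iI _ (Crf A CA) (Crf B CB)) => // j k x t It.
  have dA := is_derive1_val (is_derive_realif j.2 k.2
    (smooth2_mx_is_dt x CA It j.1 k.1)).
  have dB := is_derive1_val (is_derive_realif j.2 k.2
    (smooth2_mx_is_dx x CB It j.1 k.1)).
  rewrite /rf dA dB -!realif_mulmx -!realifD.
  have /matrixP/(_ j.1 k.1) := AB x t It.
  by rewrite !addmxE => ->.
pose F x t := \matrix_(i, j) (y j (i, false) x t +i* y j (i, true) x t).
have FE M i c p x t : \sum_k rf M (i, p) k x t * y c k x t =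
    realif ((M x t *m F x t) i c) p false.
  rewrite realif_mulmx; apply: eq_bigr => -[l q] _; rewrite /rf/= mxE.
  by case: q; rewrite /realif.
exists F; split.
- move=> i c; have [Cy _ _ _] := yP c; split=> k.
    apply: (Ck_congr oI _ (Cy (i, false) k)) => x t _.
    by rewrite mxE.
  apply: (Ck_congr oI _ (Cy (i, true) k)) => x t _.
  by rewrite mxE.
- apply/matrixP => i c; have [_ y0 _ _] := yP c.
  by rewrite mxE !y0 /realif/=; case: (C i c).
- move=> x t It i c; have [_ _ yx _] := yP c; split.
    under eq_fun do rewrite mxE/=.
    by have := yx (i, false) x t It; rewrite FE.
  under eq_fun do rewrite mxE/=.
  by have := yx (i, true) x t It; rewrite FE.
- move=> x t It i c; have [_ _ _ yt] := yP c; split.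
    under eq_fun do rewrite mxE/=.
    by have := yt (i, false) x t It; rewrite FE.
  under eq_fun do rewrite mxE/=.
  by have := yt (i, true) x t It; rewrite FE.
Qed.

Theorem mx_poincare n (A B : R -> R -> 'M[R[i]]_n) t0 :
  smooth2_mx I A -> smooth2_mx I B -> I t0 ->
  (forall x t, I t -> dt A x t = dx B x t) ->
  exists G : R -> R -> 'M[R[i]]_n, [/\ smooth2_mx I G,
    forall x t, I t -> is_mxderive (G ^~ t) x (A x t)
    & forall x t, I t -> is_mxderive (G x) t (B x t)].
Proof.
move=> CA CB It0 AB.
pose rp (p : bool) (z : R[i]) := if p then complex.Im z else complex.Re z.
have /choice[g gP] (ijp : 'I_n * 'I_n * bool) : exists g : R -> R -> R,
    [/\ smooth2 I g,
    forall (x : R) t, I t ->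
      is_derive x 1 (g ^~ t) (rp ijp.2 (A x t ijp.1.1 ijp.1.2))
    & forall x (t : R), I t ->
      is_derive t 1 (g x) (rp ijp.2 (B x t ijp.1.1 ijp.1.2))].
  case: ijp => [[i j] p] /=; have [A1 A2] := CA i j; have [B1 B2] := CB i j.
  apply: (poincare oI iI _ _ It0) => [||x t It]; [by case: (p)|by case: (p)|].
  have [A3 A4] := smooth2_mx_is_dt x CA It i j.
  have [B3 B4] := smooth2_mx_is_dx x CB It i j.
  case: (p) => /=.
    by rewrite (is_derive1_val A4) (is_derive1_val B4) AB.
  by rewrite (is_derive1_val A3) (is_derive1_val B3) AB.
exists (fun x t => \matrix_(i, j) (g (i, j, false) x t +i* g (i, j, true) x t)).
split.
- move=> i j; have [g1 _ _] := gP (i, j, false); have [g2 _ _] := gP (i, j, true).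
  split=> k.
    by apply: (Ck_congr oI _ (g1 k)) => x t _; rewrite mxE.
  by apply: (Ck_congr oI _ (g2 k)) => x t _; rewrite mxE.
- move=> x t It i j.
  have [_ g1 _] := gP (i, j, false); have [_ g2 _] := gP (i, j, true).
  by split; under eq_fun do rewrite mxE/=; [exact: g1|exact: g2].
- move=> x t It i j.
  have [_ _ g1] := gP (i, j, false); have [_ _ g2] := gP (i, j, true).
  by split; under eq_fun do rewrite mxE/=; [exact: g1|exact: g2].
Qed.

End ComplexFrobenius.

(** * Block matrices *)

Section BlockAlgebra.
Context {C : fieldType} {S : comNzRingType} (iota : {rmorphism C -> S}).
Context {n s : nat} (blk : 'I_n -> 'I_s) (c : 'I_s -> C).
Hypothesis c_inj : injective c.
Local Notation A := 'M[S]_n.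
Implicit Types X Y : A.

(** [bk], [bJ] and [bw] are the projection to the block diagonal part, the inverse of [ad omega] and
    [omega] itself, given by entries through the block index [blk] to avoid nested block matrices.
    The embedding [iota] of the scalars lets the same lemmas serve for differential polynomials and
    for complex matrices. *)
Definition bk X : A := \matrix_(a, b) (if blk a == blk b then X a b else 0).

Definition bJ X : A := \matrix_(a, b)
  (if blk a == blk b then 0 else iota (c (blk a) - c (blk b))^-1 * X a b).

Definition bw : A := \matrix_(a, b) (if a == b then iota (c (blk a)) else 0).

Lemma bkE X a b : bk X a b = if blk a == blk b then X a b else 0.
Proof. by rewrite mxE. Qed.

Lemma bmE X a b : (X - bk X) a b = if blk a == blk b then 0 else X a b.
Proof. by rewrite !mxE; case: ifP => _; rewrite ?subrr ?subr0. Qed.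

Lemma bJE X a b : bJ X a b =
  if blk a == blk b then 0 else iota (c (blk a) - c (blk b))^-1 * X a b.
Proof. by rewrite mxE. Qed.

Lemma bw_mulE X a b : (bw *m X) a b = iota (c (blk a)) * X a b.
Proof.
rewrite mxE (bigD1 a)//= big1 ?addr0 ?mxE ?eqxx// => i ia.
by rewrite mxE eq_sym (negbTE ia) mul0r.
Qed.

Lemma mul_bwE X a b : (X *m bw) a b = X a b * iota (c (blk b)).
Proof.
rewrite mxE (bigD1 b)//= big1 ?addr0 ?mxE ?eqxx// => i ib.
by rewrite mxE (negbTE ib) mulr0.
Qed.

Lemma bkD X Y : bk (X + Y) = bk X + bk Y.
Proof. by apply/matrixP => a b; rewrite !mxE; case: ifP; rewrite ?addr0. Qed.

Lemma bkN X : bk (- X) = - bk X.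
Proof. by apply/matrixP => a b; rewrite !mxE; case: ifP; rewrite ?oppr0. Qed.

Lemma bkB X Y : bk (X - Y) = bk X - bk Y.
Proof. by rewrite bkD bkN. Qed.

Lemma bkK X : bk (bk X) = bk X.
Proof. by apply/matrixP => a b; rewrite !mxE; case: eqP. Qed.

Lemma bk1 : bk 1%:M = 1%:M.
Proof.
apply/matrixP => a b; rewrite !mxE; have [->|_] := eqVneq a b.
  by rewrite eqxx.
by case: ifP.
Qed.

Lemma bkMr X Y : bk (X *m bk Y) = bk X *m bk Y.
Proof.
apply/matrixP => a b; rewrite !mxE; case: eqP => ab.
  apply: eq_bigr => i _; rewrite !mxE; case: eqP => ib; last by rewrite !mulr0.
  by rewrite ab ib eqxx.
rewrite big1// => i _; rewrite !mxE; case: eqP => ai; last by rewrite mul0r.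
case: eqP => ib; last by rewrite mulr0.
by case: ab; rewrite ai ib.
Qed.

Lemma bkMl X Y : bk (bk X *m Y) = bk X *m bk Y.
Proof.
apply/matrixP => a b; rewrite !mxE; case: eqP => ab.
  apply: eq_bigr => i _; rewrite !mxE; case: eqP => ai; last by rewrite !mul0r.
  by rewrite -ai ab eqxx.
rewrite big1// => i _; rewrite !mxE; case: eqP => ai; last by rewrite mul0r.
case: eqP => ib; last by rewrite mulr0.
by case: ab; rewrite ai ib.
Qed.

Lemma bw_bk X : bw *m bk X = bk X *m bw.
Proof.
apply/matrixP => a b; rewrite bw_mulE mul_bwE bkE.
by case: eqP => [->|]; rewrite ?mulr0 ?mul0r// mulrC.
Qed.

Lemma bkJ X : bk (bJ X) = 0.
Proof. by apply/matrixP => a b; rewrite !mxE; case: eqP. Qed.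

Lemma bk_comm X : bk (bw *m X - X *m bw) = 0.
Proof.
apply/matrixP => a b; rewrite bkE addmxE oppmxE bw_mulE mul_bwE zeromxE.
by case: eqP => // ->; rewrite mulrC subrr.
Qed.

Lemma comm_bJ X : bk X = 0 -> bw *m bJ X - bJ X *m bw = X.
Proof.
move=> /matrixP X0; apply/matrixP => a b.
have := X0 a b; rewrite addmxE oppmxE bw_mulE mul_bwE bJE bkE zeromxE.
case: eqP => [_ ->|ab _]; first by rewrite mulr0 mul0r subrr.
rewrite mulrA -rmorphM mulrAC -rmorphM -mulrBl -rmorphB.
rewrite [_^-1 * _]mulrC -mulrBl mulfV ?rmorph1 ?mul1r// subr_eq0.
by apply/eqP => /c_inj.
Qed.

Lemma bJ_comm X : bJ (bw *m X - X *m bw) = X - bk X.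
Proof.
apply/matrixP => a b.
rewrite bJE !(addmxE, oppmxE) bw_mulE mul_bwE bkE.
case: eqP => [_|ab]; first by rewrite subrr.
rewrite [X a b * _]mulrC -mulrBl mulrA -rmorphB -rmorphM mulVf.
  by rewrite rmorph1 mul1r subr0.
by rewrite subr_eq0; apply/eqP => /c_inj.
Qed.

Lemma eq_bJ X Y : X - bk X = Y - bk Y -> bJ X = bJ Y.
Proof.
move=> /matrixP XY; apply/matrixP => a b; have := XY a b.
rewrite !bJE !(addmxE, oppmxE) !bkE; case: eqP => // _.
by rewrite !subr0 => ->.
Qed.

(** By [bJ_comm] the off-diagonal part of [X] is recovered from its commutator with [bw]. *)
Lemma bk_comm0 X : bw *m X = X *m bw -> bk X = X.
Proof.
by move=> E; apply/esym/eqP; rewrite -subr_eq0 -bJ_comm E subrr;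
  apply/eqP/matrixP => a b; rewrite bJE mxE mulr0 if_same.
Qed.

Section Derivation.
Variable d : S -> S.
Hypotheses (dD : forall x y, d (x + y) = d x + d y)
  (dM : forall x y, d (x * y) = d x * y + x * d y)
  (d0 : forall z, d (iota z) = 0).

Let d00 : d 0 = 0.
Proof. by have := d0 0; rewrite rmorph0. Qed.

Lemma map_derivationD X Y : map_mx d (X + Y) = map_mx d X + map_mx d Y.
Proof. by apply/matrixP => a b; rewrite !mxE. Qed.

Lemma map_derivationM X Y :
  map_mx d (X *m Y) = map_mx d X *m Y + X *m map_mx d Y.
Proof.
apply/matrixP => a b; rewrite !mxE -big_split/=.
have dsum (r : seq 'I_n) (F : 'I_n -> S) :
    d (\sum_(i <- r) F i) = \sum_(i <- r) d (F i).
  by elim: r => [|i r IH]; rewrite ?big_nil// !big_cons dD IH.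
by rewrite dsum; apply: eq_bigr => i _; rewrite dM !mxE.
Qed.

Lemma map_derivation_bw : map_mx d bw = 0.
Proof. by apply/matrixP => a b; rewrite !mxE; case: eqP. Qed.

Lemma bk_map_derivation X : bk (map_mx d X) = map_mx d (bk X).
Proof. by apply/matrixP => a b; rewrite !mxE; case: eqP. Qed.

End Derivation.

End BlockAlgebra.

(** * Differential polynomials *)

(* Stated over an abstract algebra: unification in the concrete monoid algebra
   unfolds products into finite maps. *)
Lemma leibniz_of_spanning (G : comNzRingType) (S : comAlgType G) (K : Type)
    (M : K -> S) (D : S -> S) :
  (forall P : S -> Prop, (forall c k, P (c *: M k)) ->
     (forall p q, P p -> P q -> P (p + q)) -> forall p, P p) ->
  (forall p q, D (p + q) = D p + D q) -> (forall c p, D (c *: p) = c *: D p) ->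
  (forall k l, D (M k * M l) = D (M k) * M l + M k * D (M l)) ->
  forall p q, D (p * q) = D p * q + p * D q.
Proof.
move=> ind DD DZ DM p q; elim/ind : p => [c m|p1 p2 IH1 IH2]; last first.
  by rewrite mulrDl !DD IH1 IH2 !mulrDl addrACA.
elim/ind : q => [d m'|q1 q2 IH1 IH2]; last first.
  by rewrite mulrDr !DD IH1 IH2 !mulrDr addrACA.
have E (a b : S) : (c *: a) * (d *: b) = c *: (d *: (a * b)).
  by rewrite -scalerAl -scalerAr.
by rewrite !DZ !E !DZ DM !scalerDr.
Qed.

(* Sealed: otherwise unification compares distinct monomials by unfolding
   finite maps. *)
HB.lock Definition monomial (G : comNzRingType) (V : choiceType)
  (m : cmonom V) : malg (cmonom V) G := mkmalgU m 1.

HB.lock Definition monD (G : comNzRingType) (V : choiceType) (succ : V -> V)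
    (m : cmonom V) : malg (cmonom V) G :=
  \sum_(v <- finsupp m)
    mkmalgU (mmul (divcm m (ucm v)) (ucm (succ v))) (m v)%:R.

HB.lock Definition malgD (G : comNzRingType) (V : choiceType) (succ : V -> V)
    (p : malg (cmonom V) G) : malg (cmonom V) G :=
  mmap (mkmalgU mone) (monD G succ) p.

Section MonomialAlgebra.
Context {G : comNzRingType} {V : choiceType} (succ : V -> V).
Local Notation mon := (cmonom V).
Local Notation poly := (malg mon G).
Implicit Types (p q : poly) (m : mon) (v : V) (c : G).

Local Notation monomial := (@monomial G V).

Lemma coefU c m1 m2 : mcoeff m2 (mkmalgU m1 c : poly) = c *+ (m1 == m2).
Proof. exact: mcoeffU. Qed.

Lemma coef_monomial m1 m2 : mcoeff m2 (monomial m1) = (m1 == m2)%:R.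
Proof. by rewrite monomial.unlock; exact: mcoeffU1. Qed.

Lemma coefZ c p m : mcoeff m (c *: p) = c * mcoeff m p.
Proof. exact: mcoeffZ. Qed.

Lemma mkmalgU_scale m c : mkmalgU m c = c *: monomial m :> poly.
Proof.
apply/malgP => k; apply: (etrans (coefU c m k)); apply/esym.
by apply: (etrans (coefZ c (monomial m) k)); rewrite coef_monomial mulr_natr.
Qed.

Lemma monomialM m1 m2 : monomial (mmul m1 m2) = monomial m1 * monomial m2.
Proof. by rewrite monomial.unlock malgM_def fgmulUU mulr1. Qed.

Lemma monomial1 : monomial mone = 1.
Proof. by rewrite monomial.unlock. Qed.

Lemma malg_sum_monomial p : p = \sum_(m <- msupp p) mcoeff m p *: monomial m.
Proof.
by rewrite {1}[p]monalgE; apply: eq_bigr => m _; rewrite mkmalgU_scale.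
Qed.

Lemma cmonom_split m v : m v != 0%N -> m = mmul (ucm v) (divcm m (ucm v)).
Proof.
move=> mv; apply/eqP/cmP => i; rewrite cmM divcmE cmU; case: eqP => [<-|] /=; lia.
Qed.

Lemma malg_ind (P : poly -> Prop) :
  (forall c, P (c *: 1)) -> (forall v, P (monomial (ucm v))) ->
  (forall p q, P p -> P q -> P (p + q)) ->
  (forall p q, P p -> P q -> P (p * q)) -> forall p, P p.
Proof.
move=> Pc Pv PD PM p; rewrite [p]malg_sum_monomial.
have Pm m : P (monomial m).
  have [d] := ubnP (mdeg m); elim: d m => // d IH m; rewrite ltnS => md.
  have [->|m1] := eqVneq m mone.
    by rewrite monomial1 -[1]scale1r.
  have [v mv] : exists v, m v != 0%N.
    have [[v mv]|H] := pselect (exists v, m v != 0%N); first by exists v.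
    case/negP: m1; apply/cmP => v; rewrite cm1.
    by apply/eqP; apply: contra_notT H => mv; exists v.
  rewrite (cmonom_split mv) monomialM; apply: PM => //; apply: IH.
  by move: md; rewrite {1}(cmonom_split mv) mdegM mdegU.
elim/big_rec : _ => [|m q _ Pq].
  by have := Pc 0; rewrite scale0r.
have E : mcoeff m p *: monomial m = (mcoeff m p *: 1) * monomial m.
  by rewrite -scalerAl mul1r.
apply: (PD _ _ _ Pq); rewrite E.
exact: PM (Pc _) (Pm m).
Qed.

Local Notation monD := (monD G succ).
Local Notation malgD := (@malgD G V succ).

Lemma malgDE p : malgD p = \sum_(m <- msupp p) mcoeff m p *: monD m.
Proof.
rewrite malgD.unlock /mmap; apply: eq_bigr => m _.
by rewrite mkmalgU_scale monomial1 -scalerAl mul1r.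
Qed.

Lemma malgD_add p q : malgD (p + q) = malgD p + malgD q.
Proof. by rewrite malgD.unlock; exact: raddfD. Qed.

Lemma malgD_monomial m : malgD (monomial m) = monD m.
Proof.
rewrite malgDE (_ : msupp (monomial m) = [fset m]%fset); last first.
  by rewrite monomial.unlock; exact: msuppU1.
by rewrite big_seq_fset1 coef_monomial eqxx scale1r.
Qed.

Lemma malgD_scale c p : malgD (c *: p) = c *: malgD p.
Proof.
rewrite (malgDE p) malgDE scaler_sumr (big_fset_incl _ (msuppZ_le c p)).
  by apply: eq_bigr => m _; rewrite coefZ scalerA.
by move=> m _ /mcoeff_outdom ->; rewrite scale0r.
Qed.

Lemma monDE (d : {fset V}) m : (finsupp m `<=` d)%fset ->
  monD m = \sum_(v <- d) (m v)%:R *: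
    monomial (mmul (divcm m (ucm v)) (ucm (succ v))).
Proof.
move=> md; rewrite monD.unlock.
under eq_bigr do rewrite mkmalgU_scale.
apply: big_fset_incl => // v _ /fsfun_dflt ->.
by rewrite scale0r.
Qed.

Lemma scale_monomialMl c m1 m2 :
  (c *: monomial m1) * monomial m2 = c *: monomial (mmul m1 m2).
Proof. by rewrite monomialM -scalerAl. Qed.

Lemma scale_monomialMr c m1 m2 :
  monomial m1 * (c *: monomial m2) = c *: monomial (mmul m1 m2).
Proof. by rewrite monomialM -scalerAr. Qed.

(** [divcm] truncates at exponent [0], so the monomials in the Leibniz rule agree only when the
    differentiated variable occurs; otherwise its exponent [a], the coefficient, is [0]. *)
Lemma eq_natscale_monomial (a : nat) m1 m2 :
  (a != 0%N -> forall i, m1 i = m2 i) ->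
  a%:R *: monomial m1 = a%:R *: monomial m2.
Proof.
have [->|a0] := eqVneq a 0%N; first by rewrite mulr0n !scale0r.
by move=> /(_ isT)/cmP/eqP ->.
Qed.

Lemma monD_mul m1 m2 :
  monD (mmul m1 m2) = monD m1 * monomial m2 + monomial m1 * monD m2.
Proof.
have s1 : (finsupp m1 `<=` finsupp m1 `|` finsupp m2)%fset by exact: fsubsetUl.
have s2 : (finsupp m2 `<=` finsupp m1 `|` finsupp m2)%fset by exact: fsubsetUr.
rewrite (monDE s1) (monDE s2) (monDE (fsubset_refl (finsupp (mmul m1 m2)))) mdomD mulr_suml mulr_sumr -big_split/=.
apply: eq_bigr => v _.
rewrite cmM natrD scalerDl.
rewrite [_ * monomial m2]scale_monomialMl.
rewrite [monomial m1 * _]scale_monomialMr.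
apply: (f_equal2 +%R); apply: eq_natscale_monomial => mv i.
  by rewrite !(cmM, divcmE, cmU); case: eqP => [<-|]; lia.
by rewrite !(cmM, divcmE, cmU); case: eqP => [<-|]; lia.
Qed.

Lemma malg_linear_ind (P : poly -> Prop) :
  (forall c m, P (c *: monomial m)) -> (forall p q, P p -> P q -> P (p + q)) ->
  forall p, P p.
Proof.
move=> Pm PD p; rewrite [p]malg_sum_monomial.
elim/big_rec : _ => [|m q _ Pq]; last exact: PD (Pm _ _) Pq.
by have := Pm 0 mone; rewrite scale0r.
Qed.

Lemma malgD_mul p q : malgD (p * q) = malgD p * q + p * malgD q.
Proof.
apply: (@leibniz_of_spanning G poly mon monomial malgD malg_linear_ind malgD_add
  malgD_scale) => m1 m2.
by rewrite -monomialM !malgD_monomial monD_mul.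
Qed.

Lemma malgD_cst c : malgD (c *: 1) = 0.
Proof.
rewrite malgD_scale -monomial1 malgD_monomial monD.unlock.
by rewrite mdom1 big_seq_fset0 scaler0.
Qed.

Lemma malgD_var v : malgD (monomial (ucm v)) = monomial (ucm (succ v)).
Proof.
rewrite malgD_monomial (monDE (fsubset_refl _)) mdomU big_seq_fset1 cmUU.
rewrite scale1r; suff /eqP -> : mmul (divcm (ucm v) (ucm v)) (ucm (succ v)) ==
  ucm (succ v) by [].
by apply/cmP => i; rewrite !(cmM, divcmE, cmU); case: eqP; lia.
Qed.

End MonomialAlgebra.

Section DerivationKernel.
Context {G : numDomainType} {V : choiceType} (succ : V -> V) (ord : V -> nat).
Hypotheses (succ_inj : injective succ)
  (ord_succ : forall v, ord (succ v) = (ord v).+1).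
Local Notation mon := (cmonom V).
Local Notation poly := (malg mon G).

Lemma coef_monD (m M : mon) :
  mcoeff M (monD G succ m) =
  \sum_(v <- finsupp m)
    (m v)%:R * (mmul (divcm m (ucm v)) (ucm (succ v)) == M)%:R.
Proof.
rewrite (monDE _ (fsubset_refl _)) raddf_sum/=; apply: eq_bigr => v _.
by rewrite coefZ coef_monomial.
Qed.

Lemma coef_malgD (p : poly) (M : mon) :
  mcoeff M (malgD succ p) =
  \sum_(m <- msupp p) mcoeff m p * mcoeff M (monD G succ m).
Proof.
by rewrite malgDE raddf_sum/=; apply: eq_bigr => m _; rewrite coefZ.
Qed.

(** Let [v0] be of highest order among the variables of [p], occurring in the monomial [m0].
    Replacing one factor [v0] of [m0] by [succ v0] gives a monomial [M] that arises in the
    derivative from the pair [m0], [v0] alone, since [succ v0] occurs nowhere in [p]. Its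
    coefficient, [m0 v0] times that of [m0], is nonzero in characteristic zero. *)
Lemma malgD_eq0 (p : poly) : malgD succ p = 0 ->
  forall m, m != mone -> mcoeff m p = 0.
Proof.
move=> Dp0 m1 m1n1; apply/eqP/negPn/negP => pm1.
pose P k := `[< exists m v, [/\ m \in msupp p, m v != 0%N & ord v = k] >].
have exP : exists k, P k.
  have [v mv] : exists v, m1 v != 0%N.
    have [[v mv]|H] := pselect (exists v, m1 v != 0%N); first by exists v.
    case/negP: m1n1; apply/cmP => v; rewrite cm1.
    by apply/eqP; apply: contra_notT H => mv; exists v.
  by exists (ord v); apply/asboolP; exists m1, v; rewrite -mcoeff_neq0.
have ubP k : P k -> (k <= \max_(m <- msupp p) \max_(v <- finsupp m) ord v)%N.
  move=> /asboolP[m [v [mp mv <-]]].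
  apply: (@leq_trans (\max_(v <- finsupp m) ord v)).
    by apply: leq_bigmax_seq => //; rewrite -cmE_neq0.
  exact: (@leq_bigmax_seq _ _ _ (fun m : mon => \max_(v <- finsupp m) ord v)).
have [k /asboolP[m0 [v0 [m0p m0v0 <-]]] kmax] := ex_maxnP exP ubP.
have ord_le m v : m \in msupp p -> m v != 0%N -> (ord v <= ord v0)%N.
  by move=> mp mv; apply: kmax; apply/asboolP; exists m, v.
have sv0 m : m \in msupp p -> m (succ v0) = 0%N.
  move=> mp; apply/eqP/negPn/negP => /(ord_le _ _ mp).
  by rewrite ord_succ ltnn.
pose M := mmul (divcm m0 (ucm v0)) (ucm (succ v0)).
have uniqM m v : m \in msupp p -> m v != 0%N ->
    mmul (divcm m (ucm v)) (ucm (succ v)) == M -> m = m0 /\ v = v0.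
  move=> mp mv /cmP E.
  have vv0 : v = v0.
    have := E (succ v0); rewrite /M !(cmM, divcmE, cmU) !sv0//.
    by rewrite eqxx !sub0n !add0n; case: eqP => // /succ_inj.
  split=> //; apply/eqP/cmP => i; have := E i.
  move: mv; rewrite vv0 /M !(cmM, divcmE, cmU).
  by have [<-|] := eqVneq v0 i; lia.
have cM m : m \in msupp p ->
    mcoeff M (monD G succ m) = if m == m0 then (m0 v0)%:R else 0.
  move=> mp; rewrite coef_monD; case: eqVneq => [->|mm0].
    rewrite (bigD1_seq v0)/= ?fset_uniq -?cmE_neq0//.
    rewrite eqxx mulr1 big_seq_cond big1 ?addr0// => v /andP[vm vv0].
    case: eqP => [/eqP E|]; last by rewrite mulr0.
    have [|_ /eqP] := uniqM m0 v m0p _ E; first by rewrite cmE_neq0.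
    by rewrite (negbTE vv0).
  rewrite big_seq big1// => v vm.
  case: eqP => [/eqP E|]; last by rewrite mulr0.
  have [|/eqP] := uniqM m v mp _ E; first by rewrite cmE_neq0.
  by rewrite (negbTE mm0).
have := coef_malgD p M; rewrite Dp0 mcoeff0.
rewrite (bigD1_seq m0)/= ?fset_uniq// cM// eqxx big_seq_cond big1.
  move=> /esym/eqP; rewrite addr0 mulf_eq0 mcoeff_eq0 m0p/= pnatr_eq0.
  by rewrite (negbTE m0v0).
by move=> m /andP[mp /negbTE mm0]; rewrite cM// mm0 mulr0.
Qed.

End DerivationKernel.

Section DifferentialPolynomials.
Context {R : realType} {n : nat}.
Local Notation dp := (dpoly R n).
Implicit Types (p q : dp) (c : R[i]).

Definition jetsucc (v : @jetvar n) : @jetvar n := (v.1, v.2.+1).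

Lemma dpDE p : dpD p = malgD jetsucc p.
Proof. by rewrite malgD.unlock monD.unlock. Qed.

Lemma dpvarE (v : @jetvar n) : dpvar v = @monomial R[i] _ (ucm v).
Proof. by rewrite monomial.unlock. Qed.

Lemma dpconstE c : dpconst c = c *: (1 : dp).
Proof.
have := @mkmalgU_scale R[i] (@jetvar n) mone c.
by rewrite monomial1; exact.
Qed.

Lemma dpoly_ind (P : dp -> Prop) :
  (forall c, P (dpconst c)) -> (forall v, P (dpvar v)) ->
  (forall p q, P p -> P q -> P (p + q)) ->
  (forall p q, P p -> P q -> P (p * q)) -> forall p, P p.
Proof.
move=> Pc Pv PD PM; apply: malg_ind => // [c|v].
  by rewrite -dpconstE.
by rewrite -dpvarE.
Qed.

Lemma dpDD p q : dpD (p + q) = dpD p + dpD q.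
Proof. by rewrite !dpDE malgD_add. Qed.

Lemma dpDM p q : dpD (p * q) = dpD p * q + p * dpD q.
Proof. by rewrite !dpDE malgD_mul. Qed.

Lemma dpDZ c p : dpD (c *: p) = c *: dpD p.
Proof. by rewrite !dpDE malgD_scale. Qed.

Lemma dpD_const c : dpD (dpconst c : dp) = 0.
Proof. by rewrite dpDE dpconstE malgD_cst. Qed.

Lemma dpD_var v : dpD (dpvar v : dp) = dpvar (v.1, v.2.+1).
Proof. by rewrite dpDE !dpvarE malgD_var. Qed.

Lemma const_termD p q : const_term (p + q) = const_term p + const_term q.
Proof. exact: mcoeffD. Qed.

Lemma const_termM p q : const_term (p * q) = const_term p * const_term q.
Proof. exact: (rmorphM (mcoeff mone : {rmorphism _ -> _})). Qed.

Lemma const_termZ c p : const_term (c *: p) = c * const_term p.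
Proof. exact: mcoeffZ. Qed.

Lemma const_term_var v : const_term (dpvar v : dp) = 0.
Proof.
rewrite /const_term dpvarE coef_monomial.
by rewrite cm1_eq1.
Qed.

Lemma const_term_D p : const_term (dpD p) = 0.
Proof.
elim/dpoly_ind : p => [c|v|p q p0 q0|p q p0 q0].
- by rewrite dpD_const /const_term mcoeff0.
- by rewrite dpD_var const_term_var.
- exact: (etrans (congr1 const_term (dpDD p q)) (etrans (const_termD _ _)
    (etrans (f_equal2 +%R p0 q0) (addr0 0)))).
- apply: (etrans (congr1 const_term (dpDM p q))).
  apply: (etrans (const_termD _ _)); apply: (etrans (f_equal2 +%R
    (etrans (const_termM _ _) (congr1 (fun z => z * const_term q) p0))
    (etrans (const_termM _ _) (congr1 (fun z => const_term p * z) q0)))).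
  by rewrite mul0r mulr0 addr0.
Qed.

Lemma dpD_kernel p : dpD p = 0 -> const_term p = 0 -> p = 0.
Proof.
rewrite dpDE => Dp p0; apply/malgP => m; rewrite mcoeff0.
have [->//|m1] := eqVneq m mone.
apply: (@malgD_eq0 R[i] _ jetsucc (fun v => v.2)) Dp m m1 => //.
by move=> [u i] [v j] [-> ->].
Qed.

Lemma dpDinv_unique p q : dpD q = p -> const_term q = 0 -> dpDinv p = q.
Proof.
move=> Dq q0; rewrite /dpDinv; case: xgetP => [r _ [Dr r0]|/(_ q)[]//].
apply/subr0_eq; apply: dpD_kernel.
  have E : dpD (r - q) = dpD r + dpD (-1 *: q).
    by rewrite scaleN1r; exact: dpDD.
  by rewrite E dpDZ Dr Dq scaleN1r subrr.
have E : const_term (r - q) = const_term r + const_term (-1 *: q).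
  by rewrite scaleN1r; exact: const_termD.
by rewrite E const_termZ r0 q0 mulr0 addr0.
Qed.

End DifferentialPolynomials.

(** * The two recursions *)

Section FordyKulishRecursion.
Context {C : fieldType} {S : comNzRingType} (iota : {rmorphism C -> S}).
Context {n s : nat} (blk : 'I_n -> 'I_s) (c : 'I_s -> C).
Hypothesis c_inj : injective c.
Variables (d dinv : S -> S) (ct : S -> C).
Hypotheses (dD : forall x y, d (x + y) = d x + d y)
  (dM : forall x y, d (x * y) = d x * y + x * d y)
  (d0 : forall z, d (iota z) = 0)
  (ctD : forall x y, ct (x + y) = ct x + ct y)
  (ctM : forall x y, ct (x * y) = ct x * ct y)
  (ctd : forall x, ct (d x) = 0)
  (dinvP : forall p q, d q = p -> ct q = 0 -> dinv p = q).
Local Notation A := 'M[S]_n.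
Local Notation bk := (@bk S n s blk).
Local Notation bJ := (@bJ C S iota n s blk c).
Local Notation w := (@bw C S iota n s blk c).
Variable q : A.
Hypotheses (q_bk : bk q = 0) (q_ct : forall a b, ct (q a b) = 0).
Implicit Types X Y : A.

(** The two recursion steps over an abstract ring with derivation [d], formal inverse [dinv] and
    constant-term map [ct], which keeps the concrete monoid algebra out of the matrix
    computations. *)
Definition gFK_step (V : A) : A :=
  let Vm := bJ (map_mx d (V - bk V) - (q *m bk V - bk V *m q)
    - ((q *m (V - bk V) - (V - bk V) *m q)
       - bk (q *m (V - bk V) - (V - bk V) *m q))) in
  Vm + map_mx dinv (bk (q *m Vm - Vm *m q)).

Definition gLP_step (V : A) : A :=
  let B := bJ (bJ (w *m (map_mx d V - (q *m V - V *m q))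
    - (map_mx d V - (q *m V - V *m q)) *m w)) in
  map_mx dinv (bk (q *m (B - bk B) - (B - bk B) *m q)) + (B - bk B).

Let bk_mB X : bk (X - bk X) = 0.
Proof. by rewrite bkB bkK subrr. Qed.

(** [bJ] sees only the off-diagonal blocks, and there the derivative of [V - bk V] is that of [V]
    and the two brackets add up to [[q, V]]. *)
Lemma gFK_Vm V :
  bJ (map_mx d (V - bk V) - (q *m bk V - bk V *m q)
    - ((q *m (V - bk V) - (V - bk V) *m q)
       - bk (q *m (V - bk V) - (V - bk V) *m q)))
  = bJ (map_mx d V - (q *m V - V *m q)).
Proof.
apply: eq_bJ; apply/matrixP => a b.
rewrite [LHS]bmE [RHS]bmE; case: eqP => ab //.
rewrite [LHS]addmxE [in LHS]oppmxE bmE !(addmxE, oppmxE, mulmxBr, mulmxBl).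
rewrite [map_mx _ _ _ _]mxE bmE [map_mx _ _ _ _]mxE.
by case: eqP => // _; ring.
Qed.

(** Off the diagonal [bJ] inverts [ad w], so [ad_w^-2 ad_w] in the curve recursion collapses to
    [ad_w^-1], applied to the same [D V - [q, V]] as in [gFK_Vm]. *)
Lemma gLP_stepE V : gLP_step V = gFK_step V.
Proof.
rewrite /gLP_step /gFK_step gFK_Vm bJ_comm//.
set X := map_mx d V - _.
have -> : bJ (X - bk X) = bJ X by apply: eq_bJ; rewrite bk_mB subr0.
by rewrite bkJ subr0 addrC.
Qed.

Lemma ct0 : ct 0 = 0.
Proof. by apply: (addrI (ct 0)); rewrite -ctD !addr0. Qed.

Lemma ctN x : ct (- x) = - ct x.
Proof. by apply/eqP; rewrite -addr_eq0 -ctD addNr ct0. Qed.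

Definition noct X := forall a b, ct (X a b) = 0.

Lemma noctD X Y : noct X -> noct Y -> noct (X + Y).
Proof. by move=> X0 Y0 a b; rewrite mxE ctD X0 Y0 addr0. Qed.

Lemma noctN X : noct X -> noct (- X).
Proof. by move=> X0 a b; rewrite mxE ctN X0 oppr0. Qed.

Lemma ct_sum (I : Type) (r : seq I) (F : I -> S) :
  ct (\sum_(i <- r) F i) = \sum_(i <- r) ct (F i).
Proof. by elim: r => [|i r IH]; rewrite ?big_nil ?ct0// !big_cons ctD IH. Qed.

Lemma noctMl X Y : noct X -> noct (X *m Y).
Proof.
by move=> X0 a b; rewrite mxE ct_sum big1// => i _; rewrite ctM X0 mul0r.
Qed.

Lemma noctMr X Y : noct Y -> noct (X *m Y).
Proof.
by move=> Y0 a b; rewrite mxE ct_sum big1// => i _; rewrite ctM Y0 mulr0.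
Qed.

Lemma noct_bk X : noct X -> noct (bk X).
Proof. by move=> X0 a b; rewrite bkE; case: eqP => // _; rewrite ?ct0. Qed.

Lemma noct_bJ X : noct X -> noct (bJ X).
Proof.
by move=> X0 a b; rewrite bJE; case: eqP => _; rewrite ?ct0// ctM X0 mulr0.
Qed.

Lemma noct_sum (I : Type) (r : seq I) (F : I -> A) :
  (forall i, noct (F i)) -> noct (\sum_(i <- r) F i).
Proof.
move=> F0; elim: r => [|i r IH]; last by rewrite big_cons; exact: noctD.
by move=> a b; rewrite big_nil mxE ct0.
Qed.

(** The zero-curvature relation of the dressed series determines the off-diagonal part of [V_(j+1)]
    through [bJ], and shows that its diagonal part is the antiderivative without constant term which
    the recursion asks for. *)
Theorem gFK_dressing : exists T V : nat -> A,
  [/\ is_dressing (map_mx d) bk bJ q T, dressed w T V,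
      forall j, V j = iter j gFK_step w,
      forall j, w *m T j.+1 - T j.+1 *m w = dressing_rhs (map_mx d) bk q T j
    & forall j, map_mx d (V j) =
        q *m V j - V j *m q + (w *m V j.+1 - V j.+1 *m w)].
Proof.
have [T dT] := @exists_dressing S n (map_mx d) bk bJ q.
have [V [V0 [VS VT]]] := @exists_dressed S n w T dT.1.
have ZC j : map_mx d (V j) =
    q *m V j - V j *m q + (w *m V j.+1 - V j.+1 *m w).
  apply: (@dressed_zero_curvature S n (map_mx d) bk bJ w q) VT j => //.
  - exact: map_derivationD.
  - exact: map_derivationM.
  - exact: map_derivation_bw.
  - exact: bkD.
  - exact: bkN.
  - exact: bkK.
  - exact: bkMr.
  - exact: bk1.
  - exact: bw_bk.
  - exact: bkJ.
  - exact: comm_bJ.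
  - exact: bk_map_derivation.
have TC j : w *m T j.+1 - T j.+1 *m w = dressing_rhs (map_mx d) bk q T j.
  apply: (@dressing_comm S n (map_mx d) bk bJ w q) dT => //.
  - exact: map_derivationD.
  - exact: map_derivationM.
  - exact: bkD.
  - exact: bkN.
  - exact: bkK.
  - exact: bkMr.
  - exact: bk1.
  - exact: bkJ.
  - exact: comm_bJ.
  - exact: bk_map_derivation.
(* Every term of [dressing_rhs] is a derivative or contains a factor [q]; so [T_0 = 1] is the only
   coefficient with a constant term. *)
have noctT j : noct (T j.+1).
  elim: j => [|j IH]; rewrite dT.2; apply: noct_bJ; apply: noctD.
  - apply: noctD; first by move=> a b; rewrite mxE ctd.
    by apply: noctN; exact: noctMl.
  - apply: noct_sum => i; apply: noctMr; apply: noct_bk; exact: noctMl.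
  - apply: noctD; first by move=> a b; rewrite mxE ctd.
    by apply: noctN; exact: noctMl.
  - apply: noct_sum => i; apply: noctMr; apply: noct_bk; exact: noctMl.
have noctV j : noct (V j.+1).
  rewrite VS; apply: noctD; first by apply: noctMl; exact: noctT.
  by apply: noctN; apply: noct_sum => i; apply: noctMr; exact: noctT.
exists T, V; split=> // j; elim: j => [|j IH]; first by rewrite V0.
rewrite iterS -IH /gFK_step gFK_Vm ZC.
have -> : q *m V j - V j *m q + (w *m V j.+1 - V j.+1 *m w)
    - (q *m V j - V j *m q) = w *m V j.+1 - V j.+1 *m w by mx_ring.
rewrite bJ_comm//; rewrite -[LHS](subrK (bk (V j.+1))); congr (_ + _).
(* These are the diagonal blocks of the zero-curvature relation: [[w, .]] has none, nor has
   [[q, bk V]], since [bk q = 0]. The integrand is thus the derivative of a known polynomial and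
   [dinvP] applies. *)
have -> : bk (q *m (V j.+1 - bk (V j.+1)) - (V j.+1 - bk (V j.+1)) *m q) =
    map_mx d (bk (V j.+1)).
  rewrite -(bk_map_derivation blk d0) ZC [RHS]bkD bk_comm addr0.
  rewrite mulmxBr mulmxBl !bkB bkMr bkMl q_bk mulmx0 mul0mx.
  by rewrite !subr0.
apply/matrixP => a b; rewrite [RHS]mxE [in RHS]mxE.
symmetry; apply: dinvP => //.
by rewrite bkE; case: eqP => _; [exact: noctV|exact: ct0].
Qed.

End FordyKulishRecursion.

Section Instantiation.
Context {R : realType} {s : nat} (k : 'I_s -> nat) (mu : 'I_s -> R).
Local Notation n := (\sum_i k i)%N.

Definition blk : 'I_n -> 'I_s := @tagnat.sig1 s k.
Definition cc (i : 'I_s) : R[i] := ('i%C / 2%:R) * (mu i)%:C.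

Lemma i2_neq0 : 'i%C / 2%:R != 0 :> R[i].
Proof.
rewrite mulf_neq0// ?invr_eq0 ?pnatr_eq0//.
by rewrite eq_complex /= oner_eq0 andbF.
Qed.

Lemma cc_inj : injective mu -> injective cc.
Proof.
by move=> mu_inj i j /(mulfI i2_neq0)/complexI/mu_inj.
Qed.

Lemma kpartE (S : comNzRingType) (X : 'M[S]_n) : kpart X = bk blk X.
Proof.
apply/matrixP => a b; rewrite bkE mxE /blk; case: eqP => _; rewrite !mxE//.
by rewrite !tagnat.sig2K.
Qed.

Lemma mpartE (S : comNzRingType) (X : 'M[S]_n) : mpart X = X - bk blk X.
Proof.
apply/matrixP => a b; rewrite bmE mxE /blk; case: eqP => _; rewrite !mxE//.
by rewrite !tagnat.sig2K.
Qed.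

Lemma mxdiag_scalarE :
  \mxdiag_(i < s) ((mu i)%:C)%:M =
  \matrix_(a, b) (if a == b then (mu (blk a))%:C else 0) :> 'M[R[i]]_n.
Proof.
have RE i j (x : 'I_(k i)) (y : 'I_(k j)) :
    (tagnat.Rank i x == tagnat.Rank j y) = (i == j) && (x == y :> nat).
  by rewrite -val_eqE; exact: tagnat.eq_Rank.
apply/mxblockP => i j; have [<-|ij] := eqVneq i j.
  rewrite submxblock_diag; apply/matrixP => x y.
  rewrite !mxE /blk tagnat.Rank1K RE eqxx/=.
  by rewrite val_eqE; case: eqP.
rewrite mxblockK (negbTE ij); apply/matrixP => x y.
by rewrite !mxE RE (negbTE ij).
Qed.

Lemma omegaE : omega k mu = bw idfun blk cc.
Proof.
rewrite /omega mxdiag_scalarE; apply/matrixP => a b; rewrite !mxE /cc.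
by case: eqP; rewrite ?mulr0.
Qed.

Local Notation iota := (mkmalgU mone : {rmorphism R[i] -> dpoly R n}).

Lemma omegaDE : omegaD k mu = bw iota blk cc.
Proof.
rewrite /omegaD omegaE; apply/matrixP => a b; rewrite !mxE.
by case: eqP => // _; exact: (rmorph0 iota).
Qed.

(** [cc] lists the eigenvalues of [omega], so the constant in [ad_omega_inv] is the reciprocal of an
    eigenvalue of [ad omega]. *)
Lemma cc_sub_inv i j : mu i != mu j ->
  - 2%:R * 'i%C / (mu i - mu j)%:C = (cc i - cc j)^-1.
Proof.
move=> mij; rewrite /cc -mulrBr -rmorphB.
have m0 : (mu i - mu j)%:C != 0 :> R[i].
  by rewrite (inj_eq (@complexI R)) subr_eq0.
apply: (mulIf (mulf_neq0 i2_neq0 m0)); rewrite mulVf; last exact: mulf_neq0 i2_neq0 m0.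
have ii : 'i%C * 'i%C = -1 :> R[i] by rewrite -expr2 sqr_i.
have n2 : 2%:R != 0 :> R[i] by rewrite pnatr_eq0.
transitivity (- ('i%C * 'i%C) : R[i]); last by rewrite ii opprK.
by move: m0; move: ((mu i - mu j)%:C) => M M0; field; rewrite M0.
Qed.

Lemma ad_omega_invE : injective mu -> forall X : 'M[dpoly R n]_n,
  ad_omega_inv mu X = bJ iota blk cc X.
Proof.
move=> mu_inj X; apply/matrixP => a b; rewrite bJE mxE /blk.
case: eqP => ab; first by rewrite mxE.
rewrite !mxE !tagnat.sig2K cc_sub_inv; last by apply/eqP => /mu_inj.
exact: (esym (mul_malgC _ _)).
Qed.

Local Notation step := (gFK_step iota blk cc (@dpD R n) (@dpDinv R n) (QD k)).

Lemma FK_V_iter (mu_inj : injective mu) j :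
  FK_V k mu j = iter j step (bw iota blk cc).
Proof.
elim: j => [|j IH]; first by rewrite /= omegaDE.
rewrite iterS -IH /= /gFK_step /comm !kpartE !mpartE ad_omega_invE//.
Qed.

Lemma LP_X_iter (mu_inj : injective mu) j : LP_X k mu j = FK_V k mu j.
Proof.
rewrite FK_V_iter//; elim: j => [|j IH]; first by rewrite /= omegaDE.
rewrite !iterS -IH -gLP_stepE; last exact: cc_inj.
rewrite /LP_X iterS -/(LP_X k mu j) /LP_Rred /LP_P /frame_dx /gLP_step /comm.
move: (LP_X k mu j) => V.
rewrite omegaDE.
rewrite !(ad_omega_invE mu_inj).
move: (bJ _ _ _ (bJ _ _ _ _)) => B.
rewrite kpartE mpartE.
reflexivity.
Qed.

Lemma const_term_QD a b : const_term (QD k a b : dpoly R n) = 0.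
Proof.
rewrite /QD mpartE bmE; case: eqP => _; first exact: mcoeff0.
by rewrite mxE const_term_var.
Qed.

Theorem FK_dressing (mu_inj : injective mu) : exists T : nat -> 'M[dpoly R n]_n,
  [/\ is_dressing (map_mx (@dpD R n)) (bk blk) (bJ iota blk cc) (QD k) T,
      dressed (bw iota blk cc) T (FK_V k mu),
      forall j, bw iota blk cc *m T j.+1 - T j.+1 *m bw iota blk cc =
        dressing_rhs (map_mx (@dpD R n)) (bk blk) (QD k) T j
    & forall j, map_mx (@dpD R n) (FK_V k mu j) =
        QD k *m FK_V k mu j - FK_V k mu j *m QD k
        + (bw iota blk cc *m FK_V k mu j.+1 - FK_V k mu j.+1 *m bw iota blk cc)].
Proof.
have [||||||||| T [V [dT VT VE TC ZC]]] :=
  @gFK_dressing R[i] (dpoly R n) iota n s blk cc (cc_inj mu_inj) (@dpD R n)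
  (@dpDinv R n) (@const_term R n) _ _ _ _ _ _ _ (QD k) _ _.
- exact: dpDD.
- exact: dpDM.
- exact: dpD_const.
- exact: const_termD.
- exact: const_termM.
- exact: const_term_D.
- exact: dpDinv_unique.
- by rewrite /QD mpartE bkB bkK subrr.
- exact: const_term_QD.
exists T; have E : V = FK_V k mu.
  by apply/funext => j; rewrite VE FK_V_iter.
by rewrite -E; split.
Qed.

End Instantiation.

(** * Evaluation of differential polynomials *)

(** The counterpart of [leibniz_of_spanning] for evaluation maps, abstract for the same reason. *)
Lemma multiplicative_of_spanning (G S' : comNzRingType) (S : comAlgType G)
    (K : Type) (M : K -> S) (e : S -> S') (g : G -> S') :
  (forall P : S -> Prop, (forall c k, P (c *: M k)) ->
     (forall p q, P p -> P q -> P (p + q)) -> forall p, P p) ->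
  (forall p q, e (p + q) = e p + e q) -> (forall c p, e (c *: p) = g c * e p) ->
  (forall k l, e (M k * M l) = e (M k) * e (M l)) ->
  forall p q, e (p * q) = e p * e q.
Proof.
move=> ind eD eZ eM p q; elim/ind : p => [c m|p1 p2 IH1 IH2]; last first.
  by rewrite mulrDl !eD IH1 IH2 mulrDl.
elim/ind : q => [d m'|q1 q2 IH1 IH2]; last first.
  by rewrite mulrDr !eD IH1 IH2 mulrDr.
have E (a b : S) : (c *: a) * (d *: b) = c *: (d *: (a * b)).
  by rewrite -scalerAl -scalerAr.
by rewrite E !eZ eM mulrACA mulrA.
Qed.

Section Evaluation.
Context {G : comNzRingType} {V : choiceType} (x : V -> G).
Local Notation poly := (malg (cmonom V) G).

Definition evalmon (m : cmonom V) : G := \prod_(v <- finsupp m) x v ^+ m v.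
Definition evalmalg (p : poly) : G := mmap idfun evalmon p.

Lemma evalmonE (d : {fset V}) (m : cmonom V) : (finsupp m `<=` d)%fset ->
  evalmon m = \prod_(v <- d) x v ^+ m v.
Proof.
by move=> md; apply: big_fset_incl => // v _ /fsfun_dflt ->; rewrite expr0.
Qed.

Lemma evalmonM (m1 m2 : cmonom V) : evalmon (mmul m1 m2) = evalmon m1 * evalmon m2.
Proof.
rewrite (evalmonE (fsubsetUl (finsupp m1) (finsupp m2))).
rewrite (evalmonE (fsubsetUr (finsupp m1) (finsupp m2))).
rewrite /evalmon mdomD -big_split/=; apply: eq_bigr => v _.
by rewrite cmM exprD.
Qed.

Lemma evalmalgE p : evalmalg p = \sum_(m <- msupp p) mcoeff m p * evalmon m.
Proof. by []. Qed.

Lemma evalmalgD p q : evalmalg (p + q) = evalmalg p + evalmalg q.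
Proof. exact: (raddfD (mmap (idfun : {additive G -> G}) evalmon)). Qed.

Lemma evalmalgZ c p : evalmalg (c *: p) = c * evalmalg p.
Proof.
rewrite (evalmalgE p) evalmalgE mulr_sumr (big_fset_incl _ (msuppZ_le c p)).
  by apply: eq_bigr => m _; rewrite coefZ mulrA.
by move=> m _ /mcoeff_outdom ->; rewrite mul0r.
Qed.

Lemma evalmalg_monomial m : evalmalg (monomial G m) = evalmon m.
Proof.
rewrite evalmalgE (_ : msupp (monomial G m) = [fset m]%fset); last first.
  by rewrite monomial.unlock; exact: msuppU1.
by rewrite big_seq_fset1 coef_monomial eqxx mul1r.
Qed.

Lemma evalmalgM p q : evalmalg (p * q) = evalmalg p * evalmalg q.
Proof.
apply: (@multiplicative_of_spanning G G poly (cmonom V) (@monomial G V)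
  evalmalg idfun (@malg_linear_ind G V) evalmalgD evalmalgZ) => m1 m2.
by rewrite -monomialM !evalmalg_monomial evalmonM.
Qed.

Lemma evalmalg1 : evalmalg 1 = 1.
Proof. by rewrite -monomial1 evalmalg_monomial /evalmon mdom1 big_seq_fset0. Qed.

Lemma evalmalg_var v : evalmalg (monomial G (ucm v)) = x v.
Proof. by rewrite evalmalg_monomial /evalmon mdomU big_seq_fset1 cmUU. Qed.

End Evaluation.

Section DpolyEvaluation.
Context {R : realType} {n : nat}.
Implicit Types (Q : R -> 'M[R[i]]_n) (p q : dpoly R n) (x : R).

Definition jet Q x (v : @jetvar n) := (iter v.2 mxderive Q x) v.1.1 v.1.2.

Lemma dpevalE Q p x : dpeval Q p x = evalmalg (jet Q x) p.
Proof. by []. Qed.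

Lemma dpevalD Q x p q : dpeval Q (p + q) x = dpeval Q p x + dpeval Q q x.
Proof. exact: evalmalgD. Qed.

Lemma dpevalM Q x p q : dpeval Q (p * q) x = dpeval Q p x * dpeval Q q x.
Proof. exact: evalmalgM. Qed.

Lemma dpeval_const Q x c : dpeval Q (dpconst c) x = c.
Proof.
rewrite dpconstE.
by apply: (etrans (evalmalgZ (jet Q x) c 1)); rewrite evalmalg1 mulr1.
Qed.

Lemma dpeval_var Q x v : dpeval Q (dpvar v) x = jet Q x v.
Proof. by rewrite dpevalE dpvarE evalmalg_var. Qed.

(** [mxderive] is total and meaningless where the derivative fails to exist; this condition says
    that all jets of [Q] are genuine derivatives. *)
Definition jet_derivable Q := forall m x,
  is_mxderive (iter m mxderive Q) x (iter m.+1 mxderive Q x).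

Lemma is_cderive_dpeval Q x p : jet_derivable Q ->
  is_cderive (fun y => dpeval Q p y) x (dpeval Q (dpD p) x).
Proof.
move=> jQ; elim/(@dpoly_ind R n) : p => [c|v|p q p0 q0|p q p0 q0].
- rewrite dpD_const; under eq_fun do rewrite dpeval_const.
  have -> : dpeval Q (0 : dpoly R n) x = 0.
    by have := dpeval_const Q x 0; rewrite dpconstE scale0r.
  exact: is_cderive_cst.
- have -> : (fun y => dpeval Q (dpvar v) y) = (fun y => jet Q y v).
    by apply/funext => y; exact: dpeval_var.
  apply: (@is_cderive_eq R _ x (jet Q x (v.1, v.2.+1))); first exact: jQ.
  exact: (etrans (esym (dpeval_var Q x (v.1, v.2.+1)))
    (congr1 (fun p => dpeval Q p x) (esym (dpD_var v)))).
- have -> : (fun y => dpeval Q (p + q) y) = (fun y => dpeval Q p y + dpeval Q q y).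
    by apply/funext => y; exact: dpevalD.
  apply: (is_cderive_eq (is_cderiveD p0 q0)).
  exact: (etrans (esym (dpevalD Q x (dpD p) (dpD q)))
    (congr1 (fun p => dpeval Q p x) (esym (dpDD p q)))).
- have -> : (fun y => dpeval Q (p * q) y) = (fun y => dpeval Q p y * dpeval Q q y).
    by apply/funext => y; exact: dpevalM.
  apply: (is_cderive_eq (is_cderiveM p0 q0)).
  apply: (etrans _ (congr1 (fun p => dpeval Q p x) (esym (dpDM p q)))).
  apply: (etrans _ (esym (dpevalD Q x (dpD p * q) (p * dpD q)))).
  exact: (f_equal2 +%R (esym (dpevalM Q x (dpD p) q)) (esym (dpevalM Q x p (dpD q)))).
Qed.

End DpolyEvaluation.

Section MapBlocks.
Context {C : fieldType} {S : comNzRingType} (iota : {rmorphism C -> S}).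
Context {n s : nat} (blk : 'I_n -> 'I_s) (c : 'I_s -> C) (e : S -> C).
Hypotheses (eD : forall x y, e (x + y) = e x + e y)
  (eM : forall x y, e (x * y) = e x * e y) (e_iota : forall z, e (iota z) = z).
Implicit Types X Y : 'M[S]_n.

Let e0 : e 0 = 0.
Proof. by rewrite -(rmorph0 iota) e_iota. Qed.

Let eN x : e (- x) = - e x.
Proof. by apply/eqP; rewrite -addr_eq0 -eD addNr e0. Qed.

Let e_sum (I : Type) (r : seq I) (F : I -> S) :
  e (\sum_(i <- r) F i) = \sum_(i <- r) e (F i).
Proof. by elim: r => [|i r IH]; rewrite ?big_nil// !big_cons eD IH. Qed.

Lemma mapeD X Y : map_mx e (X + Y) = map_mx e X + map_mx e Y.
Proof. by apply/matrixP => a b; rewrite !mxE. Qed.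

Lemma mapeN X : map_mx e (- X) = - map_mx e X.
Proof. by apply/matrixP => a b; rewrite !mxE. Qed.

Lemma mapeM X Y : map_mx e (X *m Y) = map_mx e X *m map_mx e Y.
Proof.
apply/matrixP => a b; rewrite !mxE e_sum; apply: eq_bigr => i _.
by rewrite eM !mxE.
Qed.

Lemma mape_sum (I : Type) (r : seq I) (F : I -> 'M[S]_n) :
  map_mx e (\sum_(i <- r) F i) = \sum_(i <- r) map_mx e (F i).
Proof.
elim: r => [|i r IH]; last by rewrite !big_cons mapeD IH.
by rewrite !big_nil; apply/matrixP => a b; rewrite !mxE.
Qed.

Lemma mape_conv (f g : nat -> 'M[S]_n) j :
  map_mx e (conv f g j) = conv (fun i => map_mx e (f i)) (fun i => map_mx e (g i)) j.
Proof. by rewrite mape_sum; apply: eq_bigr => i _; rewrite mapeM. Qed.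

Lemma mape_bk X : map_mx e (bk blk X) = bk blk (map_mx e X).
Proof. by apply/matrixP => a b; rewrite !mxE; case: eqP. Qed.

Lemma mape_bJ X : map_mx e (bJ iota blk c X) = bJ idfun blk c (map_mx e X).
Proof.
by apply/matrixP => a b; rewrite !mxE; case: eqP => // _; rewrite eM e_iota.
Qed.

Lemma mape_bw : map_mx e (bw iota blk c) = bw idfun blk c.
Proof. by apply/matrixP => a b; rewrite !mxE; case: eqP. Qed.

Lemma mape1 : map_mx e (1%:M : 'M[S]_n) = 1%:M.
Proof.
apply/matrixP => a b; rewrite !mxE; case: eqP => _ //=.
by rewrite -(rmorph1 iota) e_iota.
Qed.

Lemma mape_dressing (D K : 'M[S]_n -> 'M[S]_n) q T j :
  (forall X, map_mx e (K X) = bk blk (map_mx e X)) ->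
  map_mx e (dressing_rhs D K q T j) = map_mx e (D (T j))
    - map_mx e q *m map_mx e (T j)
    + conv (fun i => map_mx e (T i))
        (fun i => bk blk (map_mx e q *m map_mx e (T i))) j.
Proof.
move=> eK; rewrite /dressing_rhs !mapeD mapeN mapeM mape_conv.
by congr (_ + _); apply: eq_conv => // i _; rewrite eK mapeM.
Qed.

End MapBlocks.

Section FKEvaluation.
Context {R : realType} {s : nat} (k : 'I_s -> nat) (mu : 'I_s -> R).
Local Notation n := (\sum_i k i)%N.
Local Notation M := 'M[R[i]]_n.
Local Notation K := (bk (@blk s k)).
Local Notation J := (@bJ R[i] R[i] idfun n s (@blk s k) (cc mu)).
Local Notation w := (@bw R[i] R[i] idfun n s (@blk s k) (cc mu)).

Local Notation iota := (mkmalgU mone : {rmorphism R[i] -> dpoly R n}).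

(** [dressing_rhs] after evaluation. The matrix [dt], which shadows the time derivative, stands for
    the [x]-derivative of [t j]. *)
Definition eval_rhs (q dt : M) (t : nat -> M) j : M :=
  dt - q *m t j + conv t (fun i => K (q *m t i)) j.

(** The algebra of the dressing series at the level of matrix functions: [tau] is the evaluated [T]
    and [nu] the evaluated [V]. Skewness and frame covariance of [nu] are deduced from these fields
    alone. *)
Record FK_eval (Q : R -> M) (tau nu : nat -> R -> M) : Prop := FKEval {
  FK_tau0 : forall x, tau 0%N x = 1%:M;
  FK_tau_derive : forall j x, is_mxderive (tau j) x (mxderive (tau j) x);
  FK_tauS : forall j x,
    tau j.+1 x = J (eval_rhs (Q x) (mxderive (tau j) x) (tau ^~ x) j);
  FK_tau_comm : forall j x, w *m tau j.+1 x - tau j.+1 x *m w =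
    eval_rhs (Q x) (mxderive (tau j) x) (tau ^~ x) j;
  FK_dressed : forall j x, conv (nu ^~ x) (tau ^~ x) j = tau j x *m w;
  FK_nu_derive : forall j x, is_mxderive (nu j) x
    (Q x *m nu j x - nu j x *m Q x + (w *m nu j.+1 x - nu j.+1 x *m w)) }.

Theorem exists_FK_eval : injective mu ->
  exists tau : (R -> M) -> nat -> R -> M, forall Q, jet_derivable Q ->
    (forall x, K (Q x) = 0) ->
    FK_eval Q (tau Q) (fun j => dpeval_mx Q (FK_V k mu j)).
Proof.
move=> mu_inj; have [T [dT VT TC ZC]] := FK_dressing k mu_inj.
exists (fun Q j => dpeval_mx Q (T j)) => Q jQ QK.
have eD x := dpevalD Q x; have eM x := dpevalM Q x.
have ec x z : dpeval Q (iota z) x = z := dpeval_const Q x z.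
have evD P x : is_mxderive (dpeval_mx Q P) x (dpeval_mx Q (map_mx (@dpD R n) P) x).
  move=> a b; rewrite [dpeval_mx _ _ x a b]mxE [map_mx _ _ a b]mxE.
  have -> : (fun y => dpeval_mx Q P y a b) = (fun y => dpeval Q (P a b) y).
    by apply/funext => y; rewrite mxE.
  exact: is_cderive_dpeval.
(* [QD] omits the variables of the diagonal blocks; it evaluates to [Q] because [Q] vanishes
   there. *)
have evQ x : dpeval_mx Q (QD k) x = Q x.
  have Q0 a b : dpeval Q (if blk a == blk b then 0 else dpvar (a, b, 0%N)) x = Q x a b.
    have := QK x => /matrixP/(_ a b); rewrite bkE zeromxE.
    case: eqP => _; last by rewrite dpeval_var.
    by move=> ->; have := dpeval_const Q x 0; rewrite dpconstE scale0r.
  apply/matrixP => a b; rewrite [LHS]mxE -Q0; congr (dpeval Q _ x).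
  by rewrite /QD mpartE bmE mxE.
split.
- move=> x; rewrite dT.1.
  exact: (mape1 (ec x)).
- by move=> j x; rewrite (is_mxderive_val (evD (T j) x)); exact: evD.
- move=> j x; rewrite (is_mxderive_val (evD (T j) x)) dT.2 /eval_rhs -evQ.
  apply: (etrans (mape_bJ _ _ (eM x) (ec x) _)); congr J.
  apply: (mape_dressing (eD x) (eM x) (ec x) (map_mx (@dpD R n))) => X.
  exact: (mape_bk _ (ec x)).
- move=> j x; rewrite (is_mxderive_val (evD (T j) x)) /eval_rhs -evQ.
  have E := mape_dressing (eD x) (eM x) (ec x) (map_mx (@dpD R n)) (QD k) T j
    (fun X => mape_bk (@blk s k) (ec x) X).
  apply: (etrans _ E).
  apply: (etrans _ (congr1 (fun X => dpeval_mx Q X x) (TC j))).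
  apply: (etrans _ (esym (mapeD (eD x) _ _))).
  apply: (f_equal2 +%R).
    apply: (etrans _ (esym (mapeM (eD x) (eM x) (ec x) _ _))).
    by rewrite (mape_bw _ _ (ec x)).
  apply: (etrans _ (esym (mapeN (eD x) (ec x) _))); congr (- _).
  apply: (etrans _ (esym (mapeM (eD x) (eM x) (ec x) _ _))).
  by rewrite (mape_bw _ _ (ec x)).
- move=> j x.
  apply: (etrans (esym (mape_conv (eD x) (eM x) (ec x) _ _ _))).
  apply: (etrans (congr1 (fun X => dpeval_mx Q X x) (VT j))).
  apply: (etrans (mapeM (eD x) (eM x) (ec x) _ _)).
  by rewrite (mape_bw _ _ (ec x)).
- move=> j x; apply: (is_mxderive_eq (evD (FK_V k mu j) x)).
  apply: (etrans (congr1 (fun X => dpeval_mx Q X x) (ZC j))).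
  have evM X Y : dpeval_mx Q (X *m Y) x = dpeval_mx Q X x *m dpeval_mx Q Y x.
    exact: (mapeM (eD x) (eM x) (ec x) X Y).
  have evN X : dpeval_mx Q (- X) x = - dpeval_mx Q X x.
    exact: (mapeN (eD x) (ec x) X).
  have evA X Y : dpeval_mx Q (X + Y) x = dpeval_mx Q X x + dpeval_mx Q Y x.
    exact: (mapeD (eD x) X Y).
  have evw := mape_bw (@blk s k) (cc mu) (ec x).
  move: (FK_V k mu j) (FK_V k mu j.+1) => V V'.
  apply: (etrans (evA _ _)); apply: (f_equal2 +%R).
    apply: (etrans (evA _ _)); apply: (f_equal2 +%R).
      by apply: (etrans (evM _ _)); rewrite evQ.
    by apply: (etrans (evN _)); congr (- _); apply: (etrans (evM _ _)); rewrite evQ.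
  apply: (etrans (evA _ _)); apply: (f_equal2 +%R).
    by apply: (etrans (evM _ _)); rewrite /dpeval_mx evw.
  apply: (etrans (evN _)); congr (- _); apply: (etrans (evM _ _)).
  by rewrite /dpeval_mx evw.
Qed.

End FKEvaluation.

(** * Skew-Hermitian values *)

Section Adjoint.
Context {R : realType}.

Lemma adjmxM m n p (A : 'M[R[i]]_(m, n)) (B : 'M[R[i]]_(n, p)) :
  adjmx (A *m B) = adjmx B *m adjmx A.
Proof. by rewrite trmx_mul map_mxM. Qed.

Lemma adjmxD m n (A B : 'M[R[i]]_(m, n)) : adjmx (A + B) = adjmx A + adjmx B.
Proof. by rewrite linearD /= map_mxD. Qed.

Lemma adjmxN m n (A : 'M[R[i]]_(m, n)) : adjmx (- A) = - adjmx A.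
Proof. by rewrite linearN /= map_mxN. Qed.

Lemma adjmxK m n (A : 'M[R[i]]_(m, n)) : adjmx (adjmx A) = A.
Proof. by apply/matrixP => i j; rewrite !mxE conjCK. Qed.

Lemma adjmx1 n : adjmx (1%:M : 'M[R[i]]_n) = 1%:M.
Proof. by rewrite trmx1 map_mx1. Qed.

Lemma adjmx_sum m n (I : Type) (r : seq I) (F : I -> 'M[R[i]]_(m, n)) :
  adjmx (\sum_(i <- r) F i) = \sum_(i <- r) adjmx (F i).
Proof.
elim: r => [|i r IH]; last by rewrite !big_cons adjmxD IH.
by rewrite !big_nil trmx0 map_mx0.
Qed.

Lemma adjmx_conv n (f g : nat -> 'M[R[i]]_n) j :
  adjmx (conv f g j) = conv (fun i => adjmx (g i)) (fun i => adjmx (f i)) j.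
Proof.
rewrite conv_rev adjmx_sum; apply: eq_bigr => i _.
by rewrite adjmxM.
Qed.

Lemma adjmx_bk n s (blk : 'I_n -> 'I_s) (A : 'M[R[i]]_n) :
  adjmx (bk blk A) = bk blk (adjmx A).
Proof.
apply/matrixP => a b; rewrite !mxE eq_sym; case: eqP => // _.
by rewrite rmorph0.
Qed.

Lemma bk_conv n s (blk : 'I_n -> 'I_s) (f g : nat -> 'M[R[i]]_n) j :
  (forall i, (i <= j)%N -> bk blk (f i) = f i) ->
  (forall i, (i <= j)%N -> bk blk (g i) = g i) ->
  bk blk (conv f g j) = conv f g j.
Proof.
move=> fK gK; rewrite /conv (big_morph (bk blk) (@bkD _ _ _ blk) (id1 := 0)).
  apply: eq_bigr => i _.
  by rewrite -(gK (j - i)%N) ?leq_subr// bkMr fK// -ltnS.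
by apply/matrixP => a b; rewrite bkE zeromxE if_same.
Qed.

(** The mirror image of [conv_eq0], cancelling a left factor; adjoints exchange the two sides. *)
Lemma mulmx_bk_eq0 n (f g : nat -> 'M[R[i]]_n) j : f 0%N = 1%:M ->
  (forall i, (i <= j)%N -> conv f g i = 0) -> g j = 0.
Proof.
move=> f0 fg; have := @conv_eq0 _ _ (fun i => adjmx (g i)) (fun i => adjmx (f i)) j.
rewrite f0 adjmx1 => /(_ erefl) H.
rewrite -[g j]adjmxK H ?trmx0 ?map_mx0// => i ij.
by rewrite -adjmx_conv fg// trmx0 map_mx0.
Qed.

Lemma is_mxderive_bk n s (blk : 'I_n -> 'I_s) (F : R -> 'M[R[i]]_n) x D :
  is_mxderive F x D -> is_mxderive (fun y => bk blk (F y)) x (bk blk D).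
Proof.
move=> FD a b; rewrite bkE; under eq_fun do rewrite bkE.
by case: eqP => // _; exact: is_cderive_cst.
Qed.

End Adjoint.

Section SkewHermitian.
Context {R : realType} {s : nat} (k : 'I_s -> nat) (mu : 'I_s -> R).
Hypothesis mu_inj : injective mu.
Local Notation n := (\sum_i k i)%N.
Local Notation M := 'M[R[i]]_n.
Local Notation K := (bk (@blk s k)).
Local Notation w := (@bw R[i] R[i] idfun n s (@blk s k) (cc mu)).

Lemma adj_w : adjmx w = - w.
Proof.
apply/matrixP => a b; rewrite !mxE eq_sym; case: eqP => [->|_] /=; last first.
  by rewrite rmorph0 oppr0.
rewrite /cc rmorphM -mulNr; congr (_ * _); last exact: conjc_real.
rewrite rmorphM /= -mulNr; congr (_ * _).
  by apply/eqP; rewrite eq_complex /= oppr0 !eqxx.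
by rewrite fmorphV rmorph_nat.
Qed.

Variables (Q : R -> M) (tau nu : nat -> R -> M).
Hypotheses (FK : FK_eval mu Q tau nu) (Q_skew : forall x, adjmx (Q x) = - Q x).

Let ad j x := adjmx (tau j x).
Let G j x := conv (ad ^~ x) (tau ^~ x) j.
Let h x i := K (Q x *m tau i x).

(** [G] is the Gram series of [T], with [lambda] treated as real. The equation of [T] gives [lambda
    [w, G] = G_x + h^* G + G h]. If [G_0, ..., G_j] are block diagonal, so is coefficient [j] of the
    right side, whereas a commutator with [w] has zero diagonal blocks; so both sides vanish and
    [G_(j+1)] commutes with [w]. *)
Lemma gram_bk j x : K (G j x) = G j x.
Proof.
have [m] := ubnP j; elim: m j x => // m IH [|j] x; rewrite ltnS => jm.
  rewrite /G /conv big_ord_recl big_ord0 addr0 /ad (FK_tau0 FK) adjmx1.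
  by rewrite mulmx1 bk1.
have GK i y : (i <= j)%N -> K (G i y) = G i y.
  by move=> ij; apply: IH; exact: leq_ltn_trans ij jm.
apply: (@bk_comm0 _ _ _ _ _ _ _ (cc_inj mu_inj)).
pose tau' i := mxderive (tau i) x.
pose Rh i := eval_rhs (Q x) (tau' i) (tau ^~ x) i.
have wt i : w *m tau i.+1 x - tau i.+1 x *m w = Rh i := FK_tau_comm FK i x.
have wad i : w *m ad i.+1 x - ad i.+1 x *m w = adjmx (Rh i).
  by rewrite -wt adjmxD adjmxN !adjmxM adj_w mulmxN mulNmx opprK addrC.
have ERh i : Rh i = tau' i - Q x *m tau i x + conv (tau ^~ x) (h x) i by [].
have EadRh i : adjmx (Rh i) = adjmx (tau' i) + ad i x *m Q x
    + conv (fun l => adjmx (h x l)) (ad ^~ x) i.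
  rewrite ERh !adjmxD adjmxN adjmxM Q_skew mulmxN opprK.
  by rewrite adjmx_conv.
pose G' := conv (fun i => adjmx (tau' i)) (tau ^~ x) j + conv (ad ^~ x) tau' j.
have GD : is_mxderive (G j) x G'.
  rewrite /G' /conv -big_split/=.
  apply: is_mxderive_sum => i _; apply: is_mxderiveM.
    by apply: is_mxderive_adj; exact: FK_tau_derive FK _ _.
  exact: FK_tau_derive FK _ _.
have G'K : K G' = G'.
  apply: etrans (is_mxderive_val GD).
  rewrite -(is_mxderive_val (is_mxderive_bk (@blk s k) GD)).
  by congr (mxderive _ x); apply/funext => y; rewrite GK.
(* The terms containing [Q] itself cancel by skewness, which leaves only block diagonal factors on
   the right. *)
have E : w *m G j.+1 x - G j.+1 x *m w =
    G' + conv (fun i => adjmx (h x i)) (fun i => G i x) j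
    + conv (fun i => G i x) (h x) j.
  have e1 : w *m G j.+1 x - G j.+1 x *m w =
      conv (fun i => w *m ad i x - ad i x *m w) (tau ^~ x) j.+1
      + conv (ad ^~ x) (fun i => w *m tau i x - tau i x *m w) j.+1.
    rewrite convDl convDr convNl convNr convMl convMr convMm /G; mx_ring.
  rewrite e1 convSl convSr (FK_tau0 FK) {1 2}/ad (FK_tau0 FK) adjmx1.
  rewrite !mulmx1 !mul1mx subrr mul0mx mulmx0 add0r addr0.
  have -> : conv (fun i => w *m ad i.+1 x - ad i.+1 x *m w) (tau ^~ x) j =
      conv (fun i => adjmx (tau' i) + ad i x *m Q x
        + conv (fun l => adjmx (h x l)) (ad ^~ x) i) (tau ^~ x) j.
    by apply: eq_conv => // i _; exact: etrans (wad i) (EadRh i).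
  have -> : conv (ad ^~ x) (fun i => w *m tau i.+1 x - tau i.+1 x *m w) j =
      conv (ad ^~ x) (fun i => tau' i - Q x *m tau i x
        + conv (tau ^~ x) (h x) i) j.
    by apply: eq_conv => // i _; exact: etrans (wt i) (ERh i).
  have := convA (fun l => adjmx (h x l)) (ad ^~ x) (tau ^~ x) j.
  have := convA (ad ^~ x) (tau ^~ x) (h x) j.
  rewrite !convDl !convDr convNr convMm /G' /G => -> <-.
  by mx_ring.
clearbody G'.
have hK i : K (h x i) = h x i by rewrite /h bkK.
have EK : K (w *m G j.+1 x - G j.+1 x *m w) = w *m G j.+1 x - G j.+1 x *m w.
  rewrite E !bkD G'K.
  have hK' i : K (adjmx (h x i)) = adjmx (h x i) by rewrite -adjmx_bk hK.
  congr (_ + _ + _); apply: bk_conv => // i ij; exact: GK.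
by apply/subr0_eq; apply: etrans (esym EK) _; exact: bk_comm.
Qed.

(** Multiplied by the adjoint of [T] on the left and by [T] on the right, the sum of [V] and its
    adjoint becomes [G w - w G], which is [0] by [gram_bk]. Both factors have constant term [1] and
    cancel. *)
Lemma FK_nu_skew j x : adjmx (nu j x) = - nu j x.
Proof.
apply/eqP; rewrite -addr_eq0 addrC; apply/eqP.
apply: (@mulmx_bk_eq0 _ _ (ad ^~ x) (fun j => nu j x + adjmx (nu j x))).
  by rewrite /ad (FK_tau0 FK) adjmx1.
move=> i _; apply: (@conv_eq0 _ _ (fun i => conv (ad ^~ x)
  (fun j => nu j x + adjmx (nu j x)) i) (tau ^~ x)); first exact: FK_tau0 FK x.
move=> l _.
have e1 : conv (conv (ad ^~ x) (nu ^~ x)) (tau ^~ x) l = G l x *m w.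
  rewrite -convA /G -convMr; apply: eq_conv => // p _.
  exact: FK_dressed FK p x.
have e2 : conv (conv (ad ^~ x) (fun j => adjmx (nu j x))) (tau ^~ x) l
    = - (w *m G l x).
  rewrite /G -convMl -convNl; apply: eq_conv => // p _.
  rewrite -[LHS](adjmxK) adjmx_conv.
  rewrite (eq_conv (f' := nu ^~ x) (g' := tau ^~ x)); last 2 first.
  - by move=> q _; rewrite adjmxK.
  - by move=> q _; rewrite /ad adjmxK.
  by rewrite (FK_dressed FK) adjmxM adj_w mulNmx.
rewrite (eq_conv (f' := fun i => conv (ad ^~ x) (nu ^~ x) i +
  conv (ad ^~ x) (fun j => adjmx (nu j x)) i) (g' := tau ^~ x))//; last first.
  by move=> p _; rewrite convDr.
by rewrite convDl e1 e2 -gram_bk -bw_bk subrr.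
Qed.

End SkewHermitian.

(** * Smoothness in [x] and smoothness of evaluated differential polynomials *)

Section SpatialSmoothness.
Context {R : realType}.

Lemma smooth1_jcont (f : R -> R) x t : smooth1 f -> jcont (fun x _ => f x) x t.
Proof.
move=> Cf; have cf : {for x, continuous f}.
  by apply: differentiable_continuous; apply/derivable1_diffP; exact: (Cf 0%N).
by apply: (@continuous_comp _ _ _ (fst : R * R -> R) f); [exact: cvg_fst|exact: cf].
Qed.

(** A function of [x] alone is viewed as constant in [t], so that the calculus on strips applies to
    a frame at a single time. *)
Lemma smooth1_smooth2 (I : set R) (f : R -> R) : open I -> smooth1 f ->
  smooth2 I (fun x _ => f x).
Proof.
move=> oI + k; elim: k f => [|k IH] f Cf.
  by split=> // x t It; exact: smooth1_jcont.
apply: (CkS_intro oI (fx := fun x _ => derive1 f x) (ft := fun _ _ => 0)).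
- by move=> x t It; exact: smooth1_jcont.
- by move=> x t _; apply: derivable_is_derive1; exact: (Cf 0%N).
- have Cf' : smooth1 (derive1 f) by move=> j x; rewrite -derive1Sn; exact: (Cf j.+1).
  exact: IH Cf'.
- exact: Ck_cst.
Qed.

Lemma smooth2_smooth1 (I : set R) (f : R -> R -> R) t : smooth2 I f -> I t ->
  smooth1 (f ^~ t).
Proof.
move=> Cf It k; elim: k f Cf => [|k IH] f Cf x.
  by case: (Ck_is_derive_x x (Cf 1%N) It).
by rewrite derive1Sn; exact: IH (smooth2_dx Cf) x.
Qed.

Lemma smooth1_mx_smooth2_mx (I : set R) m n (A : R -> 'M[R[i]]_(m, n)) :
  open I -> smooth1_mx A -> smooth2_mx I (fun x _ => A x).
Proof.
by move=> oI CA i j; have [A1 A2] := CA i j; split; exact: smooth1_smooth2.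
Qed.

Lemma smooth2_mx_smooth1_mx (I : set R) m n (A : R -> R -> 'M[R[i]]_(m, n)) t :
  smooth2_mx I A -> I t -> smooth1_mx (A ^~ t).
Proof.
move=> CA It i j; have [A1 A2] := CA i j; split.
  exact: (smooth2_smooth1 A1 It).
exact: (smooth2_smooth1 A2 It).
Qed.

Section Jets.
Context {I : set R} {n : nat}.
Hypothesis oI : open I.
Implicit Types Q : R -> R -> 'M[R[i]]_n.

Lemma iter_mxderive m Q t : iter m mxderive (Q ^~ t) = (iter m dx Q) ^~ t.
Proof. by elim: m => //= m ->. Qed.

Lemma smooth2_mx_iter_dx m Q : smooth2_mx I Q -> smooth2_mx I (iter m dx Q).
Proof. by move=> CQ; elim: m => //= m; exact: smooth2_mx_dx. Qed.

Lemma smooth2_jet_derivable Q t : smooth2_mx I Q -> I t -> jet_derivable (Q ^~ t).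
Proof.
move=> CQ It m x; rewrite iterS !iter_mxderive.
exact: smooth2_mx_is_dx (smooth2_mx_iter_dx m CQ) It.
Qed.

Lemma csmooth2_dpeval Q p : smooth2_mx I Q ->
  csmooth2 (I := I) (fun x t => dpeval (Q ^~ t) p x).
Proof.
move=> CQ; elim/(@dpoly_ind R n) : p => [c|v|p q p0 q0|p q p0 q0].
- apply: (csmooth2_congr oI _ (csmooth2_cst oI c)) => x t _.
  by rewrite dpeval_const.
- apply: (csmooth2_congr oI _ (smooth2_mx_iter_dx v.2 CQ v.1.1 v.1.2)) => x t _.
  by rewrite dpeval_var /jet iter_mxderive.
- apply: (csmooth2_congr oI _ (csmooth2D oI p0 q0)) => x t _.
  exact: (esym (dpevalD (Q ^~ t) x p q)).
- apply: (csmooth2_congr oI _ (csmooth2M oI p0 q0)) => x t _.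
  exact: (esym (dpevalM (Q ^~ t) x p q)).
Qed.

Lemma smooth2_dpeval_mx Q P : smooth2_mx I Q ->
  smooth2_mx I (fun x t => dpeval_mx (Q ^~ t) P x).
Proof.
move=> CQ i j; apply: (csmooth2_congr oI _ (csmooth2_dpeval (P i j) CQ)) => x t _.
by rewrite [RHS]mxE.
Qed.

End Jets.

End SpatialSmoothness.

Section UnitaryAlgebra.
Context {R : realType}.

Lemma in_uP {s} {k : 'I_s -> nat} (X : 'M[R[i]]_(\sum_i k i)) :
  in_u X <-> adjmx X = - X.
Proof.
rewrite /in_u; split=> [/is_hermitianmxP|H].
  by rewrite expr1 scaleN1r => {2}->; rewrite opprK.
by apply/is_hermitianmxP; rewrite expr1 scaleN1r H opprK.
Qed.

Lemma unitarymxPl {n} (X : 'M[R[i]]_n) : reflect (adjmx X *m X = 1%:M) (X \is unitarymx).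
Proof.
apply: (iffP unitarymxP) => [/mulmx1C//|H].
exact: mulmx1C.
Qed.

Lemma in_mP {s} {k : 'I_s -> nat} (X : 'M[R[i]]_(\sum_i k i)) :
  in_m X <-> adjmx X = - X /\ bk (@blk s k) X = 0.
Proof.
rewrite /in_m -kpartE; split=> -[/in_uP X1 X2]; split=> //.
  apply/mxblockP => i j; rewrite mxblockK submxblock0.
  by case: eqP => [->|].
move=> i; have : submxblock (kpart X) i i = 0 by rewrite X2 submxblock0.
by rewrite mxblockK eqxx.
Qed.

End UnitaryAlgebra.

Section Frames.
Context {R : realType} {s : nat} (k : 'I_s -> nat) (mu : 'I_s -> R).
Local Notation n := (\sum_i k i)%N.

(** [is_frame] asks smoothness of [E] only; that of [Q] follows from [Q = E_x E^*]. *)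
Lemma frame_jet_derivable (c E Q : R -> 'M[R[i]]_n) : is_frame mu c E Q ->
  jet_derivable Q.
Proof.
move=> [CE UE _ EQ _].
have oT : open ([set: R] : set R) := openT.
have CE2 := smooth1_mx_smooth2_mx oT CE.
have CQ2 := smooth2_mxM oT (smooth2_mx_dx oT CE2) (smooth2_mx_adj oT CE2).
have -> : Q = (fun x t => dx (fun x _ => E x) x t *m adjmx (E x)) ^~ 0.
  apply/funext => x; rewrite /dx EQ -mulmxA.
  by rewrite (unitarymxP (UE x)) mulmx1.
exact: (smooth2_jet_derivable oT (t := 0) CQ2).
Qed.

Lemma frame_derive (c E Q : R -> 'M[R[i]]_n) x : is_frame mu c E Q ->
  is_mxderive E x (Q x *m E x).
Proof.
move=> [CE UE _ EQ _].
have oT : open ([set: R] : set R) := openT.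
have := smooth2_mx_is_dx x (smooth1_mx_smooth2_mx oT CE) (I : setT 0).
by rewrite /dx EQ.
Qed.

End Frames.

(** * Frames of a curve *)

Section ConjugationAlgebra.
Context {S : comNzRingType} {n : nat} (E F : 'M[S]_n).
Hypotheses (EF : E *m F = 1%:M) (FE : F *m E = 1%:M).
Implicit Types X Y Q D W U : 'M[S]_n.

Lemma conj_mulmx X Y :
  (F *m X *m E) *m (F *m Y *m E) = F *m (X *m Y) *m E.
Proof. by rewrite !mulmxA -(mulmxA _ E F) EF mulmx1. Qed.

Lemma conj_comm X Y : (F *m X *m E) *m (F *m Y *m E)
  - (F *m Y *m E) *m (F *m X *m E) = F *m (X *m Y - Y *m X) *m E.
Proof. by rewrite !conj_mulmx mulmxBr mulmxBl. Qed.

Lemma conj_derive Q X D : (- (F *m Q) *m X + F *m D) *m E + F *m X *m (Q *m E) =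
  F *m (D - (Q *m X - X *m Q)) *m E.
Proof. by mx_ring. Qed.

Lemma conj_dressing Q X D U :
  F *m (D - (Q *m X - X *m Q)) *m E - F *m (X *m Q) *m E + F *m U *m E =
  F *m (D - Q *m X + U) *m E.
Proof. by mx_ring. Qed.

End ConjugationAlgebra.

Section SpectralProjections.
Context {C : fieldType} {n s : nat} (blk : 'I_n -> 'I_s) (c : 'I_s -> C).
Hypothesis c_inj : injective c.
Local Notation M := 'M[C]_n.
Local Notation w := (bw (idfun : {rmorphism C -> C}) blk c).
Implicit Types (A X E F : M) (f : 'I_s -> C).

(* Lagrange interpolation: the projection onto the eigenspace of A for c i,
   along the others, as a polynomial in A. *)
Definition spectral A i : M :=
  \prod_(j | j != i) ((c i - c j)^-1 *: (A - (c j)%:M)).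

Definition spectral_diag A X : M :=
  \sum_i spectral A i *m X *m spectral A i.

(** For [A] conjugate to [omega], the inverse of [ad A] on its image, extended by [0] to the
    commutant. With [spectral_diag] it transports [bJ] and [bk] without reference to the conjugating
    matrix. *)
Definition spectral_ad_inv A X : M :=
  \sum_i \sum_(j | j != i)
    (c i - c j)^-1 *: (spectral A i *m X *m spectral A j).

Definition block_scalar f : M :=
  \matrix_(a, b) (if a == b then f (blk a) else 0).

Lemma block_scalar_mulE f X a b : (block_scalar f *m X) a b = f (blk a) * X a b.
Proof.
rewrite mxE (bigD1 a)//= big1 ?addr0 ?mxE ?eqxx// => i ia.
by rewrite mxE eq_sym (negbTE ia) mul0r.
Qed.

Lemma mul_block_scalarE f X a b : (X *m block_scalar f) a b = X a b * f (blk b).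
Proof.
rewrite mxE (bigD1 b)//= big1 ?addr0 ?mxE ?eqxx// => i ib.
by rewrite mxE (negbTE ib) mulr0.
Qed.

Lemma block_scalar_prod (r : seq 'I_s) (P : pred 'I_s) (f : 'I_s -> 'I_s -> C) :
  \prod_(j <- r | P j) block_scalar (f j) =
  block_scalar (fun l => \prod_(j <- r | P j) f j l).
Proof.
elim: r => [|j r IH].
  rewrite big_nil; apply/matrixP => a b; rewrite !mxE big_nil.
  by case: eqP.
rewrite big_cons IH; apply/matrixP => a b; case: ifP => Pj; last first.
  by rewrite !mxE big_cons Pj.
by rewrite -mulmxE block_scalar_mulE !mxE big_cons Pj; case: eqP; rewrite ?mulr0.
Qed.

Lemma spectral_w i : spectral w i = block_scalar (fun l => (l == i)%:R).
Proof.
rewrite /spectral (eq_bigr (fun j =>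
    block_scalar (fun l => (c i - c j)^-1 * (c l - c j)))); last first.
  move=> j _; apply/matrixP => a b; rewrite !mxE.
  by case: eqP => [->|]; rewrite ?mulr1n ?mulr0n ?subrr ?mulr0.
rewrite block_scalar_prod; apply/matrixP => a b; rewrite !mxE.
case: eqP => // _; have [->|li] := eqVneq (blk a) i.
  rewrite big1// => j ji; rewrite mulVf// subr_eq0 eq_sym.
  by apply: contra ji => /eqP/c_inj ->.
by rewrite (bigD1 (blk a))//= subrr mulr0 mul0r.
Qed.

Lemma spectral_diag_w X : spectral_diag w X = bk blk X.
Proof.
apply/matrixP => a b; rewrite /spectral_diag summxE bkE.
under eq_bigr do rewrite spectral_w mul_block_scalarE block_scalar_mulE.
rewrite (bigD1 (blk a))//= eqxx mul1r big1 ?addr0 => [|i ia].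
  by rewrite eq_sym; case: eqP; rewrite ?mulr1 ?mulr0.
by rewrite eq_sym (negbTE ia) !mul0r.
Qed.

Lemma spectral_ad_inv_w X :
  spectral_ad_inv w X = bJ (idfun : {rmorphism C -> C}) blk c X.
Proof.
apply/matrixP => a b; rewrite /spectral_ad_inv summxE bJE.
have E i j : ((c i - c j)^-1 *: (spectral w i *m X *m spectral w j)) a b =
    (c i - c j)^-1 * ((blk a == i)%:R * X a b * (blk b == j)%:R).
  by rewrite mxE !spectral_w mul_block_scalarE block_scalar_mulE.
under eq_bigr do (rewrite summxE; under eq_bigr do rewrite E).
rewrite (bigD1 (blk a))//= [X in _ + X]big1 ?addr0; last first.
  move=> i ia; rewrite big1// => j _.
  by rewrite eq_sym (negbTE ia) !mul0r mulr0.
have [ab|ab] := eqVneq (blk a) (blk b).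
  rewrite big1// => j ja; rewrite -ab eq_sym (negbTE ja) !mulr0//.
rewrite (bigD1 (blk b)) 1?eq_sym//= !eqxx mul1r mulr1 big1 ?addr0//.
by move=> j /andP[_ jb]; rewrite [blk b == j]eq_sym (negbTE jb) !mulr0.
Qed.

Section Conjugation.
Variables E F : M.
Hypotheses (EF : E *m F = 1%:M) (FE : F *m E = 1%:M).
Local Notation conj X := (F *m X *m E).

Lemma spectral_conj A i : spectral (conj A) i = conj (spectral A i).
Proof.
rewrite /spectral (big_morph (fun X => conj X) (id1 := 1) (op1 := *%R)).
- apply: eq_bigr => j _; rewrite -scalemxAr -scalemxAl mulmxBr mulmxBl.
  by rewrite mul_mx_scalar -scalemxAl FE scalemx1.
- by move=> X Y; exact: esym (conj_mulmx EF X Y).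
- by rewrite -[1]/(1%:M : M) mulmx1.
Qed.

Lemma spectral_diag_conj A X : spectral_diag (conj A) (conj X) = conj (spectral_diag A X).
Proof.
rewrite /spectral_diag mulmx_sumr mulmx_suml; apply: eq_bigr => i _.
by rewrite spectral_conj !(conj_mulmx EF).
Qed.

Lemma spectral_ad_inv_conj A X :
  spectral_ad_inv (conj A) (conj X) = conj (spectral_ad_inv A X).
Proof.
rewrite /spectral_ad_inv mulmx_sumr mulmx_suml; apply: eq_bigr => i _.
rewrite mulmx_sumr mulmx_suml; apply: eq_bigr => j _.
by rewrite !spectral_conj !(conj_mulmx EF) -scalemxAr -scalemxAl.
Qed.

End Conjugation.

End SpectralProjections.

Section SpectralSmooth.
Context {R : realType} {I : set R} {n s : nat} (c : 'I_s -> R[i]).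
Hypothesis oI : open I.
Implicit Types A X : R -> R -> 'M[R[i]]_n.

Lemma smooth2_mx_conv (f g : nat -> R -> R -> 'M[R[i]]_n) j :
  (forall i, (i <= j)%N -> smooth2_mx I (f i)) ->
  (forall i, (i <= j)%N -> smooth2_mx I (g i)) ->
  smooth2_mx I (fun x t => conv (fun i => f i x t) (fun i => g i x t) j).
Proof.
move=> Cf Cg; apply: smooth2_mx_sum => // i _; apply: smooth2_mxM => //.
  by apply: Cf; rewrite -ltnS.
by apply: Cg; rewrite leq_subr.
Qed.

Lemma smooth2_mx_spectral A i : smooth2_mx I A ->
  smooth2_mx I (fun x t => spectral c (A x t) i).
Proof.
move=> CA; rewrite /spectral; elim: (index_enum _) => [|j r IH].
  by apply: (smooth2_mx_congr oI _ (smooth2_mx_cst oI 1)) => x t _; rewrite big_nil.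
case ij : (j != i).
  apply: (smooth2_mx_congr oI (A := fun x t => (c i - c j)^-1 *:
    (A x t + - (c j)%:M) *m \prod_(j <- r | j != i) ((c i - c j)^-1 *: (A x t - (c j)%:M)))).
    by move=> x t _; rewrite big_cons ij mulmxE.
  apply: smooth2_mxM => //; apply: smooth2_mxZ => //; apply: smooth2_mxD => //.
  exact: smooth2_mx_cst.
by apply: (smooth2_mx_congr oI _ IH) => x t _; rewrite big_cons ij.
Qed.

Lemma smooth2_mx_spectral_diag A X : smooth2_mx I A -> smooth2_mx I X ->
  smooth2_mx I (fun x t => spectral_diag c (A x t) (X x t)).
Proof.
move=> CA CX; apply: smooth2_mx_sum => // i _; apply: smooth2_mxM => //.
  by apply: smooth2_mxM => //; exact: smooth2_mx_spectral.
exact: smooth2_mx_spectral.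
Qed.

Lemma smooth2_mx_spectral_ad_inv A X : smooth2_mx I A -> smooth2_mx I X ->
  smooth2_mx I (fun x t => spectral_ad_inv c (A x t) (X x t)).
Proof.
move=> CA CX; apply: smooth2_mx_sum => // i _; apply: smooth2_mx_sum => // j _.
apply: smooth2_mxZ => //; apply: smooth2_mxM => //.
  by apply: smooth2_mxM => //; exact: smooth2_mx_spectral.
exact: smooth2_mx_spectral.
Qed.

End SpectralSmooth.

Lemma is_mxderive_conj (R : realType) n (E X : R -> 'M[R[i]]_n) Q D x :
  is_mxderive E x (Q *m E x) -> adjmx Q = - Q -> is_mxderive X x D ->
  is_mxderive (fun y => adjmx (E y) *m X y *m E y) x
    (adjmx (E x) *m (D - (Q *m X x - X x *m Q)) *m E x).
Proof.
move=> Ed Qskew Xd.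
apply: (is_mxderive_eq (is_mxderiveM (is_mxderiveM (is_mxderive_adj Ed) Xd) Ed)).
by rewrite adjmxM Qskew mulmxN; exact: conj_derive.
Qed.

Section MovingFrame.
Context {R : realType} {s : nat} (k : 'I_s -> nat) (mu : 'I_s -> R).
Hypothesis mu_inj : injective mu.
Local Notation n := (\sum_i k i)%N.
Local Notation M := 'M[R[i]]_n.
Local Notation K := (bk (@blk s k)).
Local Notation J := (@bJ R[i] R[i] idfun n s (@blk s k) (cc mu)).
Local Notation w := (@bw R[i] R[i] idfun n s (@blk s k) (cc mu)).
Local Notation nu Q j := (dpeval_mx Q (FK_V k mu j)).

(** Satisfied both by the frames that [LIE_solution] gives at single times and by the time slices of
    the frame built in the converse direction, so that the covariants can be evaluated in either. *)
Record moving_frame (A E Q : R -> M) : Prop := MovingFrame {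
  mf_unitary : forall x, E x \is unitarymx;
  mf_orbit : forall x, A x = adjmx (E x) *m w *m E x;
  mf_derive : forall x, is_mxderive E x (Q x *m E x);
  mf_jet : jet_derivable Q;
  mf_skew : forall x, adjmx (Q x) = - Q x;
  mf_diag : forall x, K (Q x) = 0 }.

Lemma is_frame_moving_frame (c E Q : R -> M) : is_frame mu c E Q ->
  moving_frame (mxderive c) E Q.
Proof.
move=> F; have [_ UE cE _ mQ] := F; split=> [||x||x|x].
- exact: UE.
- by move=> x; rewrite cE omegaE invmx_unitary.
- exact: frame_derive F.
- exact: frame_jet_derivable F.
- by have /in_mP[] := mQ x.
- by have /in_mP[] := mQ x.
Qed.

Section Consequences.
Variables A E Q : R -> M.
Hypothesis FR : moving_frame A E Q.
Local Notation F x := (adjmx (E x)).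
Local Notation pull x X := (F x *m X *m E x).

Lemma mf_EF x : E x *m F x = 1%:M.
Proof. exact/unitarymxP/(mf_unitary FR). Qed.

Lemma mf_FE x : F x *m E x = 1%:M.
Proof. exact: mulmx1C (mf_EF x). Qed.

Lemma pull_derive (X : R -> M) x D : is_mxderive X x D ->
  is_mxderive (fun y => pull y (X y)) x
    (pull x (D - (Q x *m X x - X x *m Q x))).
Proof.
exact: is_mxderive_conj (mf_derive FR x) (mf_skew FR x).
Qed.

Lemma mf_FK : exists tau, FK_eval mu Q tau (fun j => nu Q j).
Proof.
have [tau tauP] := exists_FK_eval k mu_inj.
by exists (tau Q); apply: tauP; [exact: mf_jet FR|exact: mf_diag FR].
Qed.

(** Differentiating the frame contributes [- [Q, V_j]] inside the conjugation, which leaves only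
    [[omega, V_(j+1)]] of the zero-curvature relation. *)
Lemma mf_pull_nu_derive j x : is_mxderive (fun y => pull y (nu Q j y)) x
  (A x *m pull x (nu Q j.+1 x) - pull x (nu Q j.+1 x) *m A x).
Proof.
have [tau FK] := mf_FK.
apply: (is_mxderive_eq (pull_derive (FK_nu_derive FK j x))).
rewrite (mf_orbit FR) (conj_comm (mf_EF x)); congr (_ *m _ *m _).
by rewrite addrAC subrr add0r.
Qed.

Lemma mf_nu_skew j x : adjmx (nu Q j x) = - nu Q j x.
Proof. by have [tau FK] := mf_FK; exact: FK_nu_skew FK (mf_skew FR) j x. Qed.

Lemma mf_orbit_derive x :
  is_mxderive A x (A x *m pull x (Q x) - pull x (Q x) *m A x).
Proof.
have -> : A = fun y => pull y w by apply/funext => y; exact: mf_orbit FR y.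
apply: (is_mxderive_eq (pull_derive (is_mxderive_cst w x))).
rewrite (conj_comm (mf_EF x)); congr (_ *m _ *m _).
by rewrite sub0r opprB.
Qed.

(** Kernel and image of [ad A] meet only in [0]. After conjugation to [omega], the matrix [Z] is
    block diagonal because it commutes with [omega], and has zero diagonal blocks because it is a
    commutator. *)
Lemma mf_comm_square0 x U :
  let Z := A x *m U - U *m A x in A x *m Z = Z *m A x -> Z = 0.
Proof.
move=> Z AZ; pose push X := E x *m X *m F x.
have pushK X : pull x (push X) = X.
  rewrite /push !mulmxA mf_FE mul1mx -mulmxA mf_FE mulmx1//.
have pushM X Y : push X *m push Y = push (X *m Y).
  by rewrite /push !mulmxA -(mulmxA _ (F x) (E x)) mf_FE mulmx1.
have pA : push (A x) = w.
  by rewrite /push (mf_orbit FR) !mulmxA mf_EF mul1mx -mulmxA mf_EF mulmx1.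
have pZ : push Z = w *m push U - push U *m w.
  by rewrite -pA !pushM /push /Z; mx_ring.
have KZ : K (push Z) = push Z.
  apply: (@bk_comm0 _ _ idfun _ _ _ _ (cc_inj mu_inj)).
  by rewrite -pA !pushM AZ.
by rewrite -(pushK Z) -KZ pZ bk_comm mulmx0 mul0mx.
Qed.

End Consequences.

(* The conjugates by E of Q and of V_j[Q] are polynomials in A and its
   x-derivatives: they do not depend on the frame, and are smooth in t although
   frames are chosen for each t separately. *)
Theorem covariants (I : set R) (A : R -> R -> M) : open I -> smooth2_mx I A ->
  exists (P Y : R -> R -> M) (V : nat -> R -> R -> M),
    [/\ smooth2_mx I P, smooth2_mx I Y, forall j, smooth2_mx I (V j)
      & forall t E Q, moving_frame (A ^~ t) E Q -> forall x,
        [/\ P x t = adjmx (E x) *m Q x *m E x,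
            P x t = A x t *m Y x t - Y x t *m A x t
          & forall j, V j x t = adjmx (E x) *m nu Q j x *m E x]].
Proof.
move=> oI CA.
pose inv X x t := spectral_ad_inv (cc mu) (A x t) (X x t).
(* [A_x = [A, P]], and [Q] has no diagonal blocks; together these determine [P] from [A]. *)
pose P := inv (dx A).
(* The dressing recursion conjugated by the frame. Since [T_x] corresponds to [tau_x - [Q, tau]],
   the terms [tau_x - Q tau] become [T_x - T P]. *)
pose step (T : nat -> R -> R -> M) j : R -> R -> M := inv (fun x t =>
  dx (T j) x t - T j x t *m P x t + conv (fun i => T i x t)
    (fun i => spectral_diag (cc mu) (A x t) (P x t *m T i x t)) j).
have [|T [T0 TS]] := @course_of_values _ (fun _ _ => 1%:M) step.
  move=> f g j fg; apply/funext => x; apply/funext => t.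
  rewrite /step /inv (fg j (leqnn j)).
  apply: (congr1 (fun X => spectral_ad_inv (cc mu) (A x t) (_ + X))).
  by apply: eq_conv => i ij; rewrite (fg i ij).
(* The recursion solves [V T = T A] one coefficient at a time. *)
have [|V [V0 VS]] := @course_of_values _ A (fun V j x t =>
    T j.+1 x t *m A x t - conv (fun i => V i x t) (fun i => T i.+1 x t) j).
  move=> f g j fg; apply/funext => x; apply/funext => t; congr (_ - _).
  by apply: eq_conv => // i ij; rewrite (fg i ij).
have Cinv X : smooth2_mx I X -> smooth2_mx I (inv X).
  by move=> CX; exact: smooth2_mx_spectral_ad_inv.
have CP : smooth2_mx I P by apply: Cinv; exact: smooth2_mx_dx.
have CT j : smooth2_mx I (T j).
  have [m] := ubnP j; elim: m j => // m IH [|j]; rewrite ltnS => jm.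
    by rewrite T0; exact: smooth2_mx_cst.
  have CTi i : (i <= j)%N -> smooth2_mx I (T i).
    by move=> ij; apply: IH; exact: leq_ltn_trans ij jm.
  rewrite TS; apply: Cinv; apply: smooth2_mxD => //; first apply: smooth2_mxD => //.
  - by apply: smooth2_mx_dx => //; exact: CTi.
  - by apply: smooth2_mxN => //; apply: smooth2_mxM => //; exact: CTi.
  - apply: (smooth2_mx_conv oI (f := T) (g := fun i x t =>
      spectral_diag (cc mu) (A x t) (P x t *m T i x t))) => // i ij.
    apply: smooth2_mx_spectral_diag => //; apply: smooth2_mxM => //.
    exact: CTi.
have CV j : smooth2_mx I (V j).
  have [m] := ubnP j; elim: m j => // m IH [|j]; rewrite ltnS => jm.
    by rewrite V0.
  rewrite VS; apply: smooth2_mxD => //; first exact: smooth2_mxM.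
  apply: smooth2_mxN => //.
  apply: (smooth2_mx_conv oI (f := V) (g := fun i => T i.+1)) => // i ij.
  by apply: IH; exact: leq_ltn_trans ij jm.
exists P, (inv P), V; split; [exact: CP|exact: Cinv|exact: CV|].
move=> t E Q FR x; have [tau FK] := mf_FK FR.
pose pull y X := adjmx (E y) *m X *m E y.
have pullM' y X Y : pull y X *m pull y Y = pull y (X *m Y) by exact: conj_mulmx (mf_EF FR y) X Y.
have AE y : A y t = pull y w := mf_orbit FR y.
have invE X y Z : X y t = pull y Z -> inv X y t = pull y (J Z).
  move=> XZ; rewrite /inv XZ AE spectral_ad_inv_conj ?spectral_ad_inv_w//.
  - exact: cc_inj.
  - exact: mf_EF FR y.
  - exact: mf_FE FR y.
have diagE y Z : spectral_diag (cc mu) (A y t) (pull y Z) = pull y (K Z).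
  rewrite AE spectral_diag_conj ?spectral_diag_w//.
  - exact: cc_inj.
  - exact: mf_EF FR y.
  - exact: mf_FE FR y.
have PE y : P y t = pull y (Q y).
  apply: etrans (invE (dx A) y (w *m Q y - Q y *m w) _) _.
    apply: etrans (is_mxderive_val (mf_orbit_derive FR y)) _.
    by rewrite (mf_orbit FR) (conj_comm (mf_EF FR y)).
  by rewrite bJ_comm ?(mf_diag FR) ?subr0//; exact: cc_inj.
have TE j y : T j y t = pull y (tau j y).
  have [m] := ubnP j; elim: m j y => // m IH [|j] y; rewrite ltnS => jm.
    by rewrite T0 (FK_tau0 FK) /pull mulmx1 (mf_FE FR).
  have TiE i z : (i <= j)%N -> T i z t = pull z (tau i z).
    by move=> ij; apply: IH; exact: leq_ltn_trans ij jm.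
  rewrite TS (FK_tauS FK); apply: invE.
  have -> : dx (T j) y t = pull y (mxderive (tau j) y - (Q y *m tau j y - tau j y *m Q y)).
    apply: etrans (is_mxderive_val (pull_derive FR (FK_tau_derive FK j y))).
    by congr (mxderive _ y); apply/funext => z; exact: TiE.
  rewrite TiE// PE pullM' /eval_rhs.
  have -> : conv (fun i => T i y t)
      (fun i => spectral_diag (cc mu) (A y t) (pull y (Q y) *m T i y t)) j =
      pull y (conv (tau ^~ y) (fun i => K (Q y *m tau i y)) j).
    rewrite /pull /conv mulmx_sumr mulmx_suml; apply: eq_bigr => i _.
    have ij : (i <= j)%N by rewrite -ltnS.
    by rewrite !TiE ?leq_subr// pullM' diagE; exact: pullM'.
  exact: conj_dressing.
split.
- exact: PE.
- rewrite (invE _ _ _ (PE x)) PE AE /pull (conj_comm (mf_EF FR x)).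
  congr (_ *m _ *m _); apply: esym; apply: comm_bJ; first exact: cc_inj.
  exact: mf_diag FR x.
(* Multiplied by [T], both series give [T A]; cancelling [T] identifies them. *)
- move=> j; apply/subr0_eq.
  apply: (@conv_eq0 _ _ (fun j => V j x t - pull x (nu Q j x)) (fun j => T j x t)).
    by rewrite T0.
  move=> i _; rewrite convDl convNl; apply/eqP; rewrite subr_eq0; apply/eqP.
  have -> : conv (fun j => V j x t) (fun j => T j x t) i = T i x t *m A x t.
    case: i => [|i].
      by rewrite /conv big_ord_recl big_ord0 addr0 V0 T0 mulmx1 mul1mx.
    by rewrite convSr T0 mulmx1 VS addrC subrK.
  rewrite TE AE pullM' -(FK_dressed FK) /pull /conv mulmx_sumr mulmx_suml.
  by apply: eq_bigr => l _; rewrite TE; exact: esym (pullM' _ _ _).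
Qed.

End MovingFrame.

(** * The equivalence *)

Section FordyKulishToLangerPerline.
Context {R : realType} {s : nat} (k : 'I_s -> nat) (mu : 'I_s -> R).
Hypothesis mu_inj : injective mu.
Local Notation n := (\sum_i k i)%N.
Local Notation M := 'M[R[i]]_n.
Local Notation K := (bk (@blk s k)).
Local Notation w := (@bw R[i] R[i] idfun n s (@blk s k) (cc mu)).
Local Notation nu Q j := (dpeval_mx Q (FK_V k mu j)).
Variables (L : nat) (I : set R).
Hypotheses (oI : open I) (iI : is_interval I).

(** The primitive [G] from [mx_poincare] need not be skew-Hermitian. Half the difference of [G] and
    its adjoint has the same derivatives, because [A] and [B] are skew-Hermitian. *)
Lemma curve_of_connection (A B : R -> R -> M) t0 :
  smooth2_mx I A -> smooth2_mx I B -> I t0 ->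
  (forall x t, I t -> dt A x t = dx B x t) ->
  (forall x t, I t -> adjmx (A x t) = - A x t) ->
  (forall x t, I t -> adjmx (B x t) = - B x t) ->
  exists gamma : R -> R -> M, [/\ smooth2_mx I gamma,
    forall x t, adjmx (gamma x t) = - gamma x t,
    forall x t, I t -> dx gamma x t = A x t
    & forall x t, I t -> dt gamma x t = B x t].
Proof.
move=> CA CB It0 AB As Bs.
have [G [CG Gx Gt]] := mx_poincare oI iI CA CB It0 AB.
have half (X : M) : adjmx X = - X -> (2%:R^-1 : R[i]) *: (X - adjmx X) = X.
  by move=> ->; rewrite opprK -mulr2n -(scaler_nat 2 X) scalerA mulVf ?scale1r ?pnatr_eq0//.
exists (fun x t => (2%:R^-1 : R[i]) *: (G x t - adjmx (G x t))); split.
- apply: smooth2_mxZ => //; apply: smooth2_mxD => //; apply: smooth2_mxN => //.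
  exact: smooth2_mx_adj.
- move=> x t; rewrite linearZ /= map_mxZ /= adjmxD adjmxN adjmxK.
  by rewrite fmorphV rmorph_nat -scalerN opprB.
- move=> x t It; rewrite -[RHS](half _ (As x t It)).
  apply: is_mxderive_val; apply: is_mxderiveZ; apply: is_mxderiveB.
    exact: Gx.
  by apply: is_mxderive_adj; exact: Gx.
- move=> x t It; rewrite -[RHS](half _ (Bs x t It)).
  apply: is_mxderive_val; apply: is_mxderiveZ; apply: is_mxderiveB.
    exact: Gt.
  by apply: is_mxderive_adj; exact: Gt.
Qed.

(** Skew coefficients make both derivatives of [F^* F] vanish, so its value at the base point
    spreads over the strip. *)
Lemma frobenius_unitary (A B F : R -> R -> M) t0 : I t0 ->
  (forall x t, I t -> is_mxderive (F ^~ t) x (A x t *m F x t)) ->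
  (forall x t, I t -> is_mxderive (F x) t (B x t *m F x t)) ->
  (forall x t, I t -> adjmx (A x t) = - A x t) ->
  (forall x t, I t -> adjmx (B x t) = - B x t) ->
  F 0 t0 \is unitarymx -> forall x t, I t -> F x t \is unitarymx.
Proof.
move=> It0 Fx Ft As Bs F0 x t It; apply/unitarymxPl.
have D (X Y : M) : adjmx X = - X -> adjmx (X *m Y) *m Y + adjmx Y *m (X *m Y) = 0.
  by move=> Xs; rewrite adjmxM Xs mulmxN mulNmx mulmxA addNr.
apply: etrans (strip_constant_mx (A := fun x t => adjmx (F x t) *m F x t)
  x 0 iI _ _ It It0) _; last exact/unitarymxPl.
- move=> y r Ir; have Fd := Fx y r Ir.
  by apply: (is_mxderive_eq (is_mxderiveM (is_mxderive_adj Fd) Fd)); exact: D (As _ _ Ir).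
- move=> y r Ir; have Fd := Ft y r Ir.
  by apply: (is_mxderive_eq (is_mxderiveM (is_mxderive_adj Fd) Fd)); exact: D (Bs _ _ Ir).
Qed.

Lemma FK_solution_LIE (Q : R -> R -> M) t0 : I t0 ->
  smooth2_mx I Q -> (forall x t, I t -> in_m (Q x t)) ->
  FK_solution mu (L + 2) I Q ->
  exists E gamma : R -> R -> M,
    [/\ smooth2_mx I E /\ (forall x t, I t -> E x t \is unitarymx),
        smooth2_mx I gamma /\ (forall x t, I t -> in_u (gamma x t)),
        (forall x t, I t -> dx E x t = Q x t *m E x t),
        (forall x t, I t ->
           dx gamma x t = invmx (E x t) *m omega k mu *m E x t)
      & LIE_solution mu L I gamma].
Proof.
move=> It0 CQ Qm QL.
have Qs x t : I t -> adjmx (Q x t) = - Q x t by move=> It; case/in_mP: (Qm x t It).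
have QK x t : I t -> K (Q x t) = 0 by move=> It; case/in_mP: (Qm x t It).
pose V j x t := nu (Q ^~ t) j x.
have CV j : smooth2_mx I (V j) by exact: smooth2_dpeval_mx.
have FKt t : I t -> exists tau, FK_eval mu (Q ^~ t) tau (fun j => nu (Q ^~ t) j).
  move=> It; have [tau tauP] := exists_FK_eval k mu_inj.
  exists (tau (Q ^~ t)); apply: tauP => [|x]; last exact: QK.
  exact: (smooth2_jet_derivable oI CQ It).
have Vs j x t : I t -> adjmx (V j x t) = - V j x t.
  move=> It; have [tau FK] := FKt t It.
  by apply: (FK_nu_skew mu_inj FK) => y; exact: Qs.
have Vx j x t : I t -> is_mxderive (V j ^~ t) x
    (Q x t *m V j x t - V j x t *m Q x t + (w *m V j.+1 x t - V j.+1 x t *m w)).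
  by move=> It; have [tau FK] := FKt t It; exact: FK_nu_derive FK j x.
(* The zero-curvature relation of index [L + 1] turns [[omega, V_(L+2)]] into [D V_(L+1) -
   [Q, V_(L+1)]], and the equation for [Q] into the compatibility of the linear system for [E]. *)
have ZC x t : I t -> dt Q x t + Q x t *m V L.+1 x t =
    dx (V L.+1) x t + V L.+1 x t *m Q x t.
  move=> It; rewrite (QL x t It) addn2 omegaE /dx (is_mxderive_val (Vx L.+1 x t It)).
  have alg (X Y Z : M) : Z + X = X - Y + Z + Y by rewrite addrAC subrK addrC.
  exact: alg.
have [E [CE E0 Ex Et]] := mx_frobenius oI iI 1%:M CQ (CV L.+1) ZC It0.
have UE x t : I t -> E x t \is unitarymx.
  move=> It; apply: (frobenius_unitary It0 Ex Et Qs (Vs L.+1) _ x It).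
  by rewrite E0; apply/unitarymxP; rewrite adjmx1 mulmx1.
pose A x t := adjmx (E x t) *m w *m E x t.
pose B x t := adjmx (E x t) *m V L x t *m E x t.
have conj_smooth X : smooth2_mx I X ->
    smooth2_mx I (fun x t => adjmx (E x t) *m X x t *m E x t).
  move=> CX; apply: smooth2_mxM => //; apply: smooth2_mxM => //.
  exact: smooth2_mx_adj.
have conj_skew (X Y : M) : adjmx X = - X ->
    adjmx (adjmx Y *m X *m Y) = - (adjmx Y *m X *m Y).
  by move=> Xs; rewrite !adjmxM adjmxK Xs mulNmx mulmxN mulmxA.
have CA : smooth2_mx I A by apply: (conj_smooth (fun _ _ => w)); exact: smooth2_mx_cst.
have CB : smooth2_mx I B by exact: conj_smooth.
(* Both sides equal [E^* [omega, V_(L+1)] E]: the left one by [E_t = V_(L+1) E], the right one by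
   the zero-curvature relation of index [L]. *)
have AB x t : I t -> dt A x t = dx B x t.
  move=> It; rewrite /dt /dx.
  rewrite (is_mxderive_val (is_mxderive_conj (Et x t It) (Vs L.+1 x t It)
    (is_mxderive_cst w t))).
  rewrite (is_mxderive_val (is_mxderive_conj (Ex x t It) (Qs x t It) (Vx L x t It))).
  apply: (congr1 (fun X => adjmx (E x t) *m X *m E x t)).
  by rewrite sub0r opprB addrAC subrr add0r.
have [x t It|x t It|gamma [Cg gs gx gt]] := curve_of_connection CA CB It0 AB.
- by apply: conj_skew; exact: adj_w.
- by apply: conj_skew; exact: Vs.
have gx' x t : I t -> dx gamma x t = invmx (E x t) *m omega k mu *m E x t.
  by move=> It; rewrite (gx x t It) omegaE (invmx_unitary (UE x t It)).
exists E, gamma; split.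
- by split.
- by split=> // x t It; apply/in_uP; exact: gs.
- by move=> x t It; exact: is_mxderive_val (Ex x t It).
- exact: gx'.
- move=> t It; exists (E ^~ t), (Q ^~ t); split; first split.
  + exact: smooth2_mx_smooth1_mx CE It.
  + by move=> x; exact: UE.
  + by move=> x; exact: gx'.
  + by move=> x; exact: is_mxderive_val (Ex x t It).
  + by move=> x; exact: Qm.
  + move=> x; rewrite (gt x t It) (invmx_unitary (UE x t It)).
    by rewrite (LP_X_iter k mu_inj).
Qed.

End FordyKulishToLangerPerline.

Section CommutatorIdentities.
Context {S : comNzRingType} {n : nat}.
Implicit Types A P N Y X E F : 'M[S]_n.

(** The hypothesis equates the mixed derivatives of [A] computed from [A_x = [A, P]] and [A_t =
    [A, N]]; the double brackets combine by the Jacobi identity. *)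
Lemma mixed_comm A P N Pt Nx :
  ((A *m N - N *m A) *m P + A *m Pt) - (Pt *m A + P *m (A *m N - N *m A)) =
  ((A *m P - P *m A) *m N + A *m Nx) - (Nx *m A + N *m (A *m P - P *m A)) ->
  A *m (Nx - Pt - (N *m P - P *m N)) = (Nx - Pt - (N *m P - P *m N)) *m A.
Proof.
move=> H; apply/eqP; rewrite -subr_eq0 -(subrr ((A *m P - P *m A) *m N + A *m Nx
  - (Nx *m A + N *m (A *m P - P *m A)))) -{2}H; apply/eqP.
by mx_ring.
Qed.

(** With [N_x = [A, V]], [P = [A, Y]] and [A_t = [A, N]], the Leibniz rule of [ad A] on [[N, Y]]
    displays the curvature as a commutator with [A]. *)
Lemma curvature_comm A N Y Yt V :
  A *m V - V *m A - (((A *m N - N *m A) *m Y + A *m Yt) -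
    (Yt *m A + Y *m (A *m N - N *m A)))
  - (N *m (A *m Y - Y *m A) - (A *m Y - Y *m A) *m N) =
  A *m (V - Yt - (N *m Y - Y *m N)) - (V - Yt - (N *m Y - Y *m N)) *m A.
Proof. by mx_ring. Qed.

Lemma zero_curvature_neg P N Pt Nx : Nx - Pt - (N *m P - P *m N) = 0 ->
  - Pt + - P *m - N = - Nx + - N *m - P.
Proof.
move=> H; apply/eqP; rewrite -subr_eq0 -H; apply/eqP.
by mx_ring.
Qed.

(** The derivative of [E A F] in [x], and also in [t] with [N] in the place of [P]. *)
Lemma conj_const_x E F P A :
  E *m P *m A *m F + E *m (A *m P - P *m A) *m F + E *m A *m (- P *m F) = 0.
Proof. by mx_ring. Qed.

(** This is [Q_t] for [Q = E P F] with [E_t = E N] and [F_t = - N F]; flatness replaces [P_t +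
    [N, P]] by [N_x]. *)
Lemma conj_flat E F P N Pt Nx : Nx - Pt - (N *m P - P *m N) = 0 ->
  (E *m N *m P + E *m Pt) *m F + E *m P *m (- N *m F) = E *m Nx *m F.
Proof.
move=> H; have -> : Nx = Pt + (N *m P - P *m N).
  by apply/eqP; rewrite -subr_eq0 opprD addrA H.
by mx_ring.
Qed.

End CommutatorIdentities.

Section LangerPerlineToFordyKulish.
Context {R : realType} {s : nat} (k : 'I_s -> nat) (mu : 'I_s -> R).
Hypothesis mu_inj : injective mu.
Local Notation n := (\sum_i k i)%N.
Local Notation M := 'M[R[i]]_n.
Local Notation K := (bk (@blk s k)).
Local Notation w := (@bw R[i] R[i] idfun n s (@blk s k) (cc mu)).
Local Notation nu Q j := (dpeval_mx Q (FK_V k mu j)).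
Variables (L : nat) (I : set R).
Hypotheses (oI : open I) (iI : is_interval I).

Lemma LIE_solution_FK (gamma : R -> R -> M) t0 : I t0 ->
  smooth2_mx I gamma ->
  (forall x t, I t -> in_orbit mu (dx gamma x t)) ->
  LIE_solution mu L I gamma ->
  exists E Q : R -> R -> M,
    [/\ smooth2_mx I E /\ (forall x t, I t -> E x t \is unitarymx),
        smooth2_mx I Q /\ (forall x t, I t -> in_m (Q x t)),
        (forall x t, I t ->
           dx gamma x t = invmx (E x t) *m omega k mu *m E x t),
        (forall x t, I t -> dx E x t = Q x t *m E x t)
      & FK_solution mu (L + 2) I Q].
Proof.
move=> It0 Cg Og LIE.
pose A := dx gamma.
have CA : smooth2_mx I A by exact: smooth2_mx_dx.
have [P [Y [V [CP CY CV PYV]]]] := covariants mu_inj oI CA.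
(* The frame at each time serves only to verify identities between covariants, in which it no longer
   appears. *)
have frames t : I t -> exists E Q, moving_frame mu (A ^~ t) E Q /\
    forall x, dt gamma x t = V L x t.
  move=> It; have [E [Q [F gt]]] := LIE t It.
  have FR := is_frame_moving_frame F; exists E, Q; split=> // x.
  have [_ _ VE] := PYV t E Q FR x.
  by rewrite (gt x) (VE L) (invmx_unitary (mf_unitary FR x)) (LP_X_iter k mu_inj).
pose N := V L.+1.
have CN : smooth2_mx I N by exact: CV.
have gt x t : I t -> dt gamma x t = V L x t.
  by move=> It; have [E [Q [_ ->]]] := frames t It.
have Vx j x t : I t -> is_mxderive (V j ^~ t) x
    (A x t *m V j.+1 x t - V j.+1 x t *m A x t).
  move=> It; have [E [Q [FR _]]] := frames t It.
  have VE i y : V i y t = adjmx (E y) *m nu Q i y *m E y.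
    by have [_ _ ->] := PYV t E Q FR y.
  rewrite (VE j.+1 x) (_ : V j ^~ t = fun y => adjmx (E y) *m nu Q j y *m E y).
    exact: mf_pull_nu_derive FR j x.
  by apply/funext => y; exact: VE.
have Ax x t : I t -> is_mxderive (A ^~ t) x (A x t *m P x t - P x t *m A x t).
  move=> It; have [E [Q [FR _]]] := frames t It.
  have [PE _ _] := PYV t E Q FR x.
  by rewrite PE; exact: mf_orbit_derive FR x.
have PY x t : I t -> P x t = A x t *m Y x t - Y x t *m A x t.
  move=> It; have [E [Q [FR _]]] := frames t It.
  by have [_ ? _] := PYV t E Q FR x.
have conj_skew (X Z : M) : adjmx X = - X ->
    adjmx (adjmx Z *m X *m Z) = - (adjmx Z *m X *m Z).
  by move=> Xs; rewrite !adjmxM adjmxK Xs mulNmx mulmxN mulmxA.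
have Ps x t : I t -> adjmx (P x t) = - P x t.
  move=> It; have [E [Q [FR _]]] := frames t It.
  by have [-> _ _] := PYV t E Q FR x; apply: conj_skew; exact: mf_skew FR x.
have Ns x t : I t -> adjmx (N x t) = - N x t.
  move=> It; have [E [Q [FR _]]] := frames t It.
  have [_ _ VE] := PYV t E Q FR x; rewrite /N (VE L.+1).
  by apply: conj_skew; exact: (mf_nu_skew mu_inj FR L.+1 x).
have At x t : I t -> is_mxderive (A x) t (A x t *m N x t - N x t *m A x t).
  move=> It; apply: (is_mxderive_eq (smooth2_mx_is_dt x CA It)).
  rewrite /A (schwarz_mx oI x Cg It).
  rewrite /dx (_ : dt gamma ^~ t = V L ^~ t); last first.
    by apply/funext => y; exact: gt.
  exact: is_mxderive_val (Vx L x t It).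
have Px x t : I t -> is_mxderive (P ^~ t) x (dx P x t).
  exact: smooth2_mx_is_dx CP.
have Pt x t : I t -> is_mxderive (P x) t (dt P x t).
  exact: smooth2_mx_is_dt CP.
have Nx x t : I t -> is_mxderive (N ^~ t) x (A x t *m V L.+2 x t - V L.+2 x t *m A x t).
  by move=> It; exact: Vx.
have flat x t : I t -> A x t *m V L.+2 x t - V L.+2 x t *m A x t - dt P x t
    - (N x t *m P x t - P x t *m N x t) = 0.
  move=> It.
  pose Nxx := A x t *m V L.+2 x t - V L.+2 x t *m A x t.
  have Yt := smooth2_mx_is_dt x CY It.
  have PtE : dt P x t = ((A x t *m N x t - N x t *m A x t) *m Y x t + A x t *m dt Y x t)
      - (dt Y x t *m A x t + Y x t *m (A x t *m N x t - N x t *m A x t)).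
    apply: is_mxderive_val.
    apply: (is_mxderive_t_congr oI (A := fun x t => A x t *m Y x t - Y x t *m A x t) It).
      by move=> y r Ir; rewrite PY.
    by apply: is_mxderiveB; apply: is_mxderiveM => //; exact: At.
  have frame0 U : let Z := A x t *m U - U *m A x t in A x t *m Z = Z *m A x t -> Z = 0.
    have [E [Q [FR _]]] := frames t It.
    exact: mf_comm_square0 mu_inj _ _ _ FR x U.
  pose U := V L.+2 x t - dt Y x t - (N x t *m Y x t - Y x t *m N x t).
  have ZE : A x t *m V L.+2 x t - V L.+2 x t *m A x t - dt P x t
      - (N x t *m P x t - P x t *m N x t) = A x t *m U - U *m A x t.
    rewrite PtE (PY x t It); exact: curvature_comm.
  rewrite ZE; apply: frame0; rewrite -ZE; apply: mixed_comm.
  have tx := schwarz_mx oI x CA It.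
  have e1 : dx (dt A) x t = (A x t *m P x t - P x t *m A x t) *m N x t
      + A x t *m Nxx - (Nxx *m A x t + N x t *m (A x t *m P x t - P x t *m A x t)).
    rewrite /dx (_ : dt A ^~ t = fun y => A y t *m N y t - N y t *m A y t); last first.
      by apply/funext => y; exact: is_mxderive_val (At y t It).
    apply: is_mxderive_val; apply: is_mxderiveB; apply: is_mxderiveM;
      [exact: Ax|exact: Nx|exact: Nx|exact: Ax].
  have e2 : dt (dx A) x t = (A x t *m N x t - N x t *m A x t) *m P x t
      + A x t *m dt P x t - (dt P x t *m A x t + P x t *m (A x t *m N x t - N x t *m A x t)).
    apply: is_mxderive_val.
    apply: (is_mxderive_t_congr oI (A := fun x t => A x t *m P x t - P x t *m A x t) It).
      by move=> y r Ir; exact: esym (is_mxderive_val (Ax y r Ir)).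
    apply: is_mxderiveB; apply: is_mxderiveM;
      [exact: At|exact: Pt|exact: Pt|exact: At].
  exact: etrans (esym e2) (etrans tx e1).
have ZC x t : I t -> dt (fun x t => - P x t) x t + (- P x t) *m (- N x t) =
    dx (fun x t => - N x t) x t + (- N x t) *m (- P x t).
  move=> It; rewrite /dt /dx (is_mxderive_val (is_mxderiveN (Pt x t It))).
  rewrite (is_mxderive_val (is_mxderiveN (Nx x t It))).
  exact: zero_curvature_neg (flat x t It).
(* The initial value makes [E = g], hence [E A F = omega], at [(0, t0)]; the left side turns out to
   be constant on the strip. *)
have [g Ug Ag] := Og 0 t0 It0.
have [F [CF F0 Fx Ft]] := mx_frobenius oI iI (adjmx g)
  (smooth2_mxN oI CP) (smooth2_mxN oI CN) ZC It0.
have UF x t : I t -> F x t \is unitarymx.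
  move=> It; apply: (frobenius_unitary iI It0 Fx Ft _ _ _ x It).
  - by move=> y r Ir; rewrite adjmxN Ps.
  - by move=> y r Ir; rewrite adjmxN Ns.
  - by rewrite F0; apply/unitarymxP; rewrite adjmxK; exact/unitarymxPl.
pose E x t := adjmx (F x t).
have CE : smooth2_mx I E by exact: smooth2_mx_adj.
have UE x t : I t -> E x t \is unitarymx.
  by move=> It; apply/unitarymxP; rewrite /E adjmxK; exact/unitarymxPl/UF.
have EF x t : I t -> E x t *m F x t = 1%:M.
  by move=> It; apply/unitarymxPl; exact: UF.
have FE x t : I t -> F x t *m E x t = 1%:M.
  by move=> It; apply: mulmx1C; exact: EF.
have Ex x t : I t -> is_mxderive (E ^~ t) x (E x t *m P x t).
  move=> It; apply: (is_mxderive_eq (is_mxderive_adj (Fx x t It))).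
  by rewrite adjmxM adjmxN Ps// opprK.
have Et x t : I t -> is_mxderive (E x) t (E x t *m N x t).
  move=> It; apply: (is_mxderive_eq (is_mxderive_adj (Ft x t It))).
  by rewrite adjmxM adjmxN Ns// opprK.
have EAF x t : I t -> E x t *m A x t *m F x t = w.
  move=> It; apply: etrans (strip_constant_mx
    (A := fun x t => E x t *m A x t *m F x t) x 0 iI _ _ It It0) _.
  - move=> y r Ir; apply: (is_mxderive_eq (is_mxderiveM
      (is_mxderiveM (Ex y r Ir) (Ax y r Ir)) (Fx y r Ir))).
    by rewrite mulmxDl; exact: conj_const_x.
  - move=> y r Ir; apply: (is_mxderive_eq (is_mxderiveM
      (is_mxderiveM (Et y r Ir) (At y r Ir)) (Ft y r Ir))).
    by rewrite mulmxDl; exact: conj_const_x.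
  - rewrite /E F0 adjmxK /A Ag omegaE (invmx_unitary Ug).
    have gg := unitarymxP Ug.
    by rewrite !mulmxA gg mul1mx -mulmxA gg mulmx1.
have AE x t : I t -> A x t = F x t *m w *m E x t.
  move=> It; rewrite -(EAF x t It) !mulmxA (FE x t It) mul1mx.
  by rewrite -mulmxA (FE x t It) mulmx1.
pose Q x t := E x t *m P x t *m F x t.
have CQ : smooth2_mx I Q by apply: smooth2_mxM => //; exact: smooth2_mxM.
have Qs x t : I t -> adjmx (Q x t) = - Q x t.
  move=> It; have := conj_skew (P x t) (F x t) (Ps x t It).
  by [].
(* [P = [A, Y]] becomes [Q = [omega, E Y F]], which has no diagonal blocks. *)
have QK x t : I t -> K (Q x t) = 0.
  move=> It; rewrite /Q (PY x t It) -(conj_comm (FE x t It)) (EAF x t It).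
  exact: bk_comm.
have EQ x t : I t -> E x t *m P x t = Q x t *m E x t.
  by move=> It; rewrite /Q -mulmxA (FE x t It) mulmx1.
have AE' x t : I t -> A x t = adjmx (E x t) *m w *m E x t.
  by move=> It; rewrite {1}/E adjmxK; exact: AE.
(* The slices of the new frame are moving frames of the same [A], so the covariants evaluate in them
   as well: [E V_(L+2) F] is [V_(L+2)[Q]] for the new [Q]. *)
have FR t : I t -> moving_frame mu (A ^~ t) (E ^~ t) (Q ^~ t).
  move=> It; split.
  - by move=> x; exact: UE.
  - by move=> x; exact: AE'.
  - by move=> x; rewrite -(EQ x t It); exact: Ex.
  - exact: (smooth2_jet_derivable oI CQ It).
  - by move=> x; exact: Qs.
  - by move=> x; exact: QK.
exists E, Q; split.
- by split.
- by split=> // x t It; apply/in_mP; split; [exact: Qs|exact: QK].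
- move=> x t It; rewrite (invmx_unitary (UE x t It)) omegaE; exact: AE'.
- by move=> x t It; rewrite -(EQ x t It); exact: is_mxderive_val (Ex x t It).
- move=> x t It.
  have -> : dt Q x t = E x t *m (A x t *m V L.+2 x t - V L.+2 x t *m A x t) *m F x t.
    apply: is_mxderive_val; apply: (is_mxderive_eq (is_mxderiveM
      (is_mxderiveM (Et x t It) (Pt x t It)) (Ft x t It))).
    exact: conj_flat (flat x t It).
  have [_ _ VE] := PYV t _ _ (FR t It) x.
  rewrite -(conj_comm (FE x t It)) (EAF x t It) (VE L.+2).
  have -> : E x t *m (adjmx (E x t) *m nu (Q ^~ t) L.+2 x *m E x t) *m F x t =
      nu (Q ^~ t) L.+2 x.
    rewrite !mulmxA (unitarymxP (UE x t It)) mul1mx -mulmxA (EF x t It).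
    exact: mulmx1.
  by rewrite addn2 omegaE.
Qed.

End LangerPerlineToFordyKulish.

Unset Implicit Arguments.

Theorem theorem2 (R : realType) (n s : nat) (k : 'I_s -> nat) (mu : 'I_s -> R)
    (hn : (2 <= n)%N) (hs : (2 <= s <= n)%N)
    (hk : forall i, (0 < k i)%N) (hsum : (\sum_i k i)%N = n)
    (hmu : injective mu)
    (L : nat) (hL : (1 <= L)%N)
    (I : set R) (hI : open I) (hI' : is_interval I) :
  (forall Q : R -> R -> 'M[R[i]]_(\sum_i k i),
      smooth2_mx I Q ->
      (forall x t, I t -> in_m (Q x t)) ->
      FK_solution mu (L + 2) I Q ->
      exists E gamma : R -> R -> 'M[R[i]]_(\sum_i k i),
        [/\ smooth2_mx I E /\ (forall x t, I t -> E x t \is unitarymx),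
            smooth2_mx I gamma /\ (forall x t, I t -> in_u (gamma x t)),
            (forall x t, I t -> dx E x t = Q x t *m E x t),
            (forall x t, I t ->
               dx gamma x t = invmx (E x t) *m omega k mu *m E x t)
          & LIE_solution mu L I gamma])
  /\
  (forall gamma : R -> R -> 'M[R[i]]_(\sum_i k i),
      smooth2_mx I gamma ->
      (forall x t, I t -> in_u (gamma x t)) ->
      (forall x t, I t -> in_orbit mu (dx gamma x t)) ->
      LIE_solution mu L I gamma ->
      exists E Q : R -> R -> 'M[R[i]]_(\sum_i k i),
        [/\ smooth2_mx I E /\ (forall x t, I t -> E x t \is unitarymx),
            smooth2_mx I Q /\ (forall x t, I t -> in_m (Q x t)),
            (forall x t, I t ->
               dx gamma x t = invmx (E x t) *m omega k mu *m E x t),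
            (forall x t, I t -> dx E x t = Q x t *m E x t)
          & FK_solution mu (L + 2) I Q]).
Proof.
(* Both constructions start from a base point. For empty [I] every pointwise condition is vacuous
   and zero matrices serve. *)
have [[t0 It0]|I0] := pselect (exists t, I t); last first.
  have noI t (P : Prop) : I t -> P by move=> It; case: I0; exists t.
  have C0 : smooth2_mx I (fun _ _ => 0 : 'M[R[i]]_(\sum_i k i)).
    exact: (smooth2_mx_cst hI).
  split=> [Q _ _ _|gamma _ _ _ _]; exists (fun _ _ => 0), (fun _ _ => 0).
    by split; [split=> // x t /noI; exact|split=> // x t /noI; exact
      |move=> x t /noI; exact|move=> x t /noI; exact|move=> t /noI; exact].
  by split; [split=> // x t /noI; exact|split=> // x t /noI; exact
    |move=> x t /noI; exact|move=> x t /noI; exact|move=> x t /noI; exact].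
split=> [Q CQ Qm QL|gamma Cg _ Og Lg].
  exact: FK_solution_LIE It0 CQ Qm QL.
exact: LIE_solution_FK It0 Cg Og Lg.
Qed.
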